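(* Let $A$ and $B$ be finite graphs and let $A+B$ denote their disjoint union. For all $i,j\ge0$ there is an isomorphism of $\mathfrak S_{A\cup B}$-modules $$H_{i,j}(A+B)\cong\bigoplus_{\substack{p+r=i\\ q+s=j}}\mathrm{Ind}_{\mathfrak S_A\times\mathfrak S_B}^{\mathfrak S_{A\cup B}}\bigl(H_{p,q}(A)\otimes H_{r,s}(B)\bigr),$$ where $\mathfrak S_A,\mathfrak S_B,\mathfrak S_{A\cup B}$ are the symmetric groups on $V(A)$, $V(B)$, $V(A)\sqcup V(B)$, and $H_{*,*}$ is chromatic symmetric homology.
   Context: The following construction is applied to $G=A$, $G=B$ and $G=A+B$. Graphs are finite; loops and multiple edges are allowed. $V=V(G)=\{v_1,\dots,v_n\}$, $E=E(G)=\{e_1,\dots,e_m\}$ with a fixed enumeration of the edges. $\mathfrak S_V\cong\mathfrak S_n$ is the symmetric group on $V$; representations are over $\mathbb C$; $\mathcal S^\lambda$ is the Specht module indexed by $\lambda\vdash n$. States and modules. A state of $G$ is a spanning subgraph, identified with its edge set $F\subseteq E$. For $a\ge1$ let $\mathcal L_a=\bigoplus_{i=0}^{a-1}\mathcal S^{(a-i,1^i)}$, graded with $\mathcal S^{(a-i,1^i)}$ in degree $i$; equivalently $\mathcal L_a\cong\bigwedge^*\mathcal S^{(a-1,1)}$ with the exterior grading (for $a=1$ put $\mathcal S^{(0,1)}=0$). If the connected components of $(V,F)$ have vertex sets $B_1,\dots,B_r$ of sizes $b_1,\dots,b_r$, let $\mathfrak S_F=\mathfrak S_{B_1}\times\cdots\times\mathfrak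 S_{B_r}$ and $\mathcal M_F=\mathrm{Ind}_{\mathfrak S_F}^{\mathfrak S_V}(\mathcal L_{b_1}\otimes\cdots\otimes\mathcal L_{b_r})$, a graded $\mathfrak S_V$-module. Concretely: realise $\mathcal S^{(|S|-1,1)}$ for a finite set $S$ as $W_S=\{x\in\mathbb C^S:\sum_{v\in S}x_v=0\}$, put $W_F=\bigoplus_kW_{B_k}\subseteq\mathbb C^V$; then $\mathcal L_{b_1}\otimes\cdots\otimes\mathcal L_{b_r}=\bigwedge^*W_F$ and $\mathcal M_F=\mathbb C[\mathfrak S_V]\otimes_{\mathbb C[\mathfrak S_F]}\bigwedge^*W_F$. Chain modules: $C_{i,j}(G)=\bigoplus_{|F|=i}(\mathcal M_F)_j$, $C_i(G)=\bigoplus_jC_{i,j}(G)$. Per-edge maps: let $F'=F-e$ with $e\in F$; write $\varepsilon$ for the corresponding edge of the Boolean lattice of states. If $F$ and $F'$ have the same components, $d_\varepsilon:\mathcal M_F\to\mathcal M_{F'}$ is the identity. Otherwise a component of $F$ splits into two components $P,Q$ of $F'$. In the case that $F$ has only one component, $\mathrm{Res}_{\mathfrak S_P\times\mathfrak S_Q}W_V=\mathcal T\oplus\mathbf 1$ with $\mathcal T=W_P\oplus W_Q$ and $\mathbf 1$ trivial, so $\mathrm{Res}\,\bigwedge^*W_V=\bigwedge^*\mathcal T\oplus(\bigwedge^*\mathcal T)[1]$, where $(\bigwedge^*\mathcal T)[1]=\bigwedge^*\mathcal T\wedge\mathbf 1$, and $d_\varepsilon$ is the map corresponding under Frobenius reciprocity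 to the $(\mathfrak S_P\times\mathfrak S_Q)$-map that is the identity on $\bigwedge^*\mathcal T$ and zero on $(\bigwedge^*\mathcal T)[1]$. In general $d_\varepsilon$ is obtained by tensoring this map with the identity on the factors of the other components and inducing to $\mathfrak S_V$. Explicitly, $d_\varepsilon(g\otimes x)=\sum_{h\in\mathfrak S_F/\mathfrak S_{F'}}gh\otimes(\bigwedge^*\pi)(h^{-1}x)$, where $\pi:W_F\to W_{F'}$ is the orthogonal projection. Signs and differential: encode $F$ by the binary string $z_1\cdots z_m$ with $z_i=1$ if $e_i\in F$ and $z_i=0$ otherwise. If $e=e_k$, $\mathrm{sgn}(\varepsilon)=(-1)^{s}$, where $s$ is the number of ones in positions after the $k$th. Set $d_i=\sum_\varepsilon\mathrm{sgn}(\varepsilon)d_\varepsilon:C_i(G)\to C_{i-1}(G)$, the sum over all $\varepsilon$ from a state with $i$ edges to one with $i-1$ edges, and $d_{i,j}:C_{i,j}(G)\to C_{i-1,j}(G)$ its degree $j$ part. Homology: $H_{i,j}(G)=\ker d_{i,j}/\mathrm{im}\,d_{i+1,j}$. *)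

(* Defs.v *)
From HB Require Import structures.
From mathcomp Require Import all_boot all_order all_algebra all_fingroup.
From mathcomp Require Import mxrepresentation character spectral.
From mathcomp Require Import mxtens complex reals.

Set Implicit Arguments.
Unset Strict Implicit.
Unset Printing Implicit Defensive.

Import Order.TTheory GRing.Theory Num.Theory.
Local Open Scope ring_scope.

(* MathComp composes permutations from left to right, (g * h) x = h (g x), and
   its representations act on row vectors from the right.  A right module over
   {perm V} is therefore a left module over the symmetric group of V with the
   usual composition, with no inverse involved: read the product g * h below
   as the composite "h after g", and x *m rG g as "g x". *)

Section IndexedMatrices.

Variable K : comPzRingType.

Definition fun_mx (I J : finType) (k : I -> J -> K) : 'M[K]_(#|I|, #|J|) :=
  \matrix_(a, b) k (enum_val a) (enum_val b).

Lemma sum_enum_val (J : finType) (F : J -> K) :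
  \sum_(b < #|J|) F (enum_val b) = \sum_y F y.
Proof.
rewrite (reindex (@enum_val J J)) //=.
exact/onW_bij/enum_val_bij.
Qed.

Lemma fun_mx_mul (I J L : finType) (k : I -> J -> K) (l : J -> L -> K) :
  fun_mx k *m fun_mx l = fun_mx (fun x z => \sum_y k x y * l y z).
Proof.
apply/matrixP=> a b; rewrite !mxE -[RHS]sum_enum_val.
by apply: eq_bigr => c _; rewrite !mxE.
Qed.

Lemma fun_mx1 (I : finType) : fun_mx (fun x y : I => (x == y)%:R) = 1%:M.
Proof.
by apply/matrixP=> a b; rewrite !mxE (inj_eq enum_val_inj).
Qed.

(* Row vectors of size #|{: I * 'I_n}| are the families, indexed by I, of row
   vectors of size n. *)
Definition blk_mx (I : finType) m n (k : I -> I -> 'M[K]_(m, n)) :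
    'M[K]_(#|{: I * 'I_m}|, #|{: I * 'I_n}|) :=
  fun_mx (fun x y => k x.1 y.1 x.2 y.2).

Lemma blk_mx_mul (I : finType) m n p
    (k : I -> I -> 'M[K]_(m, n)) (l : I -> I -> 'M[K]_(n, p)) :
  blk_mx k *m blk_mx l = blk_mx (fun x z => \sum_y k x y *m l y z).
Proof.
rewrite fun_mx_mul /blk_mx /fun_mx; apply/matrixP=> a b; rewrite !mxE.
rewrite summxE -(pair_bigA _ (fun y c =>
  k (enum_val a).1 y (enum_val a).2 c * l y (enum_val b).1 c (enum_val b).2)) /=.
by apply: eq_bigr => y _; rewrite mxE.
Qed.

Definition diag_blk_mx (I : finType) m n (k : I -> 'M[K]_(m, n)) :=
  blk_mx (fun x y => if x == y then k x else 0).

Lemma eq_blk_mx (I : finType) m n (k l : I -> I -> 'M[K]_(m, n)) :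
  (forall x y, k x y = l x y) -> blk_mx k = blk_mx l.
Proof. by move=> kl; apply/matrixP=> a b; rewrite !mxE kl. Qed.

Lemma diag_blk_mx1 (I : finType) m :
  diag_blk_mx (fun _ : I => 1%:M : 'M_m) = 1%:M.
Proof.
rewrite -fun_mx1; apply/matrixP=> a b; rewrite !mxE.
case: (enum_val a) (enum_val b) => [x c] [y d] /=; rewrite xpair_eqE.
by case: eqP => _; rewrite !mxE.
Qed.

Lemma mul_diag_blk_mx (I : finType) m n p
    (k : I -> 'M[K]_(m, n)) (l : I -> I -> 'M[K]_(n, p)) :
  diag_blk_mx k *m blk_mx l = blk_mx (fun x z => k x *m l x z).
Proof.
rewrite blk_mx_mul; apply: eq_blk_mx => x z.
rewrite (bigD1 x) //= eqxx big1 ?addr0 // => y /negPf.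
by rewrite eq_sym => ->; rewrite mul0mx.
Qed.

Lemma mul_blk_diag_mx (I : finType) m n p
    (k : I -> I -> 'M[K]_(m, n)) (l : I -> 'M[K]_(n, p)) :
  blk_mx k *m diag_blk_mx l = blk_mx (fun x z => k x z *m l z).
Proof.
rewrite blk_mx_mul; apply: eq_blk_mx => x z.
rewrite (bigD1 z) //= eqxx big1 ?addr0 // => y /negPf ->.
by rewrite mulmx0.
Qed.

End IndexedMatrices.

Section ExteriorPower.

Variable K : comPzRingType.

Definition jsub (j n : nat) := {S : {set 'I_n} | #|S| == j}.

Definition jnth j n (S : jsub j n) (a : 'I_j) : 'I_n :=
  enum_val (cast_ord (esym (eqP (valP S))) a).

(* The j-th exterior power of K^n has the basis e_S = e_s1 /\ ... /\ e_sj
   (s1 < ... < sj, S = {s1, ..., sj}); the j-th exterior power of a linear map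
   has in these bases the matrix of all j x j minors. *)
Definition ext_mx j m n (A : 'M[K]_(m, n)) :
    'M[K]_(#|{: jsub j m}|, #|{: jsub j n}|) :=
  fun_mx (fun S T => \det (mxsub (jnth S) (jnth T) A)).

Lemma jnth_inj j n (S : jsub j n) : injective (jnth S).
Proof. by move=> a b /enum_val_inj/cast_ord_inj. Qed.

Lemma jnthP j n (S : jsub j n) x : x \in val S -> exists a, jnth S a = x.
Proof.
move=> Sx; exists (cast_ord (eqP (valP S)) (enum_rank_in Sx x)).
by rewrite /jnth cast_ordK enum_rankK_in.
Qed.

Lemma mem_jnth j n (S : jsub j n) a : jnth S a \in val S.
Proof. exact: enum_valP. Qed.

Lemma det_mul_minors j n (A : 'M[K]_(j, n)) (B : 'M[K]_(n, j)) :
  \det (A *m B) =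
    \sum_(S : jsub j n) \det (colsub (jnth S) A) * \det (rowsub (jnth S) B).
Proof.
have ->: \det (A *m B) =
    \sum_(f : {ffun 'I_j -> 'I_n}) \prod_a A a (f a) * \det (rowsub f B).
  rewrite /determinant.
  under eq_bigr => s _.
    under eq_bigr => a _ do rewrite mxE.
    rewrite bigA_distr_bigA /= big_distrr /=; over.
  rewrite exchange_big; apply: eq_bigr => f _ /=.
  rewrite big_distrr; apply: eq_bigr => s _ /=.
  rewrite mulrCA -big_split /=; congr (_ * _).
  by apply: eq_bigr => a _; rewrite mxE.
rewrite (bigID (fun f : {ffun 'I_j -> 'I_n} => injectiveb f)) /= addrC big1 ?add0r.
  pose im (f : {ffun 'I_j -> 'I_n}) : {set 'I_n} := [set f a | a in 'I_j].
  transitivity (\sum_(S : jsub j n) \sum_(f : {ffun 'I_j -> 'I_n} |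
      injectiveb f && (im f == val S)) \prod_a A a (f a) * \det (rowsub f B)).
    rewrite (exchange_big_dep (fun f : {ffun 'I_j -> 'I_n} => injectiveb f)) /=;
      last by move=> S f _ /andP[].
    apply: eq_bigr => f injf.
    have cf: #|im f| == j by rewrite card_imset ?card_ord //; apply/injectiveP.
    rewrite (big_pred1 (exist _ (im f) cf)) // => S.
    by rewrite injf -val_eqE eq_sym.
  apply: eq_bigr => S _.
  pose h (s : 'S_j) := [ffun a => jnth S (s a)].
  have inj_h: injective h.
    move=> s t /ffunP st; apply/permP=> a.
    by have := st a; rewrite !ffunE => /jnth_inj.
  rewrite (eq_bigl (mem (h @: 'S_j))) => [|f]; last first.
    apply/andP/imsetP => [[/injectiveP injf /eqP imf] | [s _ ->]].
      have ex a : exists b, jnth S b == f a.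
        by have [|b <-] := @jnthP j n S (f a); [rewrite -imf imset_f | exists b].
      pose t a := xchoose (ex a).
      have tE a : jnth S (t a) = f a by apply/eqP; exact: (xchooseP (ex a)).
      have injt : injective t by move=> a b tab; apply: injf; rewrite -!tE tab.
      by exists (perm injt) => //; apply/ffunP=> a; rewrite ffunE permE tE.
    have injs: injective (h s).
      by move=> a b; rewrite !ffunE => /jnth_inj/perm_inj.
    split; first exact/injectiveP.
    rewrite eqEcard card_imset // card_ord (eqP (valP S)) leqnn andbT.
    by apply/subsetP=> _ /imsetP[a _ ->]; rewrite ffunE mem_jnth.
  rewrite big_imset /=; last by move=> s t _ _ /inj_h.
  rewrite [in RHS]/determinant mulr_suml.
  rewrite (eq_bigl predT) => [|s]; last by rewrite inE.
  apply: eq_bigr => s _.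
  have ->: rowsub (h s) B = row_perm s (rowsub (jnth S) B).
    by apply/matrixP=> a b; rewrite !mxE ffunE.
  rewrite row_permE det_mulmx det_perm mulrCA mulrA; congr (_ * _ * _).
  by apply: eq_bigr => a _; rewrite !mxE ffunE.
move=> f /injectivePn[a [b neq_ab fab]].
rewrite (@determinant_alternate _ _ (rowsub f B) a b) ?mulr0 // => c.
by rewrite !mxE fab.
Qed.

Lemma ext_mx_mul j m n p (A : 'M[K]_(m, n)) (B : 'M[K]_(n, p)) :
  ext_mx j (A *m B) = ext_mx j A *m ext_mx j B.
Proof.
rewrite fun_mx_mul; apply/matrixP=> a b; rewrite !mxE.
set S := enum_val a; set T := enum_val b.
have ->: mxsub (jnth S) (jnth T) (A *m B) =
         rowsub (jnth S) A *m colsub (jnth T) B.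
  by apply/matrixP=> x y; rewrite !mxE; apply: eq_bigr => z _; rewrite !mxE.
rewrite det_mul_minors; apply: eq_bigr => U _ /=.
by congr (_ * _); congr (\det _); apply/matrixP=> x y; rewrite !mxE.
Qed.

Lemma ext_mx1 j n : ext_mx j (1%:M : 'M[K]_n) = 1%:M.
Proof.
rewrite -fun_mx1; apply/matrixP=> a b; rewrite !mxE.
move: (enum_val a) (enum_val b) => S T.
have [-> | neST] := eqVneq S T.
  rewrite (_ : mxsub _ _ _ = 1%:M) ?det1 //.
  by apply/matrixP=> x y; rewrite !mxE (inj_eq (@jnth_inj _ _ _)).
have /subsetPn[s Ss nTs]: ~~ (val S \subset val T).
  apply: contra neST => sST; rewrite -val_eqE eqEcard sST.
  by rewrite (eqP (valP S)) (eqP (valP T)) /=.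
have [x xE] := jnthP Ss; rewrite (expand_det_row _ x) big1 // => y _.
rewrite !mxE xE; case: eqP => [sE | _]; last by rewrite mul0r.
by rewrite sE mem_jnth in nTs.
Qed.

End ExteriorPower.

Section Induction.

Variables (K : fieldType) (gT : finGroupType).

Definition trans_mx n (k : gT) : 'M[K]_#|{: gT * 'I_n}| :=
  blk_mx (fun g g' => if (g * k)%g == g' then 1%:M else 0).

Lemma mul_trans_mx n m (k : gT) (l : gT -> gT -> 'M[K]_(m, n)) :
  trans_mx m k *m blk_mx l = blk_mx (fun g g' => l (g * k)%g g').
Proof.
rewrite blk_mx_mul; apply: eq_blk_mx => g g'.
rewrite (bigD1 (g * k)%g) //= eqxx mul1mx big1 ?addr0 // => g1 /negPf.
by rewrite eq_sym => ->; rewrite mul0mx.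
Qed.

Lemma mul_mx_trans n m (k : gT) (l : gT -> gT -> 'M[K]_(m, n)) :
  blk_mx l *m trans_mx n k = blk_mx (fun g g' => l g (g' * k^-1)%g).
Proof.
rewrite blk_mx_mul; apply: eq_blk_mx => g g'.
rewrite (bigD1 (g' * k^-1)%g) //= mulgKV eqxx mulmx1 big1 ?addr0 // => g1.
by rewrite (can2_eq (mulgK k) (mulgKV k)) => /negPf->; rewrite mulmx0.
Qed.

Lemma trans_mx1 n : trans_mx n 1%g = 1%:M.
Proof.
by rewrite -diag_blk_mx1; apply: eq_blk_mx => x y; rewrite mulg1.
Qed.

Lemma trans_mxM n g h : trans_mx n (g * h)%g = trans_mx n g *m trans_mx n h.
Proof. by rewrite mul_trans_mx; apply: eq_blk_mx => x y; rewrite mulgA. Qed.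

Lemma trans_mx_repr n : mx_repr [set: gT] (trans_mx n).
Proof. by split=> [|g h _ _]; [apply: trans_mx1 | apply: trans_mxM]. Qed.

(* The module K[gT] (x) K^n, as the space of functions gT -> K^n. *)
Definition trans_repr n := MxRepresentation (trans_mx_repr n).

Variables (hT : finGroupType) (H : {group hT}) (f : {morphism H >-> gT}).
Variables (n : nat) (rH : mx_representation K H n).

(* K[gT] (x)_K[H] U, for an injective f and an H-submodule U of rH, is realised
   as the submodule of K[gT] (x) K^n spanned by the vectors
     g (x) x := \sum_(h in H) (g . f h) (x) h^-1 x        (g : gT, x in U),
   which satisfy g . f h (x) x = g (x) h x (ind_vec_balanced below).  It
   consists of the functions phi : gT -> U with phi (g . f h) = h^-1 (phi g). *)
Definition ind_mx m (U : 'M[K]_(m, n)) :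
    'M[K]_(#|{: gT * 'I_m}|, #|{: gT * 'I_n}|) :=
  blk_mx (fun g g' => \sum_(h in H | (f h * g)%g == g') U *m rH h^-1%g).

Lemma ind_mx_transC m (U : 'M_(m, n)) k :
  ind_mx U *m trans_mx n k = trans_mx m k *m ind_mx U.
Proof.
rewrite mul_mx_trans mul_trans_mx; apply: eq_blk_mx => g g'.
by apply: eq_bigl => h; rewrite mulgA (can2_eq (mulgK k) (mulgKV k)).
Qed.

Lemma ind_mx_module m (U : 'M_(m, n)) :
  mxmodule (trans_repr n) (ind_mx U).
Proof. by apply/mxmoduleP=> k _; rewrite /= ind_mx_transC submxMl. Qed.

Definition ind_vec g (x : 'rV[K]_n) : 'rV[K]_#|{: gT * 'I_n}| :=
  \row_c (\sum_(h in H | (f h * g)%g == (enum_val c).1)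
            x *m rH h^-1%g) 0 (enum_val c).2.

Lemma row_ind_mx m (U : 'M_(m, n)) r :
  row r (ind_mx U) = ind_vec (enum_val r).1 (row (enum_val r).2 U).
Proof.
apply/rowP=> c; rewrite !mxE !summxE; apply: eq_bigr => h _.
by rewrite -row_mul [RHS]mxE.
Qed.

Lemma ind_vec_sub m (U : 'M_(m, n)) g x :
  (x <= U)%MS -> (ind_vec g x <= ind_mx U)%MS.
Proof.
case/submxP=> y ->{x}; apply/submxP.
exists (\row_r (if (enum_val r).1 == g then y 0 (enum_val r).2 else 0)).
apply/rowP=> c; rewrite !mxE.
pose M g1 a := (\sum_(h in H | (f h * g1)%g == (enum_val c).1)
  U *m rH h^-1%g) a (enum_val c).2.
pose Y p := (if p.1 == g then y 0 p.2 else 0) * M p.1 p.2.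
rewrite (eq_bigr (fun r => Y (enum_val r))); last by move=> r _; rewrite !mxE.
rewrite sum_enum_val.
rewrite -(pair_bigA _ (fun g1 a => (if g1 == g then y 0 a else 0) * M g1 a)) /=.
rewrite (bigD1 g) //= eqxx [X in _ + X]big1 ?addr0 => [|g1 /negPf->]; last first.
  by rewrite big1 // => a _; rewrite mul0r.
under eq_bigr => h _ do rewrite -mulmxA.
by rewrite -mulmx_sumr [LHS]mxE.
Qed.

Lemma ind_vec_balanced g h x :
  h \in H -> ind_vec (f h * g)%g x = ind_vec g (x *m rH h).
Proof.
move=> Hh; apply/rowP=> c; rewrite !mxE; congr (fun_of_matrix _ _ _).
rewrite (reindex_inj (mulIg h^-1%g)) /=.
rewrite (eq_bigl (fun k => (k \in H) && ((f k * g)%g == (enum_val c).1))); last first.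
  move=> k; rewrite groupMr ?groupV //; case Hk: (k \in H) => //=.
  by rewrite morphM ?groupV // morphV // mulgA mulgKV.
apply: eq_bigr => k /andP[Hk _].
by rewrite invMg invgK repr_mxM ?groupV // mulmxA.
Qed.

Definition ind_repr := submod_repr (ind_mx_module (1%:M : 'M_n)).

End Induction.

Section ExternalTensor.

Variables (K : fieldType) (aT bT : finGroupType) (m n : nat).
Variables (rA : mx_representation K [set: aT] m).
Variables (rB : mx_representation K [set: bT] n).

Lemma tensmx1 k l : tensmx (1%:M : 'M[K]_k) (1%:M : 'M[K]_l) = 1%:M.
Proof.
apply/matrixP=> i j.
case: (mxtens_indexP i) => a b; case: (mxtens_indexP j) => c d.
by rewrite tensmxE !mxE (can_eq (@mxtens_indexK k l)) xpair_eqE -natrM mulnb.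
Qed.

Lemma xtens_mx_repr :
  mx_repr [set: aT * bT] (fun g => tensmx (rA g.1) (rB g.2)).
Proof.
split=> [|g h _ _]; first by rewrite !repr_mx1 tensmx1.
by rewrite !repr_mxM ?inE // tensmx_mul.
Qed.

Definition xtens_repr := MxRepresentation xtens_mx_repr.

End ExternalTensor.

(* Loops are the edges e with (ends e).1 = (ends e).2; the orientation given by
   the order of the two ends is ignored. *)
Record graph := Graph {
  vertex : finType;
  edge : finType;
  ends : edge -> vertex * vertex
}.

Record enumeration (G : graph) := Enumeration {
  pos :> edge G -> 'I_#|edge G|;
  pos_inj : injective pos
}.

Definition disjoint_union (A B : graph) : graph :=
  @Graph (vertex A + vertex B)%type (edge A + edge B)%type
    (fun e => match e with
              | inl a => (inl (ends a).1, inl (ends a).2)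
              | inr b => (inr (ends b).1, inr (ends b).2)
              end).

Section ChromaticHomology.

Local Open Scope sesquilinear_scope.

Variables (C : numClosedFieldType) (G : graph).

Local Notation V := (vertex G).
Local Notation E := (edge G).
Local Notation n := #|V|.
Local Notation SV := {perm V}.

Implicit Types F : {set E}.

Definition adjacent F : rel V :=
  fun u v => [exists e in F, (ends e == (u, v)) || (ends e == (v, u))].

Definition same_comp F : rel V := connect (adjacent F).

(* The product of the symmetric groups of the connected components of (V, F). *)
Definition comp_perms F : {set SV} :=
  [set g : SV | [forall v, same_comp F v (g v)]].

Lemma comp_perms_group F : group_set (comp_perms F).
Proof.
apply/group_setP; split=> [|g h].
  by rewrite inE; apply/forallP=> v; rewrite perm1 /same_comp connect0.
rewrite !inE => /forallP Fg /forallP Fh; apply/forallP=> v.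
by rewrite permM; apply: connect_trans (Fg v) (Fh _).
Qed.

Canonical comp_group F := Group (comp_perms_group F).

(* The row space of this matrix is W_F: the vectors of C^V whose coordinates sum
   to 0 on each connected component of (V, F) (comp_spaceP below). *)
Definition comp_space F : 'M[C]_n :=
  kermx (fun_mx (fun u v => (same_comp F u v)%:R)).

Definition vertex_mx (g : SV) : 'M[C]_n := fun_mx (fun u v => (v == g u)%:R).

Lemma vertex_mxM g h : vertex_mx (g * h)%g = vertex_mx g *m vertex_mx h.
Proof.
rewrite fun_mx_mul; apply/matrixP=> a b; rewrite !mxE permM.
rewrite (bigD1 (g (enum_val a))) //= eqxx mul1r big1 ?addr0 // => v /negPf->.
by rewrite mul0r.
Qed.

Lemma vertex_mx1 : vertex_mx 1%g = 1%:M.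
Proof.
by rewrite -fun_mx1; apply/matrixP=> a b; rewrite !mxE perm1 eq_sym.
Qed.

Lemma ext_vertex_repr j :
  mx_repr [set: SV] (fun g => ext_mx j (vertex_mx g)).
Proof.
split=> [|g h _ _]; first by rewrite vertex_mx1 ext_mx1.
by rewrite vertex_mxM ext_mx_mul.
Qed.

Definition ext_repr j := MxRepresentation (ext_vertex_repr j).

Definition state_repr j F : mx_representation C (comp_group F) _ :=
  subg_repr (ext_repr j) (subsetT (comp_group F)).

(* The degree j part of M_F = C[SV] (x)_C[S_F] /\ W_F, as a submodule of
   C[SV] (x) /\^j C^V. *)
Definition state_mod j F :=
  ind_mx (idm_morphism (comp_group F)) (state_repr j F)
    (ext_mx j (comp_space F)).

Local Notation N j := #|{: SV * 'I_#|{: jsub j n}|}|.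
(* The families (phi_F) indexed by all the states F, with phi_F in
   C[SV] (x) /\^j C^V; the group SV acts on each phi_F and does not permute the
   states. *)
Local Notation amb j := #|{: {set E} * 'I_(N j)}|.

Definition amb_mx j (g : SV) : 'M[C]_(amb j) :=
  diag_blk_mx (fun _ => trans_mx C _ g).

Lemma amb_mx_repr j : mx_repr [set: SV] (amb_mx j).
Proof.
split=> [|g h _ _]; rewrite /amb_mx.
  by rewrite -diag_blk_mx1; apply: eq_blk_mx => F F'; rewrite trans_mx1.
rewrite mul_diag_blk_mx; apply: eq_blk_mx => F F'.
by rewrite trans_mxM; case: eqP; rewrite ?mulmx0.
Qed.

Definition amb_repr j := MxRepresentation (amb_mx_repr j).

(* The direct sum of the (M_F)_j over the states F with i edges. *)
Definition chains i j : 'M[C]_(amb j) :=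
  diag_blk_mx (fun F : {set E} => if #|F| == i then state_mod j F else 0).

(* The map d_eps from a state F to F' = F - e, for any e in F.  The formula
     d_eps (g (x) x) = \sum_h g h (x) (/\pi) (h^-1 x),  h in S_F / S_F',
   with pi the orthogonal projection onto W_F', says that /\pi is applied to
   the second factor throughout: this is edge_mxE below.  It is the identity on
   M_F if F and F' have the same components (state_mod_edge_mx_id). *)
Definition edge_mx j F' : 'M[C]_(N j) :=
  diag_blk_mx (fun _ : SV => ext_mx j (proj_ortho (comp_space F'))).

Lemma vertex_mx_unitary g : (vertex_mx g)^t* = vertex_mx g^-1%g.
Proof.
apply/matrixP=> a b; rewrite !mxE rmorph_nat; congr (_%:R : C).
by congr (nat_of_bool _); rewrite [RHS]eq_sym (can2_eq (permKV g) (permK g)).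
Qed.

Lemma comp_spaceP m (x : 'M[C]_(m, n)) F :
  reflect (forall r v, \sum_(u | same_comp F u v) x r (enum_rank u) = 0)
          (x <= comp_space F)%MS.
Proof.
have sumE r v :
    (x *m fun_mx (fun u w => (same_comp F u w)%:R)) r (enum_rank v) =
    \sum_(u | same_comp F u v) x r (enum_rank u).
  rewrite big_mkcond -sum_enum_val mxE; apply: eq_bigr => c _.
  by rewrite !mxE enum_rankK enum_valK; case: ifP; rewrite ?mulr1 ?mulr0.
apply: (iffP sub_kermxP) => [x0 r v | x0]; first by rewrite -sumE x0 mxE.
by apply/matrixP=> r c; rewrite -(enum_valK c) sumE x0 mxE.
Qed.

Lemma same_compC F : symmetric (same_comp F).
Proof.
apply: sym_connect_sym => u v; apply/existsP/existsP=> -[e /andP[Fe uv]];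
  by exists e; rewrite Fe orbC.
Qed.

Lemma mul_vertex_mxE m (x : 'M[C]_(m, n)) g r u :
  (x *m vertex_mx g) r (enum_rank (g u)) = x r (enum_rank u).
Proof.
rewrite mxE (bigD1 (enum_rank u)) //= big1 ?addr0 => [|c neq_cu].
  by rewrite mxE !enum_rankK eqxx mulr1.
rewrite mxE enum_rankK (inj_eq perm_inj); case: eqP => [uE|_]; rewrite ?mulr0 //.
by rewrite uE enum_valK eqxx in neq_cu.
Qed.

Lemma comp_space_stable F g :
  g \in comp_group F -> (comp_space F *m vertex_mx g <= comp_space F)%MS.
Proof.
rewrite inE => /forallP Fg; apply/comp_spaceP=> r v.
have /comp_spaceP/(_ r v) x0 := submx_refl (comp_space F).
rewrite -[RHS]x0 [LHS](reindex_inj (@perm_inj _ g)) /=.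
apply: eq_big => [u | u _]; last by rewrite mul_vertex_mxE.
have cFC := sym_connect_sym; rewrite /same_comp.
by rewrite (same_connect _ (Fg u)) //; apply: same_compC.
Qed.

Lemma proj_comp_spaceC F g : g \in comp_group F ->
  vertex_mx g *m proj_ortho (comp_space F) =
  proj_ortho (comp_space F) *m vertex_mx g.
Proof.
move=> Fg; set P := proj_ortho _.
have PW : (P *m vertex_mx g <= comp_space F)%MS.
  have sPW: (P <= comp_space F)%MS by rewrite -[P]mul1mx proj_ortho_sub.
  exact: submx_trans (submxMr _ sPW) (comp_space_stable Fg).
have QW : (1%:M - P) *m vertex_mx g *m (comp_space F)^t* = 0.
  have -> : vertex_mx g = (vertex_mx g^-1%g)^t* by rewrite vertex_mx_unitary invgK.
  rewrite -mulmxA -map_mxM -trmx_mul.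
  have /submxP[D ->] := comp_space_stable (groupVr Fg).
  rewrite trmx_mul map_mxM mulmxA.
  have := @proj_ortho_compl_sub _ _ _ _ (comp_space F) (1%:M : 'M_n).
  by rewrite mul1mx => /sub_kermxP; rewrite mul1mx => ->; rewrite mul0mx.
have gE : vertex_mx g = P *m vertex_mx g + (1%:M - P) *m vertex_mx g.
  by rewrite -mulmxDl addrC subrK mul1mx.
set Q := 1%:M - P in QW gE.
rewrite [in LHS]gE mulmxDl (proj_ortho_id PW) proj_ortho_0 ?addr0 //.
by apply/sub_kermxP; rewrite mul1mx.
Qed.

Lemma same_comp_sub F F' : F' \subset F -> subrel (same_comp F') (same_comp F).
Proof.
move=> sF; apply: connect_sub => u v /existsP[e /andP[Fe uv]].
by apply/connect1/existsP; exists e; rewrite (subsetP sF).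
Qed.

Lemma comp_groupS F F' : F' \subset F -> comp_group F' \subset comp_group F.
Proof.
move=> sF; apply/subsetP=> g; rewrite !inE => /forallP F'g; apply/forallP=> v.
exact: same_comp_sub (F'g v).
Qed.

Lemma comp_spaceS F F' : F' \subset F -> (comp_space F' <= comp_space F)%MS.
Proof.
move=> sF; apply/comp_spaceP=> r v.
have /comp_spaceP x0 := submx_refl (comp_space F').
have cF := same_compC F'.
rewrite (partition_big (fingraph.root (adjacent F')) predT) //= big1 // => w _.
have [/eqP rw | nw] := boolP (fingraph.root (adjacent F') w == w); last first.
  rewrite big_pred0 // => u; apply/andP=> -[_ /eqP uw].
  by rewrite -uw (eqP (roots_root cF u)) eqxx in nw.
have [Fwv | nFwv] := boolP (same_comp F w v); last first.
  rewrite big_pred0 // => u; apply/andP=> -[Fuv /eqP uw]; case/negP: nFwv.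
  apply: connect_trans Fuv; apply: (same_comp_sub sF).
  by rewrite -uw cF; apply: connect_root.
rewrite -[RHS](x0 r w); apply: eq_bigl => u; rewrite -[X in _ && (_ == X)]rw.
rewrite (root_connect cF) andb_idl // => F'uw.
by apply: connect_trans Fwv; apply: (same_comp_sub sF).
Qed.

Variable o : enumeration G.

Definition edge_sign F (e : E) : C :=
  (-1) ^+ #|[set e' in F | (o e < o e')%N]|.

Definition diff j : 'M[C]_(amb j) :=
  blk_mx (fun F F' : {set E} =>
    \sum_(e in F | F' == F :\ e) edge_sign F e *: edge_mx j F').

Definition cycles i j := (chains i j :&: kermx (diff j))%MS.

Definition boundaries i j := chains i.+1 j *m diff j.

Lemma edge_mx_transC j F g :
  edge_mx j F *m trans_mx C _ g = trans_mx C _ g *m edge_mx j F.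
Proof.
rewrite mul_mx_trans mul_trans_mx; apply: eq_blk_mx => x y.
by rewrite (can2_eq (mulgK g) (mulgKV g)).
Qed.

Lemma diff_centg j : centgmx (amb_repr j) (diff j).
Proof.
apply/centgmxP=> g _; rewrite /= /amb_mx mul_blk_diag_mx mul_diag_blk_mx.
apply: eq_blk_mx => F F'; rewrite mulmx_suml mulmx_sumr.
by apply: eq_bigr => e _; rewrite -scalemxAl -scalemxAr edge_mx_transC.
Qed.

Lemma chains_module i j : mxmodule (amb_repr j) (chains i j).
Proof.
apply/mxmoduleP=> g _; rewrite /=.
suff ->: chains i j *m amb_mx j g = amb_mx j g *m chains i j by rewrite submxMl.
rewrite mul_blk_diag_mx mul_diag_blk_mx; apply: eq_blk_mx => F F'.
case: eqP => _; last by rewrite mul0mx mulmx0.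
by case: ifP => _; rewrite ?mul0mx ?mulmx0 // /state_mod ind_mx_transC.
Qed.

Lemma cycles_module i j : mxmodule (amb_repr j) (cycles i j).
Proof.
exact: capmx_module (chains_module i j) (kermx_centg_module (diff_centg j)).
Qed.

Lemma boundaries_module i j : mxmodule (amb_repr j) (boundaries i j).
Proof.
apply/mxmoduleP=> g Gg; rewrite -mulmxA.
have /centgmxP-> // := diff_centg j; rewrite mulmxA submxMr //.
by have /mxmoduleP-> := chains_module i.+1 j.
Qed.

(* This is the quotient of cycles by boundaries (see boundaries_sub_cycles). *)
Definition homology i j : representation C [set: SV] :=
  Representation (section_repr (boundaries_module i j) (cycles_module i j)).

Lemma edge_mxE j F F' g (x : 'rV[C]_#|{: jsub j n}|) :
    F' \subset F ->
  ind_vec (idm_morphism (comp_group F)) (state_repr j F) g x *m edge_mx j F' =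
  \sum_(c in rcosets (comp_group F') (comp_group F))
    ind_vec (idm_morphism (comp_group F')) (state_repr j F') (repr c * g)%g
      (x *m ext_repr j (repr c)^-1%g *m ext_mx j (proj_ortho (comp_space F'))).
Proof.
move=> sF'F; have sSF'F := comp_groupS sF'F.
set SF := comp_group F in sSF'F *; set SF' := comp_group F' in sSF'F *.
set P := ext_mx j _; pose y h := x *m ext_repr j h^-1%g *m P.
have PC h : h \in SF' -> P *m ext_repr j h = ext_repr j h *m P.
  by move=> SF'h; rewrite /= -!ext_mx_mul proj_comp_spaceC.
apply/rowP=> b; rewrite summxE.
transitivity ((\sum_(h in SF | (h * g)%g == (enum_val b).1) y h) 0
                (enum_val b).2).
  rewrite !mxE summxE.
  rewrite (eq_bigr (fun c => (fun p : SV * 'I_#|{: jsub j n}| =>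
    (\sum_(h in SF | (h * g)%g == p.1) x *m ext_repr j h^-1%g) 0 p.2 *
    (if p.1 == (enum_val b).1 then P else 0) p.2 (enum_val b).2)
    (enum_val c))); last by move=> c _; rewrite !mxE.
  rewrite (sum_enum_val (fun p : SV * 'I_#|{: jsub j n}| =>
    (\sum_(h in SF | (h * g)%g == p.1) x *m ext_repr j h^-1%g) 0 p.2 *
    (if p.1 == (enum_val b).1 then P else 0) p.2 (enum_val b).2)).
  rewrite -(pair_bigA _ (fun g1 a =>
    (\sum_(h in SF | (h * g)%g == g1) x *m ext_repr j h^-1%g) 0 a *
    (if g1 == (enum_val b).1 then P else 0) a (enum_val b).2)) /=.
  rewrite (bigD1 (enum_val b).1) //= eqxx [X in _ + X]big1 ?addr0; last first.
    by move=> g1 /negPf->; rewrite big1 // => a _; rewrite mxE mulr0.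
  by rewrite -summxE -mulmx_suml mxE.
rewrite summxE big_mkcondr /=.
rewrite (set_partition_big _ (rcosets_partition sSF'F)) /=.
apply: eq_bigr => _ /rcosetsP[r0 SFr0 ->].
set c := (SF' :* r0)%g; have cE : c = (SF' :* repr c)%g by rewrite rcoset_repr.
have SFr : repr c \in SF.
  have /rcosetP[h SF'h ->] := mem_repr_rcoset SF' r0.
  by rewrite groupM // (subsetP sSF'F).
rewrite {1}cE -big_mkcondr /= mxE summxE.
rewrite (reindex_inj (mulIg (repr c))) /=.
apply: eq_big => [h | h /andP[]]; rewrite mem_rcoset mulgK.
  by rewrite -mulgA.
move=> SF'h _; congr (fun_of_matrix _ _ _).
rewrite /y invMg (repr_mxM (ext_repr j)) ?inE // -[RHS]mulmxA.
by rewrite [X in _ = _ *m X](PC h^-1%g) ?groupV // !mulmxA.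
Qed.

Lemma mul_ext_proj j F F' : (comp_space F <= comp_space F')%MS ->
  ext_mx j (comp_space F) *m ext_mx j (proj_ortho (comp_space F')) =
  ext_mx j (comp_space F).
Proof. by move=> sFF'; rewrite -ext_mx_mul proj_ortho_id. Qed.

Lemma state_mod_edge_mx_id j F F' : F' \subset F ->
    same_comp F =2 same_comp F' ->
  state_mod j F *m edge_mx j F' = state_mod j F.
Proof.
move=> sF'F eqFF'; rewrite mul_blk_diag_mx; apply: eq_blk_mx => g g'.
rewrite mulmx_suml; apply: eq_bigr => h /andP[SFh _].
have SF'h : h \in comp_group F'.
  by move: SFh; rewrite !inE; under eq_forallb do rewrite eqFF'.
rewrite /= -mulmxA -ext_mx_mul proj_comp_spaceC ?groupV //.
rewrite (ext_mx_mul _ (proj_ortho _)) mulmxA mul_ext_proj //.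
rewrite /comp_space (_ : fun_mx _ = fun_mx (fun u v => (same_comp F' u v)%:R)) //.
by apply/matrixP=> a b; rewrite !mxE eqFF'.
Qed.

Lemma state_mod_edge_mx_sub j F F' : F' \subset F ->
  (state_mod j F *m edge_mx j F' <= state_mod j F')%MS.
Proof.
move=> sF'F; apply/row_subP=> r; rewrite row_mul row_ind_mx edge_mxE //.
apply: summx_sub => c _; apply: ind_vec_sub; rewrite /= -!row_mul -!ext_mx_mul.
apply: submx_trans (row_sub _ _) _.
have /submxP[D ->] : (comp_space F *m vertex_mx (repr c)^-1 *m
    proj_ortho (comp_space F') <= comp_space F')%MS by exact: proj_ortho_sub.
by rewrite ext_mx_mul submxMl.
Qed.

Lemma edge_mx_mul j F F' : F' \subset F ->
  edge_mx j F *m edge_mx j F' = edge_mx j F'.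
Proof.
move=> sF'F; rewrite mul_diag_blk_mx; apply: eq_blk_mx => g g'.
case: eqP => _; rewrite ?mulmx0 // -ext_mx_mul; congr ext_mx.
apply/eqP; rewrite -subr_eq0 -[X in _ - X]mul1mx -mulmxBl; apply/eqP.
apply: proj_ortho_0; rewrite -opprB eqmx_opp.
have := @proj_ortho_compl_sub _ _ _ _ (comp_space F) (1%:M : 'M_n).
rewrite mul1mx => /submx_trans-> //.
by rewrite submx_ortho comp_spaceS.
Qed.

Lemma diff_diff j : diff j *m diff j = 0.
Proof.
rewrite blk_mx_mul.
suff H F F'' : \sum_F' (\sum_(e in F | F' == F :\ e) edge_sign F e *: edge_mx j F')
    *m (\sum_(e in F' | F'' == F' :\ e) edge_sign F' e *: edge_mx j F'') = 0.
  by apply/matrixP=> a b; rewrite !mxE H mxE.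
transitivity (\sum_(p : E * E | (p.1 != p.2) && ((p.1 \in F) && (p.2 \in F)) &&
    (F'' == F :\ p.1 :\ p.2))
    (edge_sign F p.1 * edge_sign (F :\ p.1) p.2) *: edge_mx j F'').
  rewrite (eq_bigr (fun F' => \sum_(e in F | F' == F :\ e)
     \sum_(e' in F :\ e | F'' == F :\ e :\ e')
       (edge_sign F e * edge_sign (F :\ e) e') *: edge_mx j F'')); last first.
    move=> F' _; rewrite mulmx_suml; apply: eq_bigr => e /andP[_ /eqP->].
    rewrite mulmx_sumr; apply: eq_bigr => e' /andP[_ /eqP ->].
    by rewrite -scalemxAl -scalemxAr scalerA edge_mx_mul ?subD1set.
  rewrite (exchange_big_dep (mem F)) /=; last by move=> F' e _ /andP[].
  rewrite (eq_bigr (fun e => \sum_(e' in F :\ e | F'' == F :\ e :\ e')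
       (edge_sign F e * edge_sign (F :\ e) e') *: edge_mx j F'')); last first.
    by move=> e Fe; rewrite (big_pred1 (F :\ e)) // => F'; rewrite Fe.
  rewrite pair_big_dep /=; apply: eq_bigl => -[e e'] /=.
  by rewrite !inE eq_sym; case: (e \in F); case: (e' \in F); rewrite ?andbF ?andbT.
rewrite (bigID (fun p : E * E => (o p.1 < o p.2)%N)) /= addrC.
pose sw (p : E * E) := (p.2, p.1).
have swK : involutive sw by case.
rewrite (reindex_inj (inv_inj swK)) /=.
apply/eqP; rewrite addr_eq0 -sumrN; apply/eqP.
apply: eq_big => [[e e'] | [e e']] /=.
  rewrite eq_sym setDDl setUC -setDDl [(e' \in F) && _]andbC -leqNgt leq_eqVlt.
  rewrite -!andbA; case: eqVneq => //= nee'.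
  by rewrite (inj_eq val_inj) (inj_eq (@pos_inj _ o)) (negPf nee').
rewrite -leqNgt => /andP[/andP[/and3P[ne Fe' Fe] _]] le.
have lt : (o e < o e')%N.
  by rewrite ltn_neqAle le andbT (inj_eq val_inj) (inj_eq (@pos_inj _ o)) eq_sym.
rewrite -scaleNr; congr (_ *: _); rewrite /edge_sign.
have ->: [set x in F :\ e | (o e' < o x)%N] = [set x in F | (o e' < o x)%N].
  apply/setP=> x; rewrite !inE; case: eqVneq => //= ->.
  by rewrite ltnNge le andbF.
rewrite (cardsD1 e' [set x in F | (o e < o x)%N]) inE Fe' lt /=.
have ->: [set x in F | (o e < o x)%N] :\ e' = [set x in F :\ e' | (o e < o x)%N].
  by apply/setP=> x; rewrite !inE andbA.
by rewrite add1n exprS mulN1r mulNr opprK mulrC.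
Qed.

Lemma boundaries_sub_cycles i j : (boundaries i j <= cycles i j)%MS.
Proof.
rewrite sub_capmx; apply/andP; split; last first.
  by apply/sub_kermxP; rewrite -mulmxA diff_diff mulmx0.
pose M F F' : 'M[C]_(N j) := if (#|F| == i.+1) then
  \sum_(e in F | F' == F :\ e) edge_sign F e *: (state_mod j F *m edge_mx j F')
  else 0.
have ->: boundaries i j = blk_mx (fun F F' => M F F' *m pinvmx (state_mod j F'))
    *m chains i j.
  rewrite /boundaries mul_diag_blk_mx mul_blk_diag_mx.
  apply: eq_blk_mx => F F'; rewrite /M.
  case: eqP => cF; last by rewrite !mul0mx.
  rewrite mulmx_sumr; under eq_bigr do rewrite -scalemxAr.
  case: eqP => cF'; last first.
    rewrite mulmx0 big_pred0 // => e; apply/andP=> -[Fe /eqP F'E].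
    by case: cF'; apply: succn_inj; rewrite -cF (cardsD1 e F) Fe F'E.
  rewrite mulmxKpV //; apply: summx_sub => e /andP[_ /eqP->].
  by rewrite scalemx_sub // state_mod_edge_mx_sub ?subD1set.
exact: submxMl.
Qed.

End ChromaticHomology.

Section PermSum.

Variables S T : finType.

Definition perm_sum_fun (s : {perm S} * {perm T}) (x : S + T) : S + T :=
  match x with inl a => inl (s.1 a) | inr b => inr (s.2 b) end.

Lemma perm_sum_fun_inj s : injective (perm_sum_fun s).
Proof. by case=> x [] y //= [] /perm_inj->. Qed.

Definition perm_sum s : {perm S + T} := perm (@perm_sum_fun_inj s).

Lemma perm_sumM :
  {in [set: {perm S} * {perm T}] &, {morph perm_sum : s t / (s * t)%g}}.
Proof.
by move=> s t _ _; apply/permP=> -[] x; rewrite permM !permE /= permM.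
Qed.

Canonical perm_sum_morphism := Morphism perm_sumM.

Lemma perm_sum_injm : ('injm perm_sum_morphism)%g.
Proof.
apply/injmP=> -[s1 s2] [t1 t2] _ _ /permP st; congr (_, _); apply/permP=> x.
  by have := st (inl x); rewrite !permE => -[].
by have := st (inr x); rewrite !permE => -[].
Qed.

End PermSum.

Definition ind_tens (C : numClosedFieldType) (A B : graph)
    (HA : representation C [set: {perm vertex A}])
    (HB : representation C [set: {perm vertex B}]) :
    representation C [set: {perm vertex (disjoint_union A B)}] :=
  Representation
    (ind_repr (perm_sum_morphism (vertex A) (vertex B)) (xtens_repr HA HB)).

(* Main.v *)
(* A state of A + B is a pair of states, and its Young subgroup and its space W
   split accordingly.  Hence the functions on S_(A u B) supported on the subgroup
   S_A x S_B carry the tensor product of the complexes of A and B, after a change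
   of sign of each state that accounts for the enumerations of the edges, and
   they form a system of imprimitivity: the complex of A + B is induced from the
   tensor product.  Averaging over the group makes each homology module an
   equivariant retract of its complex, with complement contracted by a (not
   equivariant) homotopy.  The tensor product of two such retracts is again one,
   which is the Kunneth formula, and inducing it gives a retract of the complex
   of A + B onto the right-hand side. *)

Require Import Defs.
From mathcomp Require Import all_boot all_order all_algebra all_fingroup.
From mathcomp Require Import mxrepresentation character complex reals.
From mathcomp Require Import spectral mxtens.

Set Implicit Arguments.
Unset Strict Implicit.
Unset Printing Implicit Defensive.

Import Order.TTheory GRing.Theory Num.Theory.

Local Open Scope ring_scope.

(** * Homology as an equivariant retract *)

(** All modules are row spaces inside fixed ambient spaces, so a complex is handled through
    idempotents onto its graded pieces, and most identities are claimed only behind such an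
    idempotent. The reason is that the differential of a union is not a tensor differential on the
    ambient spaces: deleting an edge of A applies the exterior power of the projection onto W_{F'}
    to the whole of /\ C^V, hence also a projection onto W_{FB} to the factor of B. One finds D_A
    (x) w_B + (sign w_A) (x) D_B, where the extra projections w are the identity on chains only.
    Equivariance is needed for the maps between homology and chains, and averaging provides it. The
    homotopy only has to show that what is left of a cycle is a boundary; this is an inclusion of
    row spaces, for which any linear homotopy will do. *)

Section Sections.

Variables (F : fieldType) (gT : finGroupType) (G : {group gT}).

Definition intertwines m n (rU : mx_representation F G m)
    (rV : mx_representation F G n) (f : 'M_(m, n)) :=
  {in G, forall g, rU g *m f = f *m rV g}.

Definition average m n (rU : mx_representation F G m)
    (rV : mx_representation F G n) (f : 'M_(m, n)) : 'M_(m, n) :=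
  #|G|%:R^-1 *: \sum_(g in G) rU g^-1%g *m f *m rV g.

Lemma average_intertwines m n (rU : mx_representation F G m)
  (rV : mx_representation F G n) f : intertwines rU rV (average rU rV f).
Proof.
move=> g Gg; rewrite -scalemxAr -scalemxAl; congr (_ *: _).
rewrite mulmx_sumr mulmx_suml (reindex_inj (mulIg g)) /=.
rewrite (eq_bigl (fun x => x \in G)) => [|x]; last by rewrite groupMr.
apply: eq_bigr => x Gx; rewrite invMg !repr_mxM ?groupV // !mulmxA.
by rewrite -[rU g *m _]repr_mxM ?groupV // mulgV repr_mx1 mul1mx.
Qed.

Variables (n : nat) (rG : mx_representation F G n).

Lemma mul_in_section k l (U : 'M_n) (W : 'M_(\rank (cokermx U))) (x : 'M_(k, l))
    (y : 'M[F]_(l, n)) :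
  x *m in_submod W (in_factmod U y) = in_submod W (in_factmod U (x *m y)).
Proof. by rewrite /in_submod /in_factmod /= !mulmxA. Qed.

(** Since [p] kills [U], it factors through the quotient by [U], and on V/U it is inverse to the map
    induced by [i]. Equivariance comes from [i]; [p] only provides the inverse matrix. *)
Lemma section_rsim (U V : 'M_n) (modU : mxmodule rG U) (modV : mxmodule rG V)
    m (rH : mx_representation F G m) (i : 'M_(m, n)) (p : 'M_(n, m)) :
    intertwines rH rG i -> (i <= V)%MS -> U *m p = 0 -> i *m p = 1%:M ->
    (V - V *m p *m i <= U)%MS ->
  mx_rsim (section_repr modU modV) rH.
Proof.
move=> ri iV Up ip1 VU; apply: mx_rsim_sym.
pose W := (<<in_factmod U V>>)%MS.
have inW k (x : 'M_(k, n)) : (x <= V)%MS -> (in_factmod U x <= W)%MS.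
  by move=> xV; rewrite genmxE submxMr.
have valp k (x : 'M_(k, n)) : val_factmod (in_factmod U x) *m p = x *m p.
  rewrite -[in RHS](add_sub_fact_mod U x) mulmxDl.
  have /submxP[y ->] := val_submodP (in_submod U x).
  by rewrite -mulmxA Up mulmx0 add0r.
pose B := in_submod W (in_factmod U i).
pose B' := val_factmod (val_submod (1%:M : 'M_(\rank W))) *m p.
have BB' : B *m B' = 1%:M.
  have BE : B *m val_factmod (val_submod 1%:M) = val_factmod (val_submod B).
    by rewrite val_factmodE [RHS]val_factmodE (val_submodE B) mulmxA.
  by rewrite /B' mulmxA BE in_submodK ?inW // valp.
have B'B : B' *m B = 1%:M.
  have /submxP[X XE] : (val_submod (1%:M : 'M_(\rank W)) <= in_factmod U V)%MS.
    by rewrite val_submod1 genmxE.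
  have XE' : in_factmod U (X *m V) = val_submod (1%:M : 'M_(\rank W)).
    by rewrite XE in_factmodE [in RHS]in_factmodE mulmxA.
  rewrite /B' -XE' valp mul_in_section.
  have -> : in_factmod U (X *m V *m p *m i) = in_factmod U (X *m V).
    apply/eqP; rewrite eq_sym -subr_eq0 -linearB in_factmod_eq0.
    by rewrite -!mulmxA -mulmxBr mulmx_sub // mulmxA.
  by rewrite XE' val_submodK.
exists B.
- apply/eqP; rewrite eqn_leq; apply/andP; split.
    by rewrite -[m in X in (X <= _)%N](mxrank1 F) -BB' mulmx_max_rank.
  by rewrite -[X in (X <= _)%N](mxrank1 F) -B'B mulmx_max_rank.
- by apply/row_freeP; exists B'.
move=> g Gg /=; rewrite /B -in_submodJ ?inW // -in_factmodJ // -ri //.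
by rewrite mul_in_section.
Qed.

Hypothesis charG : #|G|%:R != 0 :> F.

Lemma average_id m k (rU : mx_representation F G m)
    (rV : mx_representation F G k) (f : 'M_(m, k)) m' (x : 'M_(m', m)) :
    {in G, forall g, x *m rU g^-1%g *m f *m rV g = x *m f} ->
  x *m average rU rV f = x *m f.
Proof.
move=> xf; rewrite -scalemxAr mulmx_sumr.
rewrite (eq_bigr (fun _ => x *m f)) => [|g Gg]; last by rewrite !mulmxA xf.
by rewrite sumr_const -scaler_nat scalerA mulVf ?scale1r.
Qed.

Variables (U V : 'M[F]_n) (modU : mxmodule rG U) (modV : mxmodule rG V).
Hypothesis sUV : (U <= V)%MS.

Local Notation W := (<<in_factmod U V>>)%MS.
Local Notation rS := (section_repr modU modV).

(** The quotient map V -> V/U, extended to the whole ambient space. [in_submod] is uncontrolled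
    outside its submodule, so the extension becomes equivariant only by averaging; on [V] the
    average changes nothing ([section_projE]). *)
Definition section_proj : 'M_(n, \rank W) :=
  average rG rS (in_submod W (in_factmod U 1%:M)).

(** An arbitrary linear section, averaged: [pinvmx] expresses a basis of the quotient through the
    classes of the rows of [V], and the same combinations of these rows are the lifts. *)
Definition section_lift : 'M_(\rank W, n) :=
  average rS rG (val_submod 1%:M *m pinvmx (in_factmod U V) *m V).

Lemma section_projC : intertwines rG rS section_proj.
Proof. exact: average_intertwines. Qed.

Lemma section_liftC : intertwines rS rG section_lift.
Proof. exact: average_intertwines. Qed.

Lemma section_projE m (x : 'M_(m, n)) :
  (x <= V)%MS -> x *m section_proj = in_submod W (in_factmod U x).
Proof.
move=> xV; have E y : y *m in_submod W (in_factmod U 1%:M) =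
    in_submod W (in_factmod U y) :> 'M_(m, _).
  by rewrite mul_in_section mulmx1.
rewrite average_id E // => g Gg; rewrite E.
have xgV : (x *m rG g^-1%g <= V)%MS by rewrite mxmodule_trans ?groupV.
rewrite /= -in_submodJ ?genmxE ?submxMr // -in_factmodJ //.
by rewrite -mulmxA -repr_mxM ?groupV // mulVg repr_mx1 mulmx1.
Qed.

Lemma sub_section_proj : U *m section_proj = 0.
Proof.
rewrite section_projE //.
have /eqP -> : in_factmod U U == 0 by rewrite in_factmod_eq0.
by rewrite linear0.
Qed.

Lemma section_lift_sub : (section_lift <= V)%MS.
Proof.
rewrite scalemx_sub // summx_sub // => g Gg.
by rewrite mxmodule_trans // mulmxA submxMl.
Qed.

(** Every conjugate of a linear section of an equivariant map is again a section, so each of the |G|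
    terms of the average contributes the identity. *)
Lemma section_liftK : section_lift *m section_proj = 1%:M.
Proof.
rewrite /section_lift; set X := _ *m pinvmx _.
rewrite -scalemxAl mulmx_suml (eq_bigr (fun _ => 1%:M)) => [|g Gg].
  by rewrite sumr_const -scaler_nat scalerA mulVf ?scale1r.
rewrite -[_ *m rG g *m _]mulmxA section_projC // mulmxA.
rewrite -[_ *m (X *m V) *m _]mulmxA section_projE ?submxMl //.
have -> : in_factmod U (X *m V) = val_submod (1%:M : 'M_(\rank W)).
  rewrite (_ : in_factmod U (X *m V) = X *m in_factmod U V).
    by rewrite mulmxKpV // val_submod1 genmxE.
  by rewrite /in_factmod /= mulmxA.
by rewrite val_submodK mulmx1 -repr_mxM ?groupV // mulVg repr_mx1.
Qed.

Lemma section_projK m (x : 'M_(m, n)) :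
  (x <= V)%MS -> (x - x *m section_proj *m section_lift <= U)%MS.
Proof.
move=> xV; set y := _ - _.
have yV : (y <= V)%MS by rewrite addmx_sub // eqmx_opp mulmx_sub ?section_lift_sub.
have : y *m section_proj = 0.
  by rewrite mulmxBl -[X in _ - X]mulmxA section_liftK mulmx1 subrr.
rewrite section_projE // => y0; rewrite -in_factmod_eq0.
have <- : val_submod (in_submod W (in_factmod U y)) = in_factmod U y.
  by rewrite in_submodK // genmxE submxMr.
by rewrite y0 linear0.
Qed.

End Sections.

(** * Retracts onto direct sums *)

Section DirectSum.

Variables (F : fieldType) (gT : finGroupType) (G : {group gT}).
Variables (n : nat) (rG : mx_representation F G n).
Variables (I : finType) (P : pred I) (rH : I -> representation F G).
Variables (i : forall x, 'M[F]_(rdegree (rH x), n)).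
Variables (p : forall x, 'M[F]_(n, rdegree (rH x))).
Hypothesis iC : forall x, P x -> intertwines (rH x) rG (i x).
Hypothesis ip1 : forall x, P x -> i x *m p x = 1%:M.
Hypothesis ip0 : forall x y, P x -> P y -> x != y -> i x *m p y = 0.

(** The iterated [dadd_grepr] is a nested block sum whose dimension is itself a big operator, so its
    blocks are hard to address by index. Inclusion and projection are built along the list, and the
    last two clauses record what is needed of their blocks as vanishing tests. *)
Lemma dadd_retract (s : seq I) : uniq s -> all P s ->
  exists (j : 'M_(rdegree (\big[dadd_grepr/grepr0]_(x <- s) rH x), n))
         (q : 'M_(n, rdegree (\big[dadd_grepr/grepr0]_(x <- s) rH x))),
  [/\ intertwines (\big[dadd_grepr/grepr0]_(x <- s) rH x) rG j,
      j *m q = 1%:M,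
      q *m j = \sum_(x <- s) p x *m i x,
      forall m (M : 'M_(n, m)), {in s, forall x, i x *m M = 0} -> j *m M = 0
    & forall m (M : 'M_(m, n)), {in s, forall x, M *m p x = 0} -> M *m q = 0].
Proof.
elim: s => [|x s IHs] /= => [_ _ | /andP[xs us] /andP[Px Ps]].
  rewrite !big_nil /=; exists 0, 0; split=> [g _||||] //.
  - by rewrite mulmx0 mul0mx.
  - by rewrite mul0mx; apply/matrixP=> -[].
  - by rewrite mul0mx.
  - by move=> m M _; rewrite mul0mx.
  - by move=> m M _; rewrite mulmx0.
have [j [q [jC jq qj j0 q0]]] := IHs us Ps.
rewrite !big_cons /=; exists (col_mx (i x) j), (row_mx (p x) q); split.
- move=> g Gg /=; rewrite mul_block_col mul_col_mx !mul0mx addr0 add0r.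
  by rewrite iC // jC.
- have neq y : y \in s -> P y /\ y != x.
    move=> sy; split; first exact: (allP Ps).
    by apply: contraNneq xs => <-.
  rewrite mul_col_row ip1 // jq j0 => [|y /neq[Py yx]]; last exact: ip0.
  rewrite q0 => [|y /neq[Py yx]]; last by rewrite ip0 // eq_sym.
  by rewrite -scalar_mx_block.
- by rewrite mul_row_col qj.
- move=> m M M0; rewrite mul_col_mx M0 ?mem_head // j0 ?col_mx0 // => y sy.
  by rewrite M0 // inE sy orbT.
move=> m M M0; rewrite mul_mx_row M0 ?mem_head // q0 ?row_mx0 // => y sy.
by rewrite M0 // inE sy orbT.
Qed.

Lemma section_rsim_dadd (U V : 'M_n) (modU : mxmodule rG U)
    (modV : mxmodule rG V) :
    (forall x, P x -> (i x <= V)%MS) -> (forall x, P x -> U *m p x = 0) ->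
    (V - V *m \sum_(x | P x) p x *m i x <= U)%MS ->
  mx_rsim (section_repr modU modV) (\big[dadd_grepr/grepr0]_(x | P x) rH x).
Proof.
move=> iV Up VU; rewrite -big_filter; set s := filter _ _.
have sP x : x \in s -> P x by rewrite mem_filter => /andP[].
have us : uniq s by rewrite filter_uniq ?index_enum_uniq.
have [j [q [jC jq qj j0 q0]]] := dadd_retract us (introT allP sP).
apply: (section_rsim modU modV jC _ _ jq).
(* Inclusion in [V] is the vanishing of the product with [cokermx V], to which the test for [j]
   applies. *)
- by rewrite submxE j0 // => x /sP Px; apply/eqP; rewrite -submxE iV.
- by rewrite q0 // => x /sP; apply: Up.
by rewrite -mulmxA qj big_filter.
Qed.

End DirectSum.

Lemma mul_in_submod (F : fieldType) n k l (U : 'M[F]_n) (x : 'M_(k, l))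
    (y : 'M_(l, n)) : x *m in_submod U y = in_submod U (x *m y).
Proof. by rewrite /in_submod /= !mulmxA. Qed.

(** * Induced modules and Frobenius reciprocity *)

Section InducedRetract.

Variables (F : fieldType) (gT hT : finGroupType) (H : {group hT}).
Variables (f : {morphism H >-> gT}) (n m : nat).
Hypothesis injf : ('injm f)%g.
Variables (rG : mx_representation F [set: gT] n).
Variables (rH : mx_representation F H m).

Local Notation rI := (ind_repr f rH).
Local Notation M := (ind_mx f rH (1%:M : 'M_m)).

(** [M] is the sum over h in H of the operators g (x) x |-> f h g (x) x h^-1, which compose through
    the product of H; the square of such a sum is |H| times the sum. *)
Lemma ind_mx_idem : M *m M = #|H|%:R *: M.
Proof.
transitivity (blk_mx (fun g g' => #|H|%:R *:
   \sum_(h in H | (f h * g)%g == g') 1%:M *m rH h^-1%g)); last first.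
  by apply/matrixP=> a b; rewrite !mxE.
rewrite blk_mx_mul.
apply: eq_blk_mx => g g'.
under eq_bigr do rewrite mulmx_suml.
rewrite (exchange_big_dep (mem H)) /=; last by move=> ? ? _ /andP[].
rewrite -sum1_card natr_sum scaler_suml; apply: eq_bigr => h Hh.
rewrite (big_pred1 (f h * g)%g) => [|k]; last by rewrite Hh /= eq_sym.
rewrite mulmx_sumr scale1r (reindex_inj (mulIg h^-1%g)) /=.
apply: eq_big => [k | k].
  rewrite groupMr ?groupV //; case Hk: (k \in H) => //=.
  by rewrite morphM ?groupV // morphV // mulgA mulgKV.
rewrite groupMr ?groupV // => /andP[Hk _].
by rewrite !mul1mx -repr_mxM ?groupV ?groupMr ?groupV // invMg invgK mulKg.
Qed.

(* Frobenius reciprocity: i extends to g (x) x |-> x i g on the induced module,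
   and p to y |-> (g |-> y g^-1 p) into the coinduced one. *)
Definition ind_lift (i : 'M[F]_(m, n)) : 'M[F]_(#|{: gT * 'I_m}|, n) :=
  \matrix_(a, c) (i *m rG (enum_val a).1) (enum_val a).2 c.

Definition coind_lift (p : 'M[F]_(n, m)) : 'M[F]_(n, #|{: gT * 'I_m}|) :=
  \matrix_(c, a) (rG (enum_val a).1^-1%g *m p) c (enum_val a).2.

Lemma mul_ind_lift i k (x : 'M_(n, k)) :
  ind_lift i *m x = \matrix_(a, c) (i *m rG (enum_val a).1 *m x) (enum_val a).2 c.
Proof.
by apply/matrixP=> a c; rewrite !mxE; apply: eq_bigr => b _; rewrite mxE.
Qed.

Lemma mul_coind_lift p k (x : 'M_(k, n)) :
  x *m coind_lift p =
  \matrix_(c, a) (x *m rG (enum_val a).1^-1%g *m p) c (enum_val a).2.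
Proof.
apply/matrixP=> a c; rewrite [LHS]mxE [RHS]mxE -mulmxA [RHS]mxE.
by apply: eq_bigr => b _; rewrite mxE.
Qed.

Lemma trans_ind_lift i g :
  trans_mx F m g *m ind_lift i = ind_lift i *m rG g.
Proof.
rewrite mul_ind_lift; apply/matrixP=> a c; rewrite [LHS]mxE [RHS]mxE.
rewrite (eq_bigr (fun b => (fun q : gT * 'I_m =>
   (if ((enum_val a).1 * g)%g == q.1 then 1%:M else 0) (enum_val a).2 q.2 *
   (i *m rG q.1) q.2 c) (enum_val b))); last by move=> b _; rewrite !mxE.
rewrite (sum_enum_val (fun q : gT * 'I_m =>
   (if ((enum_val a).1 * g)%g == q.1 then 1%:M else 0 : 'M_m)
      (enum_val a).2 q.2 * (i *m rG q.1) q.2 c)).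
rewrite -(pair_bigA _ (fun g1 b =>
   (if ((enum_val a).1 * g)%g == g1 then 1%:M else 0 : 'M_m)
      (enum_val a).2 b * (i *m rG g1) b c)) /=.
rewrite (bigD1 ((enum_val a).1 * g)%g) //= eqxx [X in _ + X]big1 ?addr0.
  rewrite -mulmxA -repr_mxM ?inE //.
  by rewrite -[i *m _ in RHS]mul1mx [RHS]mxE.
by move=> g1 /negPf; rewrite eq_sym => ->; rewrite big1 // => b _; rewrite mxE mul0r.
Qed.

Hypothesis charH : #|H|%:R != 0 :> F.

Lemma ind_mx_sub k (x : 'M_(k, _)) : (x <= M)%MS -> x *m M = #|H|%:R *: x.
Proof. by case/submxP=> y ->; rewrite -mulmxA ind_mx_idem -scalemxAr. Qed.

Section Balanced.

Variables (i : 'M[F]_(m, n)) (p : 'M[F]_(n, m)).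
Hypothesis pC : {in H, forall h, rG (f h) *m p = p *m rH h}.

(** A generator of the induced module is a sum of |H| elementary terms, and for an equivariant [i]
    they all have the same image under [ind_lift i]. The factor |H|^-1 compensates for this. *)
Definition ind_in : 'M[F]_(\rank M, n) :=
  #|H|%:R^-1 *: (val_submod 1%:M *m ind_lift i).

Definition ind_out : 'M[F]_(n, \rank M) := in_submod M (coind_lift p).

(** By equivariance of [p], the functions g |-> y g^-1 p have the covariance under H that defines
    the induced module. Membership is tested with [M], which acts on its row space as the scalar
    |H|. *)
Lemma coind_lift_sub : (coind_lift p <= M)%MS.
Proof.
suff E : coind_lift p *m M = #|H|%:R *: coind_lift p.
  have -> : coind_lift p = #|H|%:R^-1 *: (coind_lift p *m M).
    by rewrite E scalerA mulVf ?scale1r.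
  by rewrite scalemx_sub ?submxMl.
apply/matrixP=> c a; rewrite [LHS]mxE [RHS]mxE [X in _ * X]mxE.
rewrite (eq_bigr (fun b => (fun q : gT * 'I_m => (rG q.1^-1%g *m p) c q.2 *
   (\sum_(h in H | (f h * q.1)%g == (enum_val a).1) rH h^-1%g)
     q.2 (enum_val a).2) (enum_val b))); last first.
  move=> b _; rewrite !mxE; congr (_ * fun_of_matrix _ _ _).
  by apply: eq_bigr => h _; rewrite mul1mx.
rewrite (sum_enum_val (fun q : gT * 'I_m => (rG q.1^-1%g *m p) c q.2 *
   (\sum_(h in H | (f h * q.1)%g == (enum_val a).1) rH h^-1%g)
     q.2 (enum_val a).2)).
rewrite -(pair_bigA _ (fun g b => (rG g^-1%g *m p) c b *
   (\sum_(h in H | (f h * g)%g == (enum_val a).1) rH h^-1%g)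
     b (enum_val a).2)) /=.
transitivity ((\sum_g \sum_(h in H | (f h * g)%g == (enum_val a).1)
    rG g^-1%g *m p *m rH h^-1%g) c (enum_val a).2).
  by rewrite summxE; apply: eq_bigr => g _; rewrite -mulmx_sumr [in RHS]mxE.
rewrite (exchange_big_dep (mem H)) /=; last by move=> ? ? _ /andP[].
rewrite summxE -sum1_card natr_sum mulr_suml; apply: eq_bigr => h Hh.
rewrite mul1r; congr (fun_of_matrix _ _ _).
rewrite (big_pred1 ((f h)^-1 * (enum_val a).1)%g) => [|g]; last first.
  by rewrite Hh /= (can2_eq (mulKg (f h)) (mulKVg (f h))).
by rewrite -mulmxA -pC ?groupV // mulmxA morphV // -repr_mxM ?inE // invMg invgK mulgK.
Qed.

Lemma ind_inC : intertwines rI rG ind_in.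
Proof.
move=> g Gg; rewrite -scalemxAr -scalemxAl; congr (_ *: _).
rewrite -[RHS]mulmxA -trans_ind_lift [LHS]mulmxA [RHS]mulmxA -val_submodE.
by congr (_ *m _); rewrite -[rI g]mul1mx val_submodJ.
Qed.

(** The block of the product of the two lifts at (g, g') is i (g g'^-1) p. It vanishes when g g'^-1
    is outside the image of H and is the action of h when g g'^-1 = f h, so the product is [M]
    itself, which acts as |H| on its row space. *)
Lemma ind_inK : i *m p = 1%:M ->
    (forall g, g \notin (f @* H)%g -> i *m rG g *m p = 0) ->
  ind_in *m ind_out = 1%:M.
Proof.
move=> ip1 ip0; rewrite -scalemxAl.
rewrite /ind_out mul_in_submod -mulmxA.
suff -> : ind_lift i *m coind_lift p = M.
  by rewrite ind_mx_sub ?val_submodP // linearZ /= val_submodK scalerA mulVf ?scale1r.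
rewrite mul_ind_lift; apply/matrixP=> a b.
rewrite mxE mul_coind_lift mxE -[i *m _ *m _]mulmxA -repr_mxM ?inE // [RHS]mxE.
move: (enum_val a) (enum_val b) => [g c] [g' d] /=.
congr (fun_of_matrix _ c d).
have [/morphimP[h Hh _ gE] | Hg] := boolP ((g * g'^-1)%g \in (f @* H)%g).
  rewrite gE -mulmxA pC // mulmxA ip1 mul1mx (big_pred1 h^-1%g).
    by rewrite invgK mul1mx.
  have {}gE : g = (f h * g')%g by rewrite -gE mulgKV.
  move=> k; apply/andP/eqP => [[Hk /eqP E] | ->]; last first.
    by rewrite groupV morphV // gE mulKg.
  apply: (injmP injf); rewrite ?groupV // morphV //.
  apply: (mulIg (f h)); rewrite mulVg; apply: (mulIg g').
  by rewrite mul1g -mulgA -gE.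
rewrite ip0 // big_pred0 // => h; apply/andP=> -[Hh /eqP E].
by case/negP: Hg; rewrite -E invMg mulKVg -morphV ?mem_morphim ?groupV.
Qed.

(** When [i] is equivariant too, a summand depends only on the coset of g modulo the image of H, so
    that |H|^-1 leaves one conjugate of [p *m i] per coset. *)
Lemma ind_out_in : ind_out *m ind_in =
  #|H|%:R^-1 *: \sum_g rG g^-1%g *m (p *m i) *m rG g.
Proof.
rewrite -scalemxAr; congr (_ *: _).
rewrite mulmxA -val_submodE in_submodK ?coind_lift_sub //.
apply/matrixP=> c d; rewrite mxE summxE.
rewrite (eq_bigr (fun b => (fun q : gT * 'I_m => (rG q.1^-1%g *m p) c q.2 *
   (i *m rG q.1) q.2 d) (enum_val b))); last by move=> b _; rewrite !mxE.
rewrite (sum_enum_val (fun q : gT * 'I_m => (rG q.1^-1%g *m p) c q.2 *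
   (i *m rG q.1) q.2 d)).
rewrite -(pair_bigA _ (fun g b => (rG g^-1%g *m p) c b * (i *m rG g) b d)) /=.
by apply: eq_bigr => g _; rewrite mulmxA -[_ *m i *m _]mulmxA [RHS]mxE.
Qed.

Lemma sub_ind_in k (V : 'M_(k, n)) : mxmodule rG V -> (i <= V)%MS ->
  (ind_in <= V)%MS.
Proof.
move=> modV iV; rewrite scalemx_sub // mulmx_sub //; apply/row_subP=> a.
have -> : row a (ind_lift i) = row (enum_val a).2 i *m rG (enum_val a).1.
  by rewrite -row_mul; apply/rowP=> c; rewrite !mxE.
by rewrite mxmodule_trans ?inE // (submx_trans (row_sub _ _)).
Qed.

Lemma mul_ind_in0 k (x : 'M_(n, k)) :
  (forall g, i *m rG g *m x = 0) -> ind_in *m x = 0.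
Proof.
move=> ix; rewrite -scalemxAl -mulmxA mul_ind_lift.
rewrite (_ : (\matrix_(a, c) _) = 0) ?mulmx0 ?scaler0 //.
by apply/matrixP=> a c; rewrite mxE ix !mxE.
Qed.

Lemma mul_ind_out0 k (x : 'M_(k, n)) :
  (forall g, x *m rG g *m p = 0) -> x *m ind_out = 0.
Proof.
move=> xp; rewrite /ind_out mul_in_submod.
suff -> : x *m coind_lift p = 0 by rewrite linear0.
by rewrite mul_coind_lift; apply/matrixP=> c a; rewrite mxE xp !mxE.
Qed.

Lemma ind_out0 k (U : 'M_(k, n)) : mxmodule rG U -> U *m p = 0 ->
  U *m ind_out = 0.
Proof.
move=> modU Up; apply: mul_ind_out0 => g.
have /submxP[X ->] := mxmoduleP modU g (in_setT _).
by rewrite -mulmxA Up mulmx0.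
Qed.

End Balanced.

End InducedRetract.

(** * Bilinearity of the tensor product of matrices *)

Section Tensor.

Variable F : comPzRingType.

Lemma tensmxDl m n p q (A A' : 'M[F]_(m, n)) (B : 'M[F]_(p, q)) :
  (A + A') *t B = A *t B + A' *t B.
Proof. by apply/matrixP=> i j; rewrite !mxE mulrDl. Qed.

Lemma tensmxDr m n p q (A : 'M[F]_(m, n)) (B B' : 'M[F]_(p, q)) :
  A *t (B + B') = A *t B + A *t B'.
Proof. by apply/matrixP=> i j; rewrite !mxE mulrDr. Qed.

Lemma tensmxZl m n p q a (A : 'M[F]_(m, n)) (B : 'M[F]_(p, q)) :
  (a *: A) *t B = a *: (A *t B).
Proof. by apply/matrixP=> i j; rewrite !mxE mulrA. Qed.

Lemma tensmxZr m n p q a (A : 'M[F]_(m, n)) (B : 'M[F]_(p, q)) :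
  A *t (a *: B) = a *: (A *t B).
Proof. by apply/matrixP=> i j; rewrite !mxE mulrCA. Qed.

Lemma tensmxNl m n p q (A : 'M[F]_(m, n)) (B : 'M[F]_(p, q)) :
  (- A) *t B = - (A *t B).
Proof. by apply/matrixP=> i j; rewrite !mxE mulNr. Qed.

Lemma tensmxNr m n p q (A : 'M[F]_(m, n)) (B : 'M[F]_(p, q)) :
  A *t (- B) = - (A *t B).
Proof. by apply/matrixP=> i j; rewrite !mxE mulrN. Qed.

Lemma tensmx_suml m n p q (I : Type) (r : seq I) (P : pred I)
    (A : I -> 'M[F]_(m, n)) (B : 'M[F]_(p, q)) :
  (\sum_(i <- r | P i) A i) *t B = \sum_(i <- r | P i) A i *t B.
Proof.
elim/big_rec2: _ => [|i x y _ <-]; first exact: tens0mx.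
by rewrite tensmxDl.
Qed.

Lemma tensmx_sumr m n p q (I : Type) (r : seq I) (P : pred I)
    (A : 'M[F]_(m, n)) (B : I -> 'M[F]_(p, q)) :
  A *t (\sum_(i <- r | P i) B i) = \sum_(i <- r | P i) A *t B i.
Proof.
elim/big_rec2: _ => [|i x y _ <-]; first exact: tensmx0.
by rewrite tensmxDr.
Qed.

End Tensor.

(* D is a differential, e i projects onto the part of degree i, and P i projects
   the latter onto a complement of the boundaries in the cycles. *)
Record graded_retract (F : fieldType) n (e P : nat -> 'M[F]_n) (D : 'M[F]_n)
    (N : nat) : Prop := GradedRetract {
  gr_ee : forall i k, e i *m e k = if i == k then e i else 0;
  gr_eN : forall i, (N <= i)%N -> e i = 0;
  gr_e0D : e 0 *m D = 0;
  gr_eDe : forall i, e i.+1 *m D *m e i = e i.+1 *m D;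
  gr_eDD : forall i, e i.+1 *m D *m D = 0;
  gr_eP : forall i, e i *m P i = P i;
  gr_Pe : forall i, P i *m e i = P i;
  gr_PP : forall i, P i *m P i = P i;
  gr_PD : forall i, P i *m D = 0;
  gr_eDP : forall i, e i.+1 *m D *m P i = 0;
  gr_cycle : forall i (x : 'M[F]_n),
    x *m e i = x -> x *m D = 0 -> (x - x *m P i <= e i.+1 *m D)%MS
}.

(** * Contracting homotopies over a field *)

Section Contraction.

Variables (F : fieldType) (n : nat) (e P : nat -> 'M[F]_n) (D : 'M[F]_n).
Variable N : nat.
Hypothesis C : graded_retract e P D N.

Let ee := gr_ee C.
Let eN := gr_eN C.
Let e0D := gr_e0D C.
Let eDe := gr_eDe C.
Let eDD := gr_eDD C.
Let eP := gr_eP C.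
Let Pe := gr_Pe C.
Let PP := gr_PP C.
Let PD := gr_PD C.
Let eDP := gr_eDP C.
Let cycleP := gr_cycle C.

(** Over a field the differential has a linear section [s] on the boundaries. With [t] (apply D,
    then lift back), 1 - t maps chains to cycles, 1 - P maps cycles to boundaries, and [s] lifts
    these; the homotopy is the composite of the three. *)
Lemma graded_contraction : exists h : nat -> 'M[F]_n,
  [/\ forall i, e i *m h i = h i, forall i, h i *m e i.+1 = h i,
      h 0 *m D = e 0 - P 0
    & forall i, e i.+1 *m D *m h i + h i.+1 *m D = e i.+1 - P i.+1].
Proof.
have ei i : e i *m e i = e i by rewrite ee eqxx.
have [s [sE sP sD]] : exists s : nat -> 'M[F]_n,
    [/\ forall i, s i *m e i.+1 = s i, forall i, s i *m P i.+1 = 0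
      & forall i (b : 'M_n), (b <= e i.+1 *m D)%MS -> b *m s i *m D = b].
  (* The pseudo-inverse is cut down to degree i + 1 and followed by 1 - P, which does not disturb
     the section property because P D = 0. The condition s P = 0 obtained in this way removes the
     term e t P from the homotopy identity. *)
  exists (fun i => pinvmx (e i.+1 *m D) *m e i.+1 *m (1%:M - P i.+1)).
  split=> [i | i | i b /mulmxKpV]; move: (pinvmx _) => X.
  - rewrite -!mulmxA; congr (_ *m _).
    by rewrite mulmxBl mul1mx Pe !mulmxBr mulmx1 ei.
  - by rewrite -mulmxA mulmxBl mul1mx PP subrr mulmx0.
  move=> XP; rewrite !mulmxA mulmxBr mulmx1 mulmxBl -[_ *m P _ *m _]mulmxA PD.
  by rewrite mulmx0 subr0 -[LHS]mulmxA XP.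
(* In degree 0 every chain is a cycle, by [e 0 *m D = 0], and nothing has to be subtracted. *)
pose t i := if i is k.+1 then D *m s k else 0.
have te i : t i *m e i = t i.
  by case: i => [|i] /=; rewrite ?mul0mx // -mulmxA sE.
have etD i : e i *m t i *m D = e i *m D.
  by case: i => [|i] /=; rewrite ?mulmx0 ?mul0mx ?e0D // mulmxA sD.
have eDt i : e i.+1 *m D *m t i = 0.
  by case: i => [|i] /=; rewrite ?mulmx0 // mulmxA eDD mul0mx.
pose h i := e i *m (1%:M - t i) *m (1%:M - P i) *m s i.
have hD i : h i *m D = e i - P i - e i *m t i + e i *m t i *m P i.
  rewrite /h sD; last first.
    rewrite [in X in (X <= _)%MS]mulmxBr mulmx1; apply: cycleP.
      by rewrite mulmxBr mulmx1 mulmxBl ei -mulmxA te.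
    by rewrite mulmxBr mulmx1 mulmxBl etD subrr.
  rewrite mulmxBr mulmx1 mulmxBr mulmx1 mulmxBl eP opprB.
  by rewrite [_ - P i]addrC addrACA addrA.
exists h; split=> [i | i ||i].
- by rewrite /h !mulmxA ei.
- by rewrite /h -mulmxA sE.
- by rewrite hD /= mulmx0 mul0mx subr0 addr0.
rewrite hD /h !mulmxA eDe [e i.+1 *m D *m (_ - t i)]mulmxBr mulmx1 eDt subr0.
rewrite [_ *m (_ - P i)]mulmxBr mulmx1 eDP subr0.
by rewrite -[_ *m s i *m P _]mulmxA sP mulmx0 addr0 addrC subrK.
Qed.

Local Notation et := (\sum_(i < N) e i).
Local Notation Pt := (\sum_(i < N) P i).

Lemma mul_total_graded (X : nat -> 'M[F]_n) i :
    (forall k, e k *m X k = X k) -> e i *m \sum_(k < N) X k = X i.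
Proof.
move=> eX; rewrite mulmx_sumr.
under eq_bigr => k _ do rewrite -eX mulmxA ee.
have [iN | Ni] := ltnP i N; last first.
  rewrite -[RHS]eX eN // mul0mx big1 // => k _.
  by case: ifP; rewrite mul0mx.
rewrite (bigD1 (Ordinal iN)) //= eqxx eX big1 ?addr0 // => k.
by rewrite -val_eqE /= eq_sym => /negPf->; rewrite mul0mx.
Qed.

(** The tensor product calls for one matrix in all degrees. Summing below N loses nothing since
    [e i] is zero from N on, and D stands behind [et] because it is controlled only on the graded
    part. *)
Lemma total_contraction : exists h : 'M[F]_n,
  [/\ et *m h = h, forall i, e i *m h *m e i.+1 = e i *m h
    & et *m D *m h + h *m D = et - Pt].
Proof.
have [h [eh he h0 hS]] := graded_contraction.
have ei i : e i *m e i = e i by rewrite ee eqxx.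
have eht i : e i *m \sum_(k < N) h k = h i by apply: mul_total_graded.
exists (\sum_(i < N) h i); split.
- by rewrite mulmx_suml; apply: eq_bigr => i _; rewrite eht.
- by move=> i; rewrite eht he.
rewrite !mulmx_suml -sumrB -big_split /=; apply: eq_bigr => -[[|i] lti] _ /=.
  by rewrite e0D mul0mx add0r h0.
by rewrite -eDe -[_ *m e i *m _]mulmxA eht hS.
Qed.

End Contraction.

(** * The Kunneth formula for a tensor product of retracts *)

Definition tensor_piece (F : fieldType) nA nB (XA : nat -> 'M[F]_nA)
    (XB : nat -> 'M[F]_nB) i :=
  \sum_(x : 'I_i.+1 * 'I_i.+1 | (x.1 + x.2 == i)%N) XA x.1 *t XB x.2.

Lemma mul_tensor_piece (F : fieldType) nA nB (eA : nat -> 'M[F]_nA)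
    (eB : nat -> 'M[F]_nB) p q i :
    (forall i k, eA i *m eA k = if i == k then eA i else 0) ->
    (forall i k, eB i *m eB k = if i == k then eB i else 0) ->
  (eA p *t eB q) *m tensor_piece eA eB i =
  if (p + q == i)%N then eA p *t eB q else 0.
Proof.
move=> eeA eeB; rewrite mulmx_sumr.
under eq_bigr => x _ do rewrite tensmx_mul eeA eeB.
case: eqP => [<-{i} | ne]; last first.
  rewrite big1 // => -[x y] /= /eqP xy; case: eqP => [px|_]; rewrite ?tens0mx //.
  by case: eqP => [qy|_]; rewrite ?tensmx0 //; case: ne; rewrite px qy.
have ltp : (p < (p + q).+1)%N by rewrite ltnS leq_addr.
have ltq : (q < (p + q).+1)%N by rewrite ltnS leq_addl.
rewrite (bigD1 (Ordinal ltp, Ordinal ltq)) //= !eqxx big1 ?addr0 // => -[x y] /=.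
case/andP=> _; rewrite xpair_eqE -!val_eqE /= negb_and.
rewrite [val x == p]eq_sym [val y == q]eq_sym.
by case/orP=> /negPf->; rewrite ?tens0mx ?tensmx0.
Qed.

Section Kunneth.

Variables (F : fieldType) (nA nB : nat).
Variables (eA : nat -> 'M[F]_nA) (eB : nat -> 'M[F]_nB).
Variables (PA : nat -> 'M[F]_nA) (PB : nat -> 'M[F]_nB).
Variables (DA tA : 'M[F]_nA) (DB : 'M[F]_nB) (N : nat).

Hypothesis CA : graded_retract eA PA DA N.
Hypothesis CB : graded_retract eB PB DB N.
Hypothesis eAt : forall i, eA i *m tA = (-1) ^+ i *: eA i.
Hypothesis tAe : forall i, tA *m eA i = (-1) ^+ i *: eA i.
Hypothesis DtA : DA *m tA = - (tA *m DA).

Definition tensor_diff := DA *t 1%:M + tA *t DB.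

(** The factors are contracted in turn: hA (x) 1 accounts for (1 - PA) (x) 1 and the signed PA (x)
    hB for PA (x) (1 - PB), with sum 1 - PA (x) PB. The cross terms disappear because hA shifts the
    degree by one, hence anticommutes with the sign [tA], and because DA vanishes before and after
    PA. *)
Lemma kunneth_contraction i m (y : 'M_(m, nA * nB)) :
    y *m tensor_piece eA eB i = y -> y *m tensor_diff = 0 ->
  exists2 w : 'M_(m, nA * nB), w *m tensor_piece eA eB i.+1 = w &
    y - y *m tensor_piece PA PB i = w *m tensor_diff.
Proof.
move=> yE yD.
have [hA [ehA hgA HA]] := total_contraction CA.
have [hB [ehB hgB HB]] := total_contraction CB.
set EA := \sum_(k < N) eA k in ehA HA.
set EB := \sum_(k < N) eB k in ehB HB.
set QA := \sum_(k < N) PA k in HA.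
set QB := \sum_(k < N) PB k in HB.
have eEA k : eA k *m EA = eA k.
  by apply: mul_total_graded CA _ _ _ => l; rewrite (gr_ee CA) eqxx.
have eEB k : eB k *m EB = eB k.
  by apply: mul_total_graded CB _ _ _ => l; rewrite (gr_ee CB) eqxx.
have eQA k : eA k *m QA = PA k by apply: mul_total_graded CA _ _ (gr_eP CA).
have eQB k : eB k *m QB = PB k by apply: mul_total_graded CB _ _ (gr_eP CB).
have EDE : EB *m DB *m EB = EB *m DB.
  rewrite !mulmx_suml; apply: eq_bigr => -[[|k] ltk] _ /=.
    by rewrite (gr_e0D CB) mul0mx.
  by rewrite -(gr_eDe CB) -[_ *m eB k *m _]mulmxA eEB.
have EtA : EA *m tA = tA *m EA.
  by rewrite mulmx_suml mulmx_sumr; apply: eq_bigr => k _; rewrite eAt tAe.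
have EttA : EA *m tA *m tA = EA.
  rewrite !mulmx_suml; apply: eq_bigr => k _.
  by rewrite eAt -scalemxAl eAt scalerA -expr2 sqrr_sign scale1r.
have QtA : QA *m tA = tA *m QA.
  rewrite mulmx_suml mulmx_sumr; apply: eq_bigr => k _.
  rewrite -[in LHS](gr_Pe CA) -mulmxA eAt -scalemxAr (gr_Pe CA).
  by rewrite -[in RHS](gr_eP CA) mulmxA tAe -scalemxAl (gr_eP CA).
have EQA : EA *m QA = QA.
  by rewrite mulmx_suml; apply: eq_bigr => k _; rewrite eQA.
have QDA : QA *m DA = 0 by rewrite mulmx_suml big1 // => k _; rewrite (gr_PD CA).
have EDQA : EA *m DA *m QA = 0.
  rewrite !mulmx_suml big1 // => -[[|k] ltk] _ /=; first by rewrite (gr_e0D CA) mul0mx.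
  by rewrite -(gr_eDe CA) -[_ *m eA k *m _]mulmxA eQA (gr_eDP CA).
have htA : hA *m tA = - (tA *m hA).
  have hE : hA = \sum_(k < N) eA k *m hA by rewrite -mulmx_suml ehA.
  rewrite {1}hE {2}hE mulmx_suml mulmx_sumr -sumrN; apply: eq_bigr => k _.
  rewrite -[in LHS]hgA -[LHS]mulmxA eAt -scalemxAr hgA.
  by rewrite mulmxA tAe -scalemxAl exprS mulN1r scaleNr.
pose h := hA *t EB + (tA *m QA) *t hB.
have hD : (EA *t EB) *m tensor_diff *m h + h *m tensor_diff =
    EA *t EB - QA *t QB.
  rewrite /h /tensor_diff !(mulmxDl, mulmxDr) !tensmx_mul !mulmx1.
  rewrite EDE htA.
  have -> : EA *m DA *m (tA *m QA) = 0.
    by rewrite mulmxA -[EA *m DA *m tA]mulmxA DtA mulmxN mulNmx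
       [EA *m (tA *m DA)]mulmxA EtA -[tA *m EA *m DA]mulmxA -mulmxA EDQA mulmx0
       oppr0.
  have -> : EA *m tA *m hA = tA *m hA by rewrite EtA -mulmxA ehA.
  have -> : EA *m tA *m (tA *m QA) = QA by rewrite mulmxA EttA EQA.
  have -> : tA *m QA *m DA = 0 by rewrite -mulmxA QDA mulmx0.
  have -> : tA *m QA *m tA = QA.
    rewrite -mulmxA QtA -EQA !mulmxA -[tA *m tA *m EA]mulmxA -EtA mulmxA -EtA.
    by rewrite EttA.
  have -> : EB *m EB = EB by rewrite mulmx_suml; apply: eq_bigr => k _; rewrite eEB.
  rewrite !tens0mx tensmxNl ?add0r ?addr0 addrACA [X in X + _]addrACA subrr addr0.
  rewrite -tensmxDl -tensmxDr HA HB tensmxDl tensmxDr tensmxNl tensmxNr.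
  by rewrite addrA subrK.
have yE' : y *m (EA *t EB) = y.
  rewrite -yE -mulmxA mulmx_suml; congr (_ *m _); apply: eq_bigr => x _.
  by rewrite tensmx_mul eEA eEB.
exists (y *m h).
  rewrite -yE -!mulmxA; congr (_ *m _); rewrite mulmxA.
  suff E (x : 'I_i.+1 * 'I_i.+1) : (x.1 + x.2 == i)%N ->
      (eA x.1 *t eB x.2) *m h *m tensor_piece eA eB i.+1 = (eA x.1 *t eB x.2) *m h.
    by rewrite mulmx_suml mulmx_suml; apply: eq_bigr => x; apply: E.
  move=> /eqP xi; rewrite /h mulmxDr mulmxDl !tensmx_mul eEB.
  congr (_ + _).
    rewrite -hgA -[eB x.2]mul1mx -tensmx_mul -mulmxA.
    by rewrite (mul_tensor_piece _ _ _ (gr_ee CA) (gr_ee CB)) addSn xi eqxx.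
  rewrite mulmxA eAt -scalemxAl eQA -(gr_Pe CA) scalemxAl -hgB -tensmx_mul -mulmxA.
  by rewrite (mul_tensor_piece _ _ _ (gr_ee CA) (gr_ee CB)) addnS xi eqxx.
have := congr1 (mulmx y) hD; rewrite mulmxDr !mulmxA yE' yD mul0mx add0r => ->.
rewrite mulmxBr yE'; congr (_ - _).
rewrite -{2}yE -[RHS]mulmxA mulmx_suml; congr (_ *m _); apply: eq_bigr => x _.
by rewrite tensmx_mul eQA eQB.
Qed.

End Kunneth.

(* A complex of modules over a group, presented inside one ambient module:
   the part of degree i is the image of the projection gc_proj i. *)
Record graded_complex (F : fieldType) (gT : finGroupType) := GradedComplex {
  gc_dim : nat;
  gc_repr : mx_representation F [set: gT] gc_dim;
  gc_diff : 'M[F]_gc_dim;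
  gc_proj : nat -> 'M[F]_gc_dim;
  gc_sign : 'M[F]_gc_dim;
  gc_boundaries : nat -> 'M[F]_gc_dim;
  gc_cycles : nat -> 'M[F]_gc_dim;
  gc_bound : nat;
  gc_boundaries_module : forall i, mxmodule gc_repr (gc_boundaries i);
  gc_cycles_module : forall i, mxmodule gc_repr (gc_cycles i);
  gc_boundariesE : forall i, (gc_boundaries i :=: gc_proj i.+1 *m gc_diff)%MS;
  gc_cyclesE : forall i, (gc_cycles i :=: gc_proj i :&: kermx gc_diff)%MS;
  gc_projC : forall i, intertwines gc_repr gc_repr (gc_proj i);
  gc_proj_mul : forall i k,
    gc_proj i *m gc_proj k = if i == k then gc_proj i else 0;
  gc_proj_ge : forall i, (gc_bound <= i)%N -> gc_proj i = 0;
  gc_proj0_diff : gc_proj 0 *m gc_diff = 0;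
  gc_proj_diff :
    forall i, gc_proj i.+1 *m gc_diff *m gc_proj i = gc_proj i.+1 *m gc_diff;
  gc_diff_diff : gc_diff *m gc_diff = 0;
  gc_proj_sign : forall i, gc_proj i *m gc_sign = (-1) ^+ i *: gc_proj i;
  gc_sign_proj : forall i, gc_sign *m gc_proj i = (-1) ^+ i *: gc_proj i;
  gc_diff_sign : gc_diff *m gc_sign = - (gc_sign *m gc_diff)
}.

(** * Homology of an abstract equivariant complex *)

Section Homology.

Variables (F : fieldType) (gT : finGroupType) (c : graded_complex F gT).

Local Notation rG := (gc_repr c).
Local Notation e := (gc_proj c).
Local Notation D := (gc_diff c).
Local Notation B := (gc_boundaries c).
Local Notation Z := (gc_cycles c).

Definition gc_homology i :=
  section_repr (gc_boundaries_module c i) (gc_cycles_module c i).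

(** [section_proj] is controlled only on the cycles of degree i; the factor [e i] makes the map
    vanish on the other degrees. *)
Definition homology_proj i :=
  e i *m section_proj (gc_boundaries_module c i) (gc_cycles_module c i).

Definition homology_lift i :=
  section_lift (gc_boundaries_module c i) (gc_cycles_module c i).

Lemma sub_cycles m (x : 'M_(m, _)) i :
  (x <= Z i)%MS = (x *m e i == x) && (x *m D == 0).
Proof.
rewrite gc_cyclesE sub_capmx; congr (_ && _); last exact/sub_kermxP/eqP.
apply/idP/eqP => [/submxP[y ->] | <-]; last exact: submxMl.
by rewrite -mulmxA gc_proj_mul eqxx.
Qed.

Lemma sub_boundaries_cycles i : (B i <= Z i)%MS.
Proof.
rewrite sub_cycles; have /submxP[y ->] : (B i <= e i.+1 *m D)%MS.
  by rewrite gc_boundariesE.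
by rewrite -!mulmxA gc_diff_diff !mulmx0 [e _ *m _]mulmxA gc_proj_diff !eqxx.
Qed.

Lemma homology_projC i : intertwines rG (gc_homology i) (homology_proj i).
Proof.
by move=> g Gg; rewrite mulmxA gc_projC // -mulmxA section_projC // mulmxA.
Qed.

Lemma homology_liftC i : intertwines (gc_homology i) rG (homology_lift i).
Proof. exact: section_liftC. Qed.

Hypothesis charG : #|[set: gT]|%:R != 0 :> F.

Lemma homology_lift_cycle i :
  homology_lift i *m e i = homology_lift i /\ homology_lift i *m D = 0.
Proof.
have := section_lift_sub (gc_boundaries_module c i) (gc_cycles_module c i).
by rewrite sub_cycles => /andP[/eqP-> /eqP->].
Qed.

Lemma homology_liftK i : homology_lift i *m homology_proj i = 1%:M.
Proof.
by rewrite mulmxA (homology_lift_cycle i).1 section_liftK ?sub_boundaries_cycles.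
Qed.

Lemma homology_lift_proj i k : i != k ->
  homology_lift i *m homology_proj k = 0.
Proof.
move=> /negPf ik; rewrite -(homology_lift_cycle i).1 mulmxA.
by rewrite -[_ *m e i *m e k]mulmxA gc_proj_mul ik mulmx0 mul0mx.
Qed.

(** For k = i + 1 these are boundaries of degree i, which die in the homology; for any other
    positive k the degree is wrong, and for k = 0 the differential vanishes. *)
Lemma boundary_homology_proj i k : e k *m D *m homology_proj i = 0.
Proof.
case: k => [|k]; first by rewrite gc_proj0_diff mul0mx.
rewrite -gc_proj_diff mulmxA -[_ *m e k *m e i]mulmxA gc_proj_mul.
case: eqP => [->|_]; last by rewrite mulmx0 mul0mx.
rewrite gc_proj_diff; have /submxP[y ->] : (e i.+1 *m D <= B i)%MS.
  by rewrite gc_boundariesE.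
by rewrite -mulmxA sub_section_proj ?sub_boundaries_cycles // mulmx0.
Qed.

Lemma homology_retract N : (gc_bound c <= N)%N ->
  graded_retract e (fun i => homology_proj i *m homology_lift i) D N.
Proof.
move=> leN; split=> [i k | i Ni || i | i | i | i | i | i | i | i x xe xD].
- exact: gc_proj_mul.
- by rewrite gc_proj_ge // (leq_trans leN).
- exact: gc_proj0_diff.
- exact: gc_proj_diff.
- by rewrite -mulmxA gc_diff_diff mulmx0.
- by rewrite !mulmxA gc_proj_mul eqxx.
- by rewrite -mulmxA (homology_lift_cycle i).1.
- by rewrite mulmxA -[_ *m homology_proj i]mulmxA homology_liftK mulmx1.
- by rewrite -mulmxA (homology_lift_cycle i).2 mulmx0.
- by rewrite mulmxA boundary_homology_proj mul0mx.
rewrite -(gc_boundariesE c i) !mulmxA xe section_projK ?sub_boundaries_cycles //.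
by rewrite sub_cycles xe xD !eqxx.
Qed.

End Homology.

(** * The induced Kunneth formula *)

Section InducedKunneth.

Variables (F : fieldType) (aT bT gT : finGroupType).
Variables (f : {morphism [set: aT * bT] >-> gT}).
Hypothesis injf : ('injm f)%g.
Hypothesis charF : forall n, n.+1%:R != 0 :> F.

Variables (cA : nat -> graded_complex F aT) (cB : nat -> graded_complex F bT).
Variables (c : graded_complex F gT) (j : nat).
Variables (wA : forall q, 'M[F]_(gc_dim (cA q))) (wB : forall s, 'M[F]_(gc_dim (cB s))).
Variable k : forall q s, 'M[F]_(gc_dim (cA q) * gc_dim (cB s), gc_dim c).

Local Notation support := (\sum_(x : 'I_j.+1 * 'I_j.+1 | (x.1 + x.2 == j)%N)
  (k x.1 x.2)^T *m k x.1 x.2).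

(* The embeddings k q s of the tensor products, for q + s = j, are isometries
   onto orthogonal subspaces; their sum is a system of imprimitivity for the
   action of gT relative to the image of f. *)
Hypothesis kk : forall q s, (q + s)%N = j -> k q s *m (k q s)^T = 1%:M.
Hypothesis kk0 : forall q s q' s', q != q' -> k q s *m (k q' s')^T = 0.
Hypothesis kgk : forall q s q' s' g, g \notin (f @* [set: aT * bT])%g ->
  k q s *m gc_repr c g *m (k q' s')^T = 0.
Hypothesis kC : forall q s a b, (q + s)%N = j ->
  k q s *m gc_repr c (f (a, b)) = (gc_repr (cA q) a *t gc_repr (cB s) b) *m k q s.
Hypothesis k_proj : forall q s i, (q + s)%N = j ->
  k q s *m gc_proj c i = tensor_piece (gc_proj (cA q)) (gc_proj (cB s)) i *m k q s.
(** [wA] and [wB] are the projections undergone by the factor whose state loses no edge. By [projwA]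
    and [projwB] they are trivial on chains, where the formula becomes that of [tensor_diff]. *)
Hypothesis k_diff : forall q s, (q + s)%N = j ->
  k q s *m gc_diff c = (gc_diff (cA q) *t wB s +
    (gc_sign (cA q) *m wA q) *t gc_diff (cB s)) *m k q s.
Hypothesis projwA : forall q p, gc_proj (cA q) p *m wA q = gc_proj (cA q) p.
Hypothesis projwB : forall s r, gc_proj (cB s) r *m wB s = gc_proj (cB s) r.
Hypothesis support_repr : forall h,
  support *m gc_repr c (f h) = gc_repr c (f h) *m support.
Hypothesis support_proj : forall i, support *m gc_proj c i = gc_proj c i *m support.
Hypothesis support_diff : support *m gc_diff c = gc_diff c *m support.
Hypothesis sum_support :
  \sum_g gc_repr c g^-1%g *m support *m gc_repr c g = #|[set: aT * bT]|%:R%:M.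

Let char_card (hT : finGroupType) : #|[set: hT]|%:R != 0 :> F.
Proof. by rewrite -(prednK (cardG_gt0 [set: hT]%G)). Qed.

(** Transposes the relation k X = Y k without using the transposes of X and Y: [support] fixes the
    transpose of [k q s] and commutes with X, and after expanding [support] only the term of index
    (q, s) survives, by orthogonality. *)
Let trk q s X Y : (q + s)%N = j -> support *m X = X *m support ->
    (forall q' s', (q' + s')%N = j -> k q' s' *m X = Y q' s' *m k q' s') ->
  X *m (k q s)^T = (k q s)^T *m Y q s.
Proof.
move=> qsj XC XY.
have ltq : (q < j.+1)%N by rewrite ltnS -qsj leq_addr.
have lts : (s < j.+1)%N by rewrite ltnS -qsj leq_addl.
have neq (x : 'I_j.+1 * 'I_j.+1) : (x.1 + x.2 == j)%N ->
    x != (Ordinal ltq, Ordinal lts) -> x.1 != q :> nat.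
  move=> /eqP xj; apply: contraNneq => xq.
  rewrite [x]surjective_pairing; apply/eqP; congr (_, _); apply: val_inj => //=.
  by apply: (@addnI q); rewrite qsj -{1}xq xj.
have supK : support *m (k q s)^T = (k q s)^T.
  rewrite mulmx_suml (bigD1 (Ordinal ltq, Ordinal lts)) /= ?qsj //.
  rewrite -mulmxA kk // mulmx1 big1 ?addr0 // => x /andP[xj ne].
  by rewrite -mulmxA kk0 ?mulmx0 // neq.
rewrite -{1}supK mulmxA -XC !mulmx_suml.
rewrite (bigD1 (Ordinal ltq, Ordinal lts)) /= ?qsj //.
rewrite -[_ *m _ *m X]mulmxA XY // -!mulmxA kk // mulmx1.
rewrite big1 ?addr0 // => x /andP[/eqP xj ne].
by rewrite -[_ *m _ *m X]mulmxA XY // -!mulmxA kk0 ?mulmx0 // neq //; apply/eqP.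
Qed.

Variable i : nat.

Local Notation index := (('I_i.+1 * 'I_i.+1) * ('I_j.+1 * 'I_j.+1))%type.
Local Notation P := (fun x : index => (x.1.1 + x.1.2 == i)%N && (x.2.1 + x.2.2 == j)%N).

Local Notation rH x := (xtens_repr (gc_homology (cA x.2.1) x.1.1)
  (gc_homology (cB x.2.2) x.1.2)).

Definition tens_lift (x : index) :=
  homology_lift (cA x.2.1) x.1.1 *t homology_lift (cB x.2.2) x.1.2 *m k x.2.1 x.2.2.

Definition tens_proj (x : index) := (k x.2.1 x.2.2)^T *m
  (homology_proj (cA x.2.1) x.1.1 *t homology_proj (cB x.2.2) x.1.2).

Let diff_tr q s : (q + s)%N = j -> gc_diff c *m (k q s)^T = (k q s)^T *m
  (gc_diff (cA q) *t wB s + (gc_sign (cA q) *m wA q) *t gc_diff (cB s)).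
Proof.
move=> qs; apply: (trk (Y := fun q s => gc_diff (cA q) *t wB s +
  (gc_sign (cA q) *m wA q) *t gc_diff (cB s))) => //.
Qed.

Let proj_tr q s m : (q + s)%N = j -> gc_proj c m *m (k q s)^T =
  (k q s)^T *m tensor_piece (gc_proj (cA q)) (gc_proj (cB s)) m.
Proof.
move=> qs; apply: (trk (Y := fun q s => tensor_piece (gc_proj (cA q))
  (gc_proj (cB s)) m)) => // q' s'; exact: k_proj.
Qed.

Lemma tens_liftC x : P x ->
  {in [set: aT * bT], forall h, rH x h *m tens_lift x = tens_lift x *m gc_repr c (f h)}.
Proof.
move=> /andP[_ /eqP xj] [a b] _; rewrite -[RHS]mulmxA kC // mulmxA [RHS]mulmxA.
by rewrite !tensmx_mul !homology_liftC ?inE.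
Qed.

Lemma tens_projC x : P x ->
  {in [set: aT * bT], forall h, gc_repr c (f h) *m tens_proj x = tens_proj x *m rH x h}.
Proof.
move=> /andP[_ /eqP xj] [a b] _; rewrite mulmxA.
rewrite (trk (Y := fun q s => gc_repr (cA q) a *t gc_repr (cB s) b)) //; last first.
  by move=> q s; apply: kC.
by rewrite -[LHS]mulmxA -[RHS]mulmxA !tensmx_mul !homology_projC ?inE.
Qed.

Lemma tens_liftK x : P x -> tens_lift x *m tens_proj x = 1%:M.
Proof.
move=> /andP[_ /eqP xj]; rewrite mulmxA -[tens_lift x *m _]mulmxA kk // mulmx1.
by rewrite tensmx_mul !homology_liftK // tensmx1.
Qed.

Lemma tens_lift_notin x y g : g \notin (f @* [set: aT * bT])%g ->
  tens_lift x *m gc_repr c g *m tens_proj y = 0.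
Proof.
move=> ng; rewrite /tens_lift /tens_proj mulmxA.
rewrite -[_ *m k _ _ *m gc_repr c g]mulmxA -[_ *m (k _ _ *m _) *m _^T]mulmxA.
by rewrite kgk // mulmx0 mul0mx.
Qed.

(** A translation by the image of [f] is absorbed by equivariance. As p + r and q + s are fixed,
    distinct indices differ in q, where the embeddings are orthogonal, or in p, where the homologies
    live in different degrees. *)
Lemma tens_lift0 x y g : P x -> P y -> x != y ->
  tens_lift x *m gc_repr c g *m tens_proj y = 0.
Proof.
move=> Px Py ne; have [/morphimP[h Hh _ ->] | ng] :=
  boolP (g \in (f @* [set: aT * bT])%g); last exact: tens_lift_notin.
rewrite -tens_liftC // -mulmxA; suff -> : tens_lift x *m tens_proj y = 0.
  by rewrite mulmx0.
rewrite mulmxA -[tens_lift x *m _]mulmxA.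
move: x y Px Py ne => [[p r] [q s]] [[p' r'] [q' s']] /= /andP[/eqP pr /eqP qs].
move=> /andP[/eqP pr' /eqP qs'] ne.
have [qq | nq] := eqVneq (q : nat) q'; last by rewrite kk0 // mulmx0 mul0mx.
have {}qq : q = q' by apply: val_inj.
subst q'; have ss : s = s' by apply: val_inj; apply: (@addnI q); rewrite qs qs'.
subst s'; rewrite kk // mulmx1 tensmx_mul.
have [pp | np] := eqVneq (p : nat) p'; last by rewrite homology_lift_proj // tens0mx.
have {}pp : p = p' by apply: val_inj.
subst p'; have rr : r = r' by apply: val_inj; apply: (@addnI p); rewrite pr pr'.
by rewrite rr eqxx in ne.
Qed.

Lemma tens_lift_cycles x : P x -> (tens_lift x <= gc_cycles c i)%MS.
Proof.
move=> /andP[/eqP xi /eqP xj]; rewrite sub_cycles /tens_lift -!mulmxA k_proj // k_diff //.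
rewrite !mulmxA; apply/andP; split; apply/eqP.
  rewrite -(homology_lift_cycle (cA x.2.1) x.1.1).1.
  rewrite -(homology_lift_cycle (cB x.2.2) x.1.2).1 -tensmx_mul.
  rewrite -[_ *m tensor_piece _ _ _]mulmxA.
  by rewrite (mul_tensor_piece _ _ _ (gc_proj_mul _) (gc_proj_mul _)) xi eqxx.
rewrite mulmxDr !tensmx_mul !(homology_lift_cycle _ _).2 tens0mx tensmx0 addr0.
by rewrite mul0mx.
Qed.

Lemma boundaries_tens_proj x : P x -> gc_boundaries c i *m tens_proj x = 0.
Proof.
move=> /andP[/eqP xi /eqP xj].
have /submxP[y ->] : (gc_boundaries c i <= gc_proj c i.+1 *m gc_diff c)%MS.
  by rewrite gc_boundariesE.
rewrite -mulmxA; suff -> : gc_proj c i.+1 *m gc_diff c *m tens_proj x = 0.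
  by rewrite mulmx0.
rewrite mulmxA -[gc_proj c _ *m _ *m _]mulmxA diff_tr // mulmxA proj_tr //.
rewrite -!mulmxA; set X := tensor_piece _ _ _ *m _; suff -> : X = 0 by rewrite mulmx0.
rewrite /X mulmx_suml big1 // => z _; rewrite mulmxDl mulmxDr !tensmx_mul.
rewrite ![_ *m (gc_diff _ *m _)]mulmxA.
by rewrite !boundary_homology_proj // tens0mx tensmx0 addr0.
Qed.

(** The difference splits over (q, s), and the transpose of [k q s] sends y to a cycle of the tensor
    product. The Kunneth homotopy bounds what this cycle differs from its projection by, and [k q s]
    carries the bounding chain back. *)
Lemma cycles_tens_proj m (y : 'M_(m, _)) : (y <= gc_cycles c i)%MS ->
  (y *m (support - \sum_(x : index | P x) tens_proj x *m tens_lift x)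
     <= gc_boundaries c i)%MS.
Proof.
rewrite sub_cycles => /andP[/eqP ye /eqP yD].
have -> : \sum_(x : index | P x) tens_proj x *m tens_lift x =
    \sum_(x : 'I_j.+1 * 'I_j.+1 | (x.1 + x.2 == j)%N) ((k x.1 x.2)^T *m tensor_piece
      (fun p => homology_proj (cA x.1) p *m homology_lift (cA x.1) p)
      (fun r => homology_proj (cB x.2) r *m homology_lift (cB x.2) r) i *m k x.1 x.2).
  rewrite -(pair_big_dep (fun u : 'I_i.+1 * 'I_i.+1 => (u.1 + u.2 == i)%N)
    (fun u (v : 'I_j.+1 * 'I_j.+1) => (v.1 + v.2 == j)%N)
    (fun u v => tens_proj (u, v) *m tens_lift (u, v))) /= exchange_big /=.
  apply: eq_bigr => v _; rewrite mulmx_sumr mulmx_suml; apply: eq_bigr => u _.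
  by rewrite -tensmx_mul /tens_proj /tens_lift /= !mulmxA.
rewrite -sumrB mulmx_sumr; apply: summx_sub => -[q s] /= /eqP qs.
set Y := y *m (k q s)^T.
pose N := maxn (gc_bound (cA q)) (gc_bound (cB s)).
have RA := homology_retract (char_card aT) (leq_maxl _ _ : (gc_bound (cA q) <= N)%N).
have RB := homology_retract (char_card bT) (leq_maxr _ _ : (gc_bound (cB s) <= N)%N).
have YE : Y *m tensor_piece (gc_proj (cA q)) (gc_proj (cB s)) i = Y.
  by rewrite -mulmxA -proj_tr // mulmxA ye.
(* On graded chains [wA] and [wB] are the identity, so the two differentials agree there. *)
have diffE m' (w : 'M_(m', _)) l :
    w *m tensor_piece (gc_proj (cA q)) (gc_proj (cB s)) l = w ->
  w *m tensor_diff (gc_diff (cA q)) (gc_sign (cA q)) (gc_diff (cB s)) =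
  w *m (gc_diff (cA q) *t wB s + (gc_sign (cA q) *m wA q) *t gc_diff (cB s)).
  move=> <-; rewrite -!mulmxA; congr (_ *m _); rewrite !mulmx_suml.
  apply: eq_bigr => z _; rewrite !mulmxDr !tensmx_mul mulmx1 projwB.
  by rewrite mulmxA gc_proj_sign -scalemxAl projwA.
have YD : Y *m tensor_diff (gc_diff (cA q)) (gc_sign (cA q)) (gc_diff (cB s)) = 0.
  by rewrite (diffE _ _ i) // -mulmxA -diff_tr // mulmxA yD mul0mx.
have [w wE wD] := kunneth_contraction RA RB (gc_proj_sign (cA q)) (gc_sign_proj (cA q))
  (gc_diff_sign (cA q)) YE YD.
rewrite mulmxBr !mulmxA -mulmxBl -/Y wD (diffE _ _ i.+1) // -mulmxA -k_diff //.
rewrite gc_boundariesE -wE -[w *m _ *m _]mulmxA [tensor_piece _ _ _ *m _]mulmxA.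
by rewrite -k_proj // -[k q s *m _ *m _]mulmxA [w *m _]mulmxA submxMl.
Qed.

(** The tensor retracts are induced up to [gT], and the point is that they exhaust the homology. By
    [sum_support], a cycle is an average of translates of the parts of its translates in [support];
    [cycles_tens_proj] applies to each part, as cycles and boundaries are stable under [gT]. *)
Lemma induced_kunneth : mx_rsim (gc_homology c i)
  (\big[dadd_grepr/grepr0]_(x : index | P x) Representation (ind_repr f (rH x))).
Proof.
pose cH := char_card (aT * bT)%type.
pose RH (x : index) := Representation (ind_repr f (rH x)).
pose I (x : index) : 'M[F]_(rdegree (RH x), gc_dim c) :=
  ind_in f (gc_repr c) (rH x) (tens_lift x).
pose O (x : index) : 'M[F]_(gc_dim c, rdegree (RH x)) :=
  ind_out f (gc_repr c) (rH x) (tens_proj x).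
apply: (@section_rsim_dadd F gT [set: gT]%G _ (gc_repr c) index P RH I O).
- by move=> x Px; apply: ind_inC.
- move=> x Px; apply: ind_inK => //; first exact: tens_projC.
    exact: tens_liftK.
  by move=> g; apply: tens_lift_notin.
- move=> x y Px Py ne; apply: mul_ind_in0 => g; apply: mul_ind_out0 => g'.
  by rewrite -[_ *m gc_repr c g *m _]mulmxA -repr_mxM ?inE // tens_lift0.
- move=> x Px; apply: sub_ind_in; [exact: gc_cycles_module | exact: tens_lift_cycles].
- move=> x Px; apply: ind_out0; [exact: gc_boundaries_module |].
  exact: boundaries_tens_proj.
rewrite (eq_bigr (fun x => #|[set: aT * bT]|%:R^-1 *: \sum_g gc_repr c g^-1%g *m
  (tens_proj x *m tens_lift x) *m gc_repr c g)) => [|x Px]; last first.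
  by apply: ind_out_in => //; apply: tens_projC.
rewrite -scaler_sumr exchange_big /=; set Z := gc_cycles c i.
have ZE : Z = Z *m (#|[set: aT * bT]|%:R^-1 *:
    \sum_g gc_repr c g^-1%g *m support *m gc_repr c g).
  by rewrite sum_support -scalemx1 scalerA mulVf ?scale1r ?mulmx1.
rewrite {1}ZE -mulmxBr -scalerBr -sumrB -scalemxAr scalemx_sub //.
rewrite mulmx_sumr summx_sub // => g _.
rewrite -mulmx_suml -mulmx_sumr -mulmxBl -mulmxBr !mulmxA.
rewrite mxmodule_trans ?inE ?gc_boundaries_module // cycles_tens_proj //.
by rewrite mxmodule_trans ?inE ?gc_cycles_module.
Qed.

End InducedKunneth.

(** * Block matrices and exterior products *)

Section FramedMatrices.

Variable K : comPzRingType.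

(* A frame phi : 'I_n -> X * 'I_m, once bijective, presents K^n as the space of
   families of row vectors of size m indexed by X. *)
Definition framed_mx (X Y : finType) n n' m m' (phi : 'I_n -> X * 'I_m)
    (psi : 'I_n' -> Y * 'I_m') (k : X -> Y -> 'M[K]_(m, m')) : 'M[K]_(n, n') :=
  \matrix_(a, b) k (phi a).1 (psi b).1 (phi a).2 (psi b).2.

Lemma eq_framed_mx (X Y : finType) n n' m m' (phi : 'I_n -> X * 'I_m)
    (psi : 'I_n' -> Y * 'I_m') (k l : X -> Y -> 'M[K]_(m, m')) :
  (forall x y, k x y = l x y) -> framed_mx phi psi k = framed_mx phi psi l.
Proof. by move=> kl; apply/matrixP=> a b; rewrite !mxE kl. Qed.

Lemma framed_mx_mul (X Y Z : finType) n n' n'' m m' m''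
    (phi : 'I_n -> X * 'I_m) (psi : 'I_n' -> Y * 'I_m')
    (chi : 'I_n'' -> Z * 'I_m'') k l : bijective psi ->
  framed_mx phi psi k *m framed_mx psi chi l =
  framed_mx phi chi (fun x z => \sum_y k x y *m l y z).
Proof.
move=> bij_psi; apply/matrixP=> a b; rewrite mxE [RHS]mxE summxE.
pose G q := k (phi a).1 q.1 (phi a).2 q.2 * l q.1 (chi b).1 q.2 (chi b).2.
transitivity (\sum_(q : Y * 'I_m') G q).
  rewrite (reindex psi) /=; last exact: onW_bij.
  by apply: eq_bigr => c _; rewrite !mxE.
rewrite -(pair_bigA _ (fun y c => G (y, c))) /=.
by apply: eq_bigr => y _; rewrite mxE.
Qed.

Lemma framed_mx1 (X : finType) n m (phi : 'I_n -> X * 'I_m) : injective phi ->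
  framed_mx phi phi (fun x y => if x == y then 1%:M else 0) = 1%:M.
Proof.
move=> inj_phi; apply/matrixP=> a b; rewrite !mxE.
rewrite -(inj_eq inj_phi); case: (phi a) (phi b) => [x c] [y d] /=.
by rewrite xpair_eqE; case: eqP; rewrite mxE.
Qed.

Lemma framed_mx_tr (X Y : finType) n n' m m' (phi : 'I_n -> X * 'I_m)
    (psi : 'I_n' -> Y * 'I_m') (k : X -> Y -> 'M[K]_(m, m')) :
  (framed_mx phi psi k)^T = framed_mx psi phi (fun y x => (k x y)^T).
Proof. by apply/matrixP=> a b; rewrite !mxE. Qed.

Lemma framed_mxZ (X Y : finType) n n' m m' (phi : 'I_n -> X * 'I_m)
    (psi : 'I_n' -> Y * 'I_m') a (k : X -> Y -> 'M[K]_(m, m')) :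
  a *: framed_mx phi psi k = framed_mx phi psi (fun x y => a *: k x y).
Proof. by apply/matrixP=> c d; rewrite !mxE. Qed.

Lemma framed_mxD (X Y : finType) n n' m m' (phi : 'I_n -> X * 'I_m)
    (psi : 'I_n' -> Y * 'I_m') (k l : X -> Y -> 'M[K]_(m, m')) :
  framed_mx phi psi k + framed_mx phi psi l =
  framed_mx phi psi (fun x y => k x y + l x y).
Proof. by apply/matrixP=> c d; rewrite !mxE. Qed.

Lemma framed_mx0 (X Y : finType) n n' m m' (phi : 'I_n -> X * 'I_m)
    (psi : 'I_n' -> Y * 'I_m') :
  framed_mx phi psi (fun _ _ => 0 : 'M[K]_(m, m')) = 0.
Proof. by apply/matrixP=> c d; rewrite !mxE. Qed.

Lemma framed_mx_sum (X Y I : finType) (P : pred I) n n' m m'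
    (phi : 'I_n -> X * 'I_m) (psi : 'I_n' -> Y * 'I_m')
    (k : I -> X -> Y -> 'M[K]_(m, m')) :
  \sum_(i | P i) framed_mx phi psi (k i) =
  framed_mx phi psi (fun x y => \sum_(i | P i) k i x y).
Proof.
apply/matrixP=> c d; rewrite summxE mxE summxE.
by apply: eq_bigr => i _; rewrite mxE.
Qed.

Definition tens_pair (X Y : finType) m m' (p : X * 'I_m) (q : Y * 'I_m') :
    (X * Y) * 'I_(m * m') :=
  ((p.1, q.1), mxtens_index (p.2, q.2)).

Definition tens_unpair (X Y : finType) m m' (z : (X * Y) * 'I_(m * m')) :
    (X * 'I_m) * (Y * 'I_m') :=
  ((z.1.1, (mxtens_unindex z.2).1), (z.1.2, (mxtens_unindex z.2).2)).

Lemma tens_pairK (X Y : finType) m m' (p : X * 'I_m) (q : Y * 'I_m') :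
  tens_unpair (tens_pair p q) = (p, q).
Proof. by case: p q => x c [y d]; rewrite /tens_unpair mxtens_indexK. Qed.

Lemma tens_unpairK (X Y : finType) m m' (z : (X * Y) * 'I_(m * m')) :
  tens_pair (tens_unpair z).1 (tens_unpair z).2 = z.
Proof.
case: z => [[x y] c]; congr (_, _).
apply: etrans (mxtens_unindexK c).
by rewrite [in RHS](surjective_pairing (mxtens_unindex c)).
Qed.

Definition tens_frame (X Y : finType) n n' m m' (phi : 'I_n -> X * 'I_m)
    (psi : 'I_n' -> Y * 'I_m') (a : 'I_(n * n')) : (X * Y) * 'I_(m * m') :=
  tens_pair (phi (mxtens_unindex a).1) (psi (mxtens_unindex a).2).

Lemma tens_frame_bij (X Y : finType) n n' m m' (phi : 'I_n -> X * 'I_m)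
    (psi : 'I_n' -> Y * 'I_m') :
  bijective phi -> bijective psi -> bijective (tens_frame phi psi).
Proof.
move=> [phi' phiK phi'K] [psi' psiK psi'K].
exists (fun z => mxtens_index (phi' (tens_unpair z).1, psi' (tens_unpair z).2)).
  move=> a; rewrite /tens_frame tens_pairK phiK psiK.
  by rewrite -surjective_pairing mxtens_unindexK.
by move=> z; rewrite /tens_frame mxtens_indexK phi'K psi'K tens_unpairK.
Qed.

Lemma tens_framed_mx (X Y X' Y' : finType) n n' m m' p p' q q'
    (phi : 'I_n -> X * 'I_m) (psi : 'I_n' -> Y * 'I_m')
    (phi' : 'I_p -> X' * 'I_q) (psi' : 'I_p' -> Y' * 'I_q') k l :
  framed_mx phi psi k *t framed_mx phi' psi' l =
  framed_mx (tens_frame phi phi') (tens_frame psi psi')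
    (fun x y => k x.1 y.1 *t l x.2 y.2).
Proof. by apply/matrixP=> a b; rewrite [RHS]mxE tensmxE !mxE. Qed.

Lemma tens_framed_mxD (X Y : finType) n n' m m' (phi : 'I_n -> X * 'I_m)
    (psi : 'I_n' -> Y * 'I_m') (XA XA' : 'M[K]_n) (XB XB' : 'M[K]_n') k k' l l' :
    XA = framed_mx phi phi k -> XB = framed_mx psi psi l ->
    XA' = framed_mx phi phi k' -> XB' = framed_mx psi psi l' ->
  XA *t XB + XA' *t XB' = framed_mx (tens_frame phi psi) (tens_frame phi psi)
    (fun x y => k x.1 y.1 *t l x.2 y.2 + k' x.1 y.1 *t l' x.2 y.2).
Proof. by move=> -> -> -> ->; rewrite !tens_framed_mx framed_mxD. Qed.

Lemma scale_tens_intertwines m n p (w : 'M[K]_(m * n, p)) (P : 'M[K]_p)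
    (PA : 'M[K]_m) (PB : 'M[K]_n) u v a b c :
    w *m P = (PA *t PB) *m w -> u * a = v * (b * c) ->
  u *: (w *m (a *: P)) = v *: ((b *: PA) *t (c *: PB) *m w).
Proof.
move=> wP ua; rewrite -scalemxAr wP tensmxZl tensmxZr -!scalemxAl !scalerA.
by rewrite ua mulrA.
Qed.

End FramedMatrices.

Lemma tensor_piece_framed (K : fieldType) (X Y : finType) n n' m m'
    (phi : 'I_n -> X * 'I_m) (psi : 'I_n' -> Y * 'I_m')
    (XA : nat -> 'M[K]_n) (XB : nat -> 'M[K]_n') k l i :
    (forall p, XA p = framed_mx phi phi (k p)) ->
    (forall r, XB r = framed_mx psi psi (l r)) ->
  tensor_piece XA XB i = framed_mx (tens_frame phi psi) (tens_frame phi psi)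
    (fun x y => \sum_(z : 'I_i.+1 * 'I_i.+1 | (z.1 + z.2 == i)%N)
       k z.1 x.1 y.1 *t l z.2 x.2 y.2).
Proof.
move=> XAE XBE; rewrite -framed_mx_sum; apply: eq_bigr => z _.
by rewrite XAE XBE tens_framed_mx.
Qed.

(** * Signed embeddings of families of blocks *)

Section MonomialMatrices.

Variables (K : comPzRingType) (X Y : finType) (u : X -> Y).
Variables (n' m' : nat) (psi : 'I_n' -> Y * 'I_m').
Hypothesis inj_u : injective u.
Hypothesis bij_psi : bijective psi.

Definition monomial_mx n m (phi : 'I_n -> X * 'I_m) (eps : X -> K)
    (w : 'M[K]_(m, m')) : 'M[K]_(n, n') :=
  framed_mx phi psi (fun x y => if y == u x then eps x *: w else 0).

(** The vanishing condition says that [k] does not lead out of the blocks in the image of [u]; what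
    remains is one identity per pair of blocks. *)
Lemma monomial_mx_intertwines n m (phi : 'I_n -> X * 'I_m) eps w k l :
    bijective phi ->
    (forall x y, y \notin codom u -> k (u x) y = 0) ->
    (forall x x', eps x *: (w *m k (u x) (u x')) = eps x' *: (l x x' *m w)) ->
  monomial_mx phi eps w *m framed_mx psi psi k =
  framed_mx phi phi l *m monomial_mx phi eps w.
Proof.
move=> bij_phi k0 kl; rewrite !framed_mx_mul //; apply: eq_framed_mx => x y.
rewrite (bigD1 (u x)) //= eqxx big1 ?addr0 => [|z /negPf->]; last by rewrite mul0mx.
have [/codomP[x' ->] | uy] := boolP (y \in codom u); last first.
  rewrite k0 // mulmx0 big1 // => x' _; case: eqP => [yE|_]; last by rewrite mulmx0.
  by rewrite yE codom_f in uy.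
rewrite (bigD1 x') //= eqxx -scalemxAl -scalemxAr kl big1 ?addr0 // => z.
by rewrite (inj_eq inj_u) eq_sym => /negPf->; rewrite mulmx0.
Qed.

Lemma monomial_mx_trmx n m p q (phi : 'I_n -> X * 'I_m) (chi : 'I_p -> X * 'I_q)
    (eps : X -> K) w w' k : (forall x, eps x * eps x = 1) ->
  monomial_mx phi eps w *m framed_mx psi psi k *m (monomial_mx chi eps w')^T =
  framed_mx phi chi (fun x y => (eps x * eps y) *: (w *m k (u x) (u y) *m w'^T)).
Proof.
move=> eps2; rewrite framed_mx_tr !framed_mx_mul //; apply: eq_framed_mx => x y.
rewrite (bigD1 (u y)) //= eqxx [X in _ + X]big1 ?addr0 => [|z /negPf->]; last first.
  by rewrite trmx0 mulmx0.
rewrite (bigD1 (u x)) //= eqxx big1 ?addr0 => [|z /negPf->]; last by rewrite mul0mx.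
by rewrite [(_ *: w')^T]linearZ /= -!scalemxAl -scalemxAr scalerA.
Qed.

Lemma monomial_mx_trmx1 n m (phi : 'I_n -> X * 'I_m) eps w :
    injective phi -> (forall x, eps x * eps x = 1) -> w *m w^T = 1%:M ->
  monomial_mx phi eps w *m (monomial_mx phi eps w)^T = 1%:M.
Proof.
move=> inj_phi eps2 ww; rewrite -[X in X *m _^T]mulmx1.
rewrite -(framed_mx1 _ (bij_inj bij_psi)) monomial_mx_trmx // -(framed_mx1 _ inj_phi).
apply: eq_framed_mx => x y; rewrite (inj_eq inj_u).
case: eqP => [<- | _]; last by rewrite mulmx0 mul0mx scaler0.
by rewrite eps2 scale1r mulmx1.
Qed.

Lemma monomial_mx_trmx_eq0 n m p q (phi : 'I_n -> X * 'I_m)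
    (chi : 'I_p -> X * 'I_q) eps w w' k : (forall x, eps x * eps x = 1) ->
    (forall x y, w *m k (u x) (u y) *m w'^T = 0) ->
  monomial_mx phi eps w *m framed_mx psi psi k *m (monomial_mx chi eps w')^T = 0.
Proof.
move=> eps2 wkw; rewrite monomial_mx_trmx // -[RHS](framed_mx0 _ phi chi).
by apply: eq_framed_mx => x y; rewrite wkw scaler0.
Qed.

Lemma monomial_mx_trmx0 n m p q (phi : 'I_n -> X * 'I_m)
    (chi : 'I_p -> X * 'I_q) eps w w' : (forall x, eps x * eps x = 1) ->
    w *m w'^T = 0 ->
  monomial_mx phi eps w *m (monomial_mx chi eps w')^T = 0.
Proof.
move=> eps2 ww; rewrite -[X in X *m _^T]mulmx1 -(framed_mx1 _ (bij_inj bij_psi)).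
apply: monomial_mx_trmx_eq0 => // x y.
by case: eqP => _; rewrite ?mulmx1 // mulmx0 mul0mx.
Qed.

Lemma trmx_monomial_mx n m (phi : 'I_n -> X * 'I_m) eps w : bijective phi ->
    (forall x, eps x * eps x = 1) ->
  (monomial_mx phi eps w)^T *m monomial_mx phi eps w =
  framed_mx psi psi
    (fun y z => if (y == z) && (y \in codom u) then w^T *m w else 0).
Proof.
move=> bij_phi eps2; rewrite framed_mx_tr framed_mx_mul //.
apply: eq_framed_mx => y z.
have [/codomP[x ->] | uy] := boolP (y \in codom u); last first.
  rewrite andbF big1 // => x _; case: eqP => [yE|_]; last by rewrite trmx0 mul0mx.
  by rewrite yE codom_f in uy.
rewrite andbT (bigD1 x) //= eqxx big1 ?addr0 => [|x' x'x]; last first.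
  by rewrite (inj_eq inj_u) eq_sym (negPf x'x) trmx0 mul0mx.
rewrite eq_sym; case: eqP => _; last by rewrite mulmx0.
by rewrite [(_ *: w)^T]linearZ /= -scalemxAl -scalemxAr scalerA eps2 scale1r.
Qed.

End MonomialMatrices.

(** * Exterior powers of a direct sum *)

Section WedgeProduct.

Variables (K : comPzRingType) (a b n : nat).
Variables (iA : 'I_a -> 'I_n) (iB : 'I_b -> 'I_n).
Hypothesis iAE : forall x, iA x = x :> nat.
Hypothesis iBE : forall y, iB y = (a + y)%N :> nat.
Hypothesis nE : n = (a + b)%N.

Lemma iA_inj : injective iA.
Proof. by move=> x y /(congr1 val); rewrite /= !iAE => /val_inj. Qed.

Lemma iB_inj : injective iB.
Proof. by move=> x y /(congr1 val); rewrite /= !iBE => /addnI/val_inj. Qed.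

Lemma iAB_neq x y : (iA x == iB y) = false.
Proof.
apply/eqP=> /(congr1 val) /=; rewrite iAE iBE => E.
by have := ltn_ord x; rewrite E ltnNge leq_addr.
Qed.

Lemma iAB_cases v : (exists x, v = iA x) \/ (exists y, v = iB y).
Proof.
have [va | av] := ltnP v a.
  by left; exists (Ordinal va); apply: val_inj; rewrite /= iAE.
have lt : (v - a < b)%N by rewrite ltn_subLR // -nE.
by right; exists (Ordinal lt); apply: val_inj; rewrite /= iBE subnKC.
Qed.

Definition join_set (S : {set 'I_a}) (T : {set 'I_b}) := iA @: S :|: iB @: T.

Lemma mem_join_setA S T x : (iA x \in join_set S T) = (x \in S).
Proof.
rewrite inE (mem_imset _ _ iA_inj) orbC; case: imsetP => // -[y _ /eqP].
by rewrite iAB_neq.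
Qed.

Lemma mem_join_setB S T y : (iB y \in join_set S T) = (y \in T).
Proof.
rewrite inE (mem_imset _ _ iB_inj); case: imsetP => // -[x _ /esym/eqP].
by rewrite iAB_neq.
Qed.

Lemma join_set_inj S T S' T' :
  (join_set S T == join_set S' T') = (S == S') && (T == T').
Proof.
apply/eqP/andP => [E | [/eqP-> /eqP->] //]; split; apply/eqP/setP=> x.
  by rewrite -(mem_join_setA S T) E mem_join_setA.
by rewrite -(mem_join_setB S T) E mem_join_setB.
Qed.

Lemma join_setK (U : {set _}) : join_set (iA @^-1: U) (iB @^-1: U) = U.
Proof.
apply/setP=> v; have [[x ->] | [y ->]] := iAB_cases v.
  by rewrite mem_join_setA inE.
by rewrite mem_join_setB inE.
Qed.

Lemma card_join_set S T : #|join_set S T| = (#|S| + #|T|)%N.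
Proof.
rewrite cardsU (card_imset _ iA_inj) (card_imset _ iB_inj).
rewrite (_ : _ :&: _ = set0) ?cards0 ?subn0 //; apply/setP=> v; rewrite !inE.
by apply/andP=> -[/imsetP[x _ ->] /imsetP[y _ /eqP]]; rewrite iAB_neq.
Qed.

(** Both lists are strictly increasing with the same elements, since every [iA x] precedes every
    [iB y]. Hence the minors of a block diagonal matrix are block diagonal in their given order,
    with no reordering sign. *)
Lemma enum_join_set S T :
  enum (join_set S T) = map iA (enum S) ++ map iB (enum T).
Proof.
have sorted_enum m (X : {set 'I_m}) : sorted ltn (map val (enum X)).
  rewrite (subseq_sorted ltn_trans (s2 := map val (enum 'I_m))) //.
    by apply: map_subseq; rewrite [enum X]/enum_mem -enumT filter_subseq.
  by rewrite val_enum_ord iota_ltn_sorted.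
apply: (inj_map val_inj); apply: (irr_sorted_eq ltn_trans ltnn).
- exact: sorted_enum.
- rewrite map_cat -!map_comp.
  rewrite (eq_map (g := val)) => [|x]; last exact: iAE.
  rewrite (eq_map (f := val \o iB) (g := addn a \o val)) => [|x]; last exact: iBE.
  rewrite map_comp; move: (sorted_enum _ S) (sorted_enum _ T).
  have : all (fun x => x < a)%N (map val (enum S)).
    by apply/allP=> _ /mapP[x _ ->]; apply: ltn_ord.
  move: (map val (enum S)) (map val (enum T)) => s t.
  case: s => [|x s] /= => [_ _ | /andP[xa sa] ps] st.
    by rewrite sorted_map; apply: sub_sorted st => u v; rewrite /= ltn_add2l.
  rewrite cat_path ps /=; case: t st => //= y t pt.
  have -> : (last x s < a + y)%N.
    have : last x s \in x :: s by apply: mem_last.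
    rewrite inE => /predU1P[->|]; first by apply: leq_trans xa (leq_addr _ _).
    by move/(allP sa)=> lt; apply: leq_trans lt (leq_addr _ _).
  by rewrite path_map; apply: sub_path pt => u v; rewrite /= ltn_add2l.
move=> k; apply/mapP/mapP=> -[v vU ->]; exists v => //; move: vU.
  rewrite mem_enum mem_cat; have [[x ->] | [y ->]] := iAB_cases v.
    by rewrite mem_join_setA => Sx; rewrite map_f ?mem_enum.
  by rewrite mem_join_setB => Ty; rewrite [X in _ || X]map_f ?mem_enum ?orbT.
rewrite mem_enum mem_cat => /orP[] /mapP[x]; rewrite mem_enum => xS ->.
  by rewrite mem_join_setA.
by rewrite mem_join_setB.
Qed.

Section Degrees.

Variables (q s : nat).

Lemma jnth_join (S : jsub q a) (T : jsub s b) (U : jsub (q + s) n) :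
  val U = join_set (val S) (val T) ->
  (forall c, jnth U (lshift s c) = iA (jnth S c)) /\
  (forall d, jnth U (rshift q d) = iB (jnth T d)).
Proof.
move=> UE; have sS : size (enum (val S)) = q by rewrite -cardE (eqP (valP S)).
have sT : size (enum (val T)) = s by rewrite -cardE (eqP (valP T)).
split=> c; rewrite /jnth.
  rewrite !(enum_val_nth (iA (jnth S c))) /= UE enum_join_set nth_cat size_map sS.
  by rewrite ltn_ord (nth_map (jnth S c)) ?sS //; congr iA; apply: set_nth_default;
     rewrite sS.
rewrite !(enum_val_nth (iB (jnth T c))) /= UE enum_join_set nth_cat size_map sS.
rewrite ltnNge leq_addr /= addKn (nth_map (jnth T c)) ?sT //; congr iB.
by apply: set_nth_default; rewrite sT.
Qed.

End Degrees.

(* The exterior product e_S (x) e_T |-> e_S /\ e_T.  There is no sign because iA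
   places the first basis before the second. *)
Definition wedge_mx q s j : 'M[K]_(#|{: jsub q a}| * #|{: jsub s b}|, #|{: jsub j n}|) :=
  \matrix_(x, U) (val (enum_val U) == join_set (val (enum_val (mxtens_unindex x).1))
                                        (val (enum_val (mxtens_unindex x).2)))%:R.

Lemma wedge_mxE q s j S T U :
  wedge_mx q s j (mxtens_index (S, T)) U =
  (val (enum_val U) == join_set (val (enum_val S)) (val (enum_val T)))%:R.
Proof. by rewrite mxE mxtens_indexK. Qed.

Lemma card_iA j (U : {set 'I_n}) : #|U| = j ->
  (#|iA @^-1: U| + #|iB @^-1: U|)%N = j.
Proof. by rewrite -card_join_set join_setK. Qed.

Section Minors.

Variables (M : 'M[K]_n) (MA : 'M[K]_a) (MB : 'M[K]_b).
Hypothesis MAA : forall x y, M (iA x) (iA y) = MA x y.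
Hypothesis MBB : forall x y, M (iB x) (iB y) = MB x y.
Hypothesis MAB : forall x y, M (iA x) (iB y) = 0.
Hypothesis MBA : forall x y, M (iB x) (iA y) = 0.

Lemma minor_join q s (S S' : jsub q a) (T T' : jsub s b) (U U' : jsub (q + s) n) :
    val U = join_set (val S) (val T) -> val U' = join_set (val S') (val T') ->
  \det (mxsub (jnth U) (jnth U') M) =
  \det (mxsub (jnth S) (jnth S') MA) * \det (mxsub (jnth T) (jnth T') MB).
Proof.
move=> /jnth_join[UA UB] /jnth_join[UA' UB'].
rewrite -(det_ublock _ 0); congr (\det _); apply/matrixP=> c d.
rewrite mxE -[c]splitK -[d]splitK.
case: (split c) (split d) => x [] y /=.
- by rewrite block_mxEul mxE UA UA' MAA.
- by rewrite block_mxEur mxE UA UB' MAB.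
- by rewrite block_mxEdl mxE UB UA' MBA.
by rewrite block_mxEdr mxE UB UB' MBB.
Qed.

(** The two sets meet the first block in different numbers, so each permutation of the Leibniz
    expansion matches an index of one block with an index of the other, where [M] is zero. *)
Lemma minor_join0 j (U U' : jsub j n) :
    #|iA @^-1: val U| != #|iA @^-1: val U'| ->
  \det (mxsub (jnth U) (jnth U') M) = 0.
Proof.
move=> neU; rewrite /determinant big1 // => g _.
pose isA := [pred v : 'I_n | v \in codom iA].
have M0 v w : isA v != isA w -> M v w = 0.
  have isAA x : isA (iA x) by apply: codom_f.
  have isAB y : isA (iB y) = false.
    by apply/codomP=> -[x /esym/eqP]; rewrite iAB_neq.
  have [[x ->]|[x ->]] := iAB_cases v; have [[y ->]|[y ->]] := iAB_cases w;
    by rewrite ?isAA ?isAB // ?MAB ?MBA.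
have cA (X : jsub j n) : #|[set c | isA (jnth X c)]| = #|iA @^-1: val X|.
  rewrite -(card_imset _ (@jnth_inj _ _ X)) -(card_imset _ iA_inj).
  congr #|pred_of_set _|; apply/setP=> v; apply/imsetP/imsetP => -[x].
    rewrite inE => /codomP[y xE] ->; exists y => //.
    by rewrite inE -xE mem_jnth.
  rewrite inE => /jnthP[c cE] ->; exists c => //.
  by rewrite inE cE; apply: codom_f.
have [c neq_c | eqA] := pickP (fun c => isA (jnth U c) != isA (jnth U' (g c))).
  by rewrite (bigD1 c) //= mxE M0 // mul0r mulr0.
case/eqP: neU; rewrite -!cA -[RHS](card_preimset _ (@perm_inj _ g)).
by congr #|pred_of_set _|; apply/setP=> c; rewrite !inE; apply/eqP/negbFE/eqA.
Qed.

(** An entry on the left is a single minor of [M]. On the right only the traces of the column set U'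
    on the two blocks can contribute, and they do when their sizes are q and s; otherwise the minor
    is zero too. *)
Lemma ext_mx_wedge q s j : (q + s)%N = j ->
  wedge_mx q s j *m ext_mx j M = (ext_mx q MA *t ext_mx s MB) *m wedge_mx q s j.
Proof.
case: j / => /=; apply/matrixP=> x U'; case: (mxtens_indexP x) => S T.
have UP : #|join_set (val (enum_val S)) (val (enum_val T))| == (q + s)%N.
  by rewrite card_join_set (eqP (valP (enum_val S))) (eqP (valP (enum_val T))).
pose U : jsub (q + s) n := exist _ (join_set (val (enum_val S)) (val (enum_val T))) UP.
transitivity (\det (mxsub (jnth U) (jnth (enum_val U')) M)).
  rewrite mxE (bigD1 (enum_rank U)) //= wedge_mxE enum_rankK eqxx mul1r.
  rewrite big1 ?addr0 => [|V neV]; first by rewrite mxE enum_rankK.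
  rewrite wedge_mxE; case: eqP => [E | _]; last by rewrite mul0r.
  by case/eqP: neV; rewrite -[V]enum_valK; congr enum_rank; apply: val_inj.
rewrite mxE.
have [cA | ncA] := eqVneq #|iA @^-1: val (enum_val U')| q; last first.
  rewrite minor_join0; last first.
    rewrite eq_sym; apply: contra ncA => /eqP->; apply/eqP.
    rewrite -[RHS](eqP (valP (enum_val S))); congr #|pred_of_set _|; apply/setP=> v.
    by rewrite inE mem_join_setA.
  rewrite big1 // => y _; case: (mxtens_indexP y) => S' T'; rewrite wedge_mxE.
  case: eqP => [E | _]; last by rewrite mulr0.
  case/eqP: ncA; rewrite E -[RHS](eqP (valP (enum_val S'))).
  by congr #|pred_of_set _|; apply/setP=> v; rewrite inE mem_join_setA.
have cB : #|iB @^-1: val (enum_val U')| == s.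
  have := card_iA (eqP (valP (enum_val U'))).
  by rewrite cA => /addnI->.
pose S' : jsub q a := exist _ (iA @^-1: val (enum_val U')) (introT eqP cA).
pose T' : jsub s b := exist _ (iB @^-1: val (enum_val U')) cB.
rewrite (bigD1 (mxtens_index (enum_rank S', enum_rank T'))) //= wedge_mxE.
rewrite !enum_rankK join_setK eqxx mulr1 tensmxE !mxE !enum_rankK.
rewrite big1 ?addr0; last first.
  move=> y; case: (mxtens_indexP y) => S1 T1; rewrite wedge_mxE.
  rewrite (can_eq (@mxtens_indexK _ _)) => ne; case: eqP => [E | _]; last first.
    by rewrite mulr0.
  case/eqP: ne; congr (_, _); rewrite -[LHS]enum_valK; congr enum_rank; apply: val_inj.
    by apply/setP=> v; rewrite /= inE E mem_join_setA.
  by apply/setP=> v; rewrite /= inE E mem_join_setB.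
by apply: minor_join => //=; rewrite join_setK.
Qed.

End Minors.

Lemma wedge_mx_tr q s j : (q + s)%N = j ->
  wedge_mx q s j *m (wedge_mx q s j)^T = 1%:M.
Proof.
move=> qsj; apply/matrixP=> x y.
case: (mxtens_indexP x) => S T; case: (mxtens_indexP y) => S' T'.
have UP : #|join_set (val (enum_val S)) (val (enum_val T))| == j.
  by rewrite card_join_set (eqP (valP (enum_val S))) (eqP (valP (enum_val T))) qsj.
pose U : jsub j n := exist _ (join_set (val (enum_val S)) (val (enum_val T))) UP.
rewrite mxE (bigD1 (enum_rank U)) //= wedge_mxE [_^T _ _]mxE wedge_mxE.
rewrite enum_rankK eqxx mul1r.
rewrite big1 ?addr0 => [|V neV]; last first.
  rewrite wedge_mxE; case: eqP => [E | _]; last by rewrite mul0r.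
  by case/eqP: neV; rewrite -[V]enum_valK; congr enum_rank; apply: val_inj.
rewrite mxE (can_eq (@mxtens_indexK _ _)) xpair_eqE join_set_inj !val_eqE.
by rewrite !(inj_eq enum_val_inj).
Qed.

Lemma wedge_mx_tr0 q s q' s' j : q != q' ->
  wedge_mx q s j *m (wedge_mx q' s' j)^T = 0.
Proof.
move=> neq; apply/matrixP=> x y.
case: (mxtens_indexP x) => S T; case: (mxtens_indexP y) => S' T'.
rewrite mxE [RHS]mxE big1 // => U _; rewrite [_^T _ _]mxE !wedge_mxE.
case: eqP => [-> | _]; rewrite ?mul0r ?mulr0 //.
rewrite join_set_inj; case: eqP => [E | _]; last by rewrite mulr0.
case/eqP: neq; rewrite -(eqP (valP (enum_val S))) E.
exact: (eqP (valP (enum_val S'))).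
Qed.

(** A basis set arises from exactly one pair, its traces on the two blocks, and their sizes give the
    only bidegree that contributes. *)
Lemma sum_wedge_mx j :
  \sum_(x : 'I_j.+1 * 'I_j.+1 | (x.1 + x.2 == j)%N)
    (wedge_mx x.1 x.2 j)^T *m wedge_mx x.1 x.2 j = 1%:M.
Proof.
apply/matrixP=> U U'; rewrite summxE.
set SU := iA @^-1: val (enum_val U); set TU := iB @^-1: val (enum_val U).
have cU : (#|SU| + #|TU|)%N = j := card_iA (eqP (valP (enum_val U))).
have ltS : (#|SU| < j.+1)%N by rewrite ltnS -cU leq_addr.
have ltT : (#|TU| < j.+1)%N by rewrite ltnS -cU leq_addl.
pose x0 := (Ordinal ltS, Ordinal ltT).
have UE : val (enum_val U) = join_set SU TU by rewrite join_setK.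
rewrite (bigD1 x0) /= ?cU // [X in _ + X]big1 ?addr0.
  pose S : jsub #|SU| a := exist _ SU (eqxx _).
  pose T : jsub #|TU| b := exist _ TU (eqxx _).
  rewrite mxE (bigD1 (mxtens_index (enum_rank S, enum_rank T))) //=.
  rewrite [_^T _ _]mxE !wedge_mxE !enum_rankK UE eqxx mul1r big1 ?addr0 => [|y].
    by rewrite mxE -UE val_eqE (inj_eq enum_val_inj) eq_sym.
  case: (mxtens_indexP y) => S1 T1 ne; rewrite [_^T _ _]mxE !wedge_mxE UE join_set_inj.
  case: eqP => [E1 | _]; last by rewrite mul0r.
  case: eqP => [E2 | _]; last by rewrite mul0r.
  case/eqP: ne; congr (mxtens_index (_, _)); rewrite -[LHS]enum_valK; congr enum_rank;
    exact: val_inj.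
move=> [q s] /andP[/eqP qs neq]; rewrite mxE big1 // => y _.
case: (mxtens_indexP y) => S1 T1; rewrite [_^T _ _]mxE !wedge_mxE UE join_set_inj.
case: eqP => [E1 | _]; last by rewrite mul0r.
case: eqP => [E2 | _]; last by rewrite mul0r.
case/eqP: neq; congr (_, _); apply: val_inj; rewrite /= ?E1 ?E2.
  by rewrite (eqP (valP (enum_val S1))).
by rewrite (eqP (valP (enum_val T1))).
Qed.

End WedgeProduct.

(** * Chromatic complexes *)

Lemma blk_mx0 (K : comPzRingType) (I : finType) m n :
  blk_mx (fun _ _ : I => 0 : 'M[K]_(m, n)) = 0.
Proof. by apply/matrixP=> a b; rewrite !mxE. Qed.

Lemma blk_mxZ (K : comPzRingType) (I : finType) m n a
    (k : I -> I -> 'M[K]_(m, n)) :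
  blk_mx (fun x y => a *: k x y) = a *: blk_mx k.
Proof. by apply/matrixP=> c d; rewrite !mxE. Qed.

Lemma diag_blk_mxM (K : comPzRingType) (I : finType) m n p
    (k : I -> 'M[K]_(m, n)) (l : I -> 'M[K]_(n, p)) :
  diag_blk_mx k *m diag_blk_mx l = diag_blk_mx (fun x => k x *m l x).
Proof.
rewrite mul_diag_blk_mx; apply: eq_blk_mx => x y.
by case: eqP => _; rewrite ?mulmx0.
Qed.

Lemma eq_diag_blk_mx (K : comPzRingType) (I : finType) m n
    (k l : I -> 'M[K]_(m, n)) : k =1 l -> diag_blk_mx k = diag_blk_mx l.
Proof. by move=> kl; apply: eq_blk_mx => x y; rewrite kl. Qed.

Lemma diag_blk_mx0 (K : comPzRingType) (I : finType) m n :
  diag_blk_mx (fun _ : I => 0 : 'M[K]_(m, n)) = 0.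
Proof. by rewrite -[RHS]blk_mx0; apply: eq_blk_mx => x y; rewrite if_same. Qed.

Lemma diag_blk_mxZ (K : comPzRingType) (I : finType) m n a
    (k : I -> 'M[K]_(m, n)) :
  diag_blk_mx (fun x => a *: k x) = a *: diag_blk_mx k.
Proof.
by rewrite -blk_mxZ; apply: eq_blk_mx => x y; case: eqP; rewrite ?scaler0.
Qed.

Lemma diag_blk_sub (K : fieldType) (I : finType) m n (k l : I -> 'M[K]_(m, n)) :
  (forall x, (k x <= l x)%MS) -> (diag_blk_mx k <= diag_blk_mx l)%MS.
Proof.
move=> kl; apply/submxP; exists (diag_blk_mx (fun x => k x *m pinvmx (l x))).
by rewrite diag_blk_mxM; apply: eq_diag_blk_mx => x; rewrite mulmxKpV.
Qed.

Lemma diag_blk_sign (K : comPzRingType) (I : finType) n (s : I -> K)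
    (k : I -> I -> 'M[K]_n) :
    (forall x y, s y *: k x y = - (s x *: k x y)) ->
  blk_mx k *m diag_blk_mx (fun x => (s x)%:M) =
  - (diag_blk_mx (fun x => (s x)%:M) *m blk_mx k).
Proof.
move=> sk; rewrite mul_blk_diag_mx mul_diag_blk_mx -scaleN1r -blk_mxZ.
by apply: eq_blk_mx => x y; rewrite mul_mx_scalar mul_scalar_mx scaleN1r sk.
Qed.

Lemma mulmx_idem_sub (K : fieldType) m n (e : 'M[K]_n) (x : 'M_(m, n)) :
  e *m e = e -> (x <= e)%MS -> x *m e = x.
Proof. by move=> ee /submxP[y ->]; rewrite -mulmxA ee. Qed.

(** * Chain modules as images of idempotents *)

Section GraphComplex.

Variables (C : numClosedFieldType) (G : graph).

Local Notation V := (vertex G).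
Local Notation E := (edge G).
Local Notation n := #|V|.
Local Notation SV := {perm V}.
Local Notation N j := #|{: SV * 'I_#|{: jsub j n}|}|.
Local Notation amb j := #|{: {set E} * 'I_(N j)}|.

(** Flattens the two nested enumerations of the ambient space, so that its operators become matrices
    indexed by pairs (F, g) with values in the endomorphisms of the exterior power. *)
Definition amb_frame j (a : 'I_(amb j)) : ({set E} * SV) * 'I_#|{: jsub j n}| :=
  (((enum_val a).1, (enum_val (enum_val a).2).1), (enum_val (enum_val a).2).2).

Lemma amb_frame_bij j : bijective (@amb_frame j).
Proof.
exists (fun z => enum_rank (z.1.1, enum_rank (z.1.2, z.2))).
  move=> a; rewrite -[RHS]enum_valK; congr enum_rank.
  by rewrite /= -surjective_pairing enum_valK -surjective_pairing.
by move=> [[F g] S]; rewrite /amb_frame !enum_rankK.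
Qed.

Definition amb_blk_mx j
    (k : {set E} * SV -> {set E} * SV -> 'M[C]_#|{: jsub j n}|) : 'M[C]_(amb j) :=
  framed_mx (@amb_frame j) (@amb_frame j) k.

Lemma amb_blk_mxE j k : amb_blk_mx (j := j) k =
  blk_mx (fun F F' : {set E} => blk_mx (fun g g' : SV => k (F, g) (F', g'))).
Proof. by apply/matrixP=> a b; rewrite !mxE. Qed.

Lemma amb_mxE j g : amb_mx C (G := G) j g =
  amb_blk_mx (fun z z' => if (z.1 == z'.1) && (z.2 * g == z'.2)%g then 1%:M else 0).
Proof.
rewrite amb_blk_mxE; apply: eq_blk_mx => F F'.
by case: eqP => _ //=; rewrite -[LHS]blk_mx0.
Qed.

(** An idempotent with the row space of [state_mod]: the matrix generating the induced module, with
    [comp_space] replaced by the orthogonal projection onto its row space, divided by |S_F|. *)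
Definition state_proj j (F : {set E}) : 'M[C]_(N j) :=
  blk_mx (fun g g' : SV => if (g' * g^-1)%g \in comp_group F then
    #|comp_group F|%:R^-1 *:
      ext_mx j (proj_ortho (comp_space C F) *m vertex_mx C (g * g'^-1)%g) else 0).

Definition chain_proj i j : 'M[C]_(amb j) :=
  diag_blk_mx (fun F : {set E} => if #|F| == i then state_proj j F else 0).

(** The exterior part is a parameter [f], so that comparing the union with its two parts involves
    only states and permutations. *)
Definition chain_blk m (f : {set E} -> SV -> 'M[C]_m) i (z z' : {set E} * SV) :
    'M[C]_m :=
  if [&& z.1 == z'.1, #|z.1| == i & (z'.2 * z.2^-1)%g \in comp_group z.1] then
    #|comp_group z.1|%:R^-1 *: f z.1 (z.2 * z'.2^-1)%g
  else 0.

Definition comp_ext j (F : {set E}) (g : SV) : 'M[C]_#|{: jsub j n}| :=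
  ext_mx j (proj_ortho (comp_space C F) *m vertex_mx C g).

Lemma chain_projE i j : chain_proj i j = amb_blk_mx (chain_blk (comp_ext j) i).
Proof.
rewrite amb_blk_mxE; apply: eq_blk_mx => F F' /=; rewrite /chain_blk /=.
case: eqP => _; last by rewrite -[LHS]blk_mx0.
by case: eqP => _ //; rewrite -[LHS]blk_mx0.
Qed.

(** S_F is included by the identity, so h = g' g^-1 is the only possible term of the sum. *)
Lemma ind_mx_state j F m (U : 'M_(m, _)) :
  ind_mx (idm_morphism (comp_group F)) (state_repr C j F) U =
  blk_mx (fun g g' : SV => if (g' * g^-1)%g \in comp_group F then
    U *m ext_mx j (vertex_mx C (g * g'^-1)%g) else 0).
Proof.
apply: eq_blk_mx => g g'; rewrite big_mkcond /= (bigD1 (g' * g^-1)%g) //=.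
rewrite mulgKV eqxx andbT big1 ?addr0 ?invMg ?invgK // => h ne.
case: ifP => // /andP[_ /eqP hE]; case/eqP: ne.
by rewrite -hE mulgK.
Qed.

Lemma comp_group_neq0 (F : {set E}) : #|comp_group F|%:R != 0 :> C.
Proof. by rewrite pnatr_eq0 -lt0n cardG_gt0. Qed.

Lemma state_proj_eqmx j F : (state_mod C j F :=: state_proj j F)%MS.
Proof.
set Q := proj_ortho (comp_space C F).
have WQ : comp_space C F *m Q = comp_space C F by rewrite proj_ortho_id.
have /submxP[X XE] : (Q <= comp_space C F)%MS by rewrite proj_orthoE.
apply/eqmxP/andP; split; apply/submxP.
  exists (diag_blk_mx (fun _ => #|comp_group F|%:R *: ext_mx j (comp_space C F))).
  rewrite /state_mod ind_mx_state mul_diag_blk_mx; apply: eq_blk_mx => g g'.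
  case: ifP => _; last by rewrite mulmx0.
  rewrite -scalemxAl -scalemxAr scalerA divff ?comp_group_neq0 // scale1r.
  by rewrite -!ext_mx_mul mulmxA WQ.
exists (diag_blk_mx (fun _ => #|comp_group F|%:R^-1 *: ext_mx j X)).
rewrite /state_mod ind_mx_state mul_diag_blk_mx; apply: eq_blk_mx => g g'.
case: ifP => _; last by rewrite mulmx0.
by rewrite -scalemxAl -!ext_mx_mul mulmxA -XE.
Qed.

Lemma chain_proj_eqmx i j : (chains C G i j :=: chain_proj i j)%MS.
Proof.
apply/eqmxP/andP; split; apply: diag_blk_sub => F; case: ifP => // _;
  by rewrite state_proj_eqmx.
Qed.

(** The product runs over the coset of g modulo S_F. The orthogonal projection commutes with S_F, so
    its |S_F| terms are equal and cancel one of the two normalising factors. *)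
Lemma state_proj_idem j F : state_proj j F *m state_proj j F = state_proj j F.
Proof.
rewrite blk_mx_mul; apply: eq_blk_mx => g g'.
set S := comp_group F; set Q := proj_ortho (comp_space C F).
have QQ : Q *m Q = Q by rewrite proj_ortho_proj.
rewrite (eq_bigr (fun g1 => if (g1 * g^-1)%g \in S then
   if (g' * g^-1)%g \in S then
     (#|S|%:R^-1 * #|S|%:R^-1) *: ext_mx j (Q *m vertex_mx C (g * g'^-1)%g) else 0
   else 0)).
  case: ifP => _; last by rewrite big1 // => g1 _; case: ifP.
  rewrite -big_mkcond /= (reindex_inj (mulIg g)) /=.
  rewrite (eq_bigl (fun h => h \in S)) => [|h]; last by rewrite mulgK.
  rewrite sumr_const -scaler_nat scalerA mulrA divff ?comp_group_neq0 //.
  by rewrite mul1r.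
move=> g1 _; case: ifP => [Sg1 | _]; last by rewrite mul0mx.
have -> : (g' * g1^-1)%g \in S = ((g' * g^-1)%g \in S).
  by rewrite -[g' in RHS](mulgKV g1) -[in RHS]mulgA [RHS]groupMr.
case: ifP => _; last by rewrite mulmx0.
rewrite -scalemxAl -scalemxAr scalerA -ext_mx_mul; congr (_ *: ext_mx j _).
rewrite mulmxA -[_ *m Q]mulmxA proj_comp_spaceC; last first.
  by rewrite -groupV invMg invgK.
by rewrite mulmxA QQ -mulmxA -vertex_mxM mulgA mulgKV.
Qed.

Lemma chain_proj_mul i k j : chain_proj i j *m chain_proj k j =
  if i == k then chain_proj i j else 0.
Proof.
rewrite diag_blk_mxM; have [<- | ne] := eqVneq i k.
  by apply: eq_diag_blk_mx => F; case: ifP; rewrite ?mulmx0 // state_proj_idem.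
rewrite -[RHS]diag_blk_mx0; apply: eq_diag_blk_mx => F.
have [-> | _] := eqVneq #|F| i; last by rewrite mul0mx.
by rewrite (negPf ne) mulmx0.
Qed.

Lemma chain_proj_ge i j : (#|E| < i)%N -> chain_proj i j = 0.
Proof.
move=> ltEi; rewrite -[RHS]diag_blk_mx0; apply: eq_diag_blk_mx => F.
case: eqP => // cF.
by have := max_card (mem F); rewrite cF leqNgt ltEi.
Qed.

Lemma chain_projC i j : intertwines (amb_repr C G j) (amb_repr C G j) (chain_proj i j).
Proof.
move=> h _; rewrite /= /amb_mx !diag_blk_mxM; apply: eq_diag_blk_mx => F.
case: ifP => _; last by rewrite mul0mx mulmx0.
rewrite mul_trans_mx mul_mx_trans; apply: eq_blk_mx => g g'.
by rewrite !invMg !invgK !mulgA.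
Qed.

Variable o : enumeration G.

Definition diff_blk m (f : {set E} -> 'M[C]_m) (z z' : {set E} * SV) : 'M[C]_m :=
  if z.2 == z'.2 then
    \sum_(e in z.1 | z'.1 == z.1 :\ e) edge_sign C o z.1 e *: f z'.1
  else 0.

Lemma diff_ambE j : diff C o j =
  amb_blk_mx (diff_blk (fun F => ext_mx j (proj_ortho (comp_space C F)))).
Proof.
rewrite amb_blk_mxE; apply: eq_blk_mx => F F'; rewrite /diff_blk /=.
apply/matrixP=> a b; rewrite summxE mxE.
case: eqP => [ab|nab]; last first.
  by rewrite mxE big1 // => e _; rewrite !mxE; case: eqP => // _; rewrite mxE mulr0.
rewrite summxE; apply: eq_bigr => e _.
by rewrite mxE [RHS]mxE; congr (_ * _); rewrite mxE ab eqxx.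
Qed.

Lemma chain0_diff j : chain_proj 0 j *m diff C o j = 0.
Proof.
rewrite mul_diag_blk_mx -[RHS]blk_mx0; apply: eq_blk_mx => F F'.
case: eqP => [/eqP|_]; last by rewrite mul0mx.
rewrite cards_eq0 => /eqP->; rewrite big_pred0 ?mulmx0 // => e.
by rewrite inE.
Qed.

Lemma chain_proj_sub i j m (x : 'M_(m, _)) :
  (x <= chain_proj i j)%MS -> x *m chain_proj i j = x.
Proof. by apply: mulmx_idem_sub; rewrite chain_proj_mul eqxx. Qed.

Lemma boundaries_eqmx i j :
  (boundaries C o i j :=: chain_proj i.+1 j *m diff C o j)%MS.
Proof. exact: eqmxMr (chain_proj_eqmx _ _). Qed.

Lemma cycles_eqmx i j :
  (cycles C o i j :=: chain_proj i j :&: kermx (diff C o j))%MS.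
Proof. exact: cap_eqmx (chain_proj_eqmx _ _) (eqmx_refl _). Qed.

Lemma chain_proj_diff i j :
  chain_proj i.+1 j *m diff C o j *m chain_proj i j = chain_proj i.+1 j *m diff C o j.
Proof.
apply: chain_proj_sub; rewrite -boundaries_eqmx -chain_proj_eqmx.
by apply: submx_trans (boundaries_sub_cycles C o i j) _; apply: capmxSl.
Qed.

Definition grade_sign j : 'M[C]_(amb j) :=
  diag_blk_mx (fun F : {set E} => ((-1) ^+ #|F|)%:M).

Lemma grade_signE j : grade_sign j = amb_blk_mx (fun z z' =>
  if z == z' then ((-1) ^+ #|z.1|)%:M else 0).
Proof.
rewrite amb_blk_mxE; apply: eq_blk_mx => F F'.
apply/matrixP=> a b; rewrite [RHS]mxE xpair_eqE.
case: eqP => _ /=; last by rewrite !mxE.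
rewrite mxE -(inj_eq enum_val_inj); case: (enum_val a) (enum_val b) => [g c] [g' d] /=.
by rewrite xpair_eqE; case: eqP => _; rewrite mxE.
Qed.

Lemma chain_proj_sign i j :
  chain_proj i j *m grade_sign j = (-1) ^+ i *: chain_proj i j.
Proof.
rewrite diag_blk_mxM -diag_blk_mxZ; apply: eq_diag_blk_mx => F.
by case: eqP => [-> | _]; rewrite ?mul0mx ?scaler0 // mul_mx_scalar.
Qed.

Lemma sign_chain_proj i j :
  grade_sign j *m chain_proj i j = (-1) ^+ i *: chain_proj i j.
Proof.
rewrite diag_blk_mxM -diag_blk_mxZ; apply: eq_diag_blk_mx => F.
by case: eqP => [-> | _]; rewrite ?mulmx0 ?scaler0 // mul_scalar_mx.
Qed.

Lemma diff_sign j : diff C o j *m grade_sign j = - (grade_sign j *m diff C o j).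
Proof.
apply: diag_blk_sign => F F'; rewrite !scaler_sumr -sumrN.
apply: eq_bigr => e /andP[Fe /eqP->].
by rewrite [in RHS](cardsD1 e F) Fe exprS mulN1r scaleNr opprK.
Qed.

End GraphComplex.

(** * Disjoint unions *)

Section SumEnumeration.

Variables S T : finType.

Lemma enum_sum : enum {: S + T} = map inl (enum S) ++ map inr (enum T).
Proof. by rewrite !enumT [in LHS]unlock. Qed.

Lemma enum_rank_inl (x : S) : enum_rank (inl x : S + T) = enum_rank x :> nat.
Proof.
have E : nth (inl x) (enum {: S + T}) (enum_rank x) = inl x.
  rewrite enum_sum nth_cat size_map -cardE ltn_ord (nth_map x) -?cardE ?ltn_ord //.
  by rewrite nth_enum_rank.
apply/eqP; rewrite -(nth_uniq (inl x) _ _ (enum_uniq {: S + T})) -?cardE ?ltn_ord //.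
  by rewrite E nth_enum_rank.
by rewrite card_sum ltn_addr.
Qed.

Lemma enum_rank_inr (y : T) :
  enum_rank (inr y : S + T) = (#|S| + enum_rank y)%N :> nat.
Proof.
have E : nth (inr y) (enum {: S + T}) (#|S| + enum_rank y) = inr y.
  rewrite enum_sum nth_cat size_map -cardE ltnNge leq_addr /= addKn.
  by rewrite (nth_map y) -?cardE ?ltn_ord // nth_enum_rank.
apply/eqP; rewrite -(nth_uniq (inr y) _ _ (enum_uniq {: S + T})) -?cardE ?ltn_ord //.
  by rewrite E nth_enum_rank.
by rewrite card_sum ltn_add2l.
Qed.

End SumEnumeration.

(** * Block form of the orthogonal projections *)

Section CompProjection.

Variables (C : numClosedFieldType) (G : graph).
Local Notation V := (vertex G).

Definition comp_card (F : {set edge G}) (u : V) := #|[set w | same_comp F u w]|.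

(* The orthogonal projection onto W_F subtracts from x its mean on each
   connected component. *)
Lemma proj_comp_spaceE (F : {set edge G}) : proj_ortho (comp_space C F) =
  fun_mx (fun u v : V => (u == v)%:R - (same_comp F u v)%:R / (comp_card F u)%:R).
Proof.
set Q := fun_mx _; set W := comp_space C F; set P := proj_ortho W.
have cC := same_compC F.
have same u v w : same_comp F u v -> same_comp F u w = same_comp F v w.
  by move=> uv; apply: (same_connect cC).
have cardE u v : same_comp F u v -> comp_card F u = comp_card F v.
  by move=> uv; apply: eq_card => w; rewrite !inE (same u v).
have card0 u : (comp_card F u)%:R != 0 :> C.
  by rewrite pnatr_eq0 -lt0n; apply/card_gt0P; exists u; rewrite inE /same_comp connect0.
have QW : (Q <= W)%MS.
  apply/comp_spaceP => r v; rewrite (eq_bigr (fun u => (enum_val r == u)%:R -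
      (same_comp F (enum_val r) u)%:R / (comp_card F (enum_val r))%:R)); last first.
    by move=> u _; rewrite mxE enum_rankK.
  set w := enum_val r; rewrite sumrB.
  have [wv | nwv] := boolP (same_comp F w v); last first.
    rewrite !big1 ?subrr // => u uv.
      rewrite [same_comp F w u](_ : _ = false) ?mul0r //.
      by apply/negbTE; apply: contra nwv => wu; rewrite (same w u).
    by case: eqP => // wu; rewrite wu uv in nwv.
  rewrite (bigD1 w) //= eqxx big1 ?addr0; last first.
    by move=> u /andP[_ /negPf]; rewrite eq_sym => ->.
  rewrite (eq_bigr (fun _ => (comp_card F w)%:R^-1)) => [|u uv]; last first.
    by rewrite (same w v) // cC uv mul1r.
  rewrite sumr_const -[X in _ - X]mulr_natl [X in X%:R * _](_ : _ = comp_card F w).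
    by rewrite divff ?subrr.
  by rewrite (cardE w v) // /comp_card; apply: eq_card => u; rewrite !inE cC.
(* The rows of 1 - Q are constant on the components, hence orthogonal to W; as the rows of Q lie in
   W, this identifies Q with the projection. *)
have QP : (1%:M - Q) *m P = 0.
  apply: proj_ortho_0; rewrite orthomx1E; apply/eqP/matrixP=> r c.
  rewrite [RHS]mxE mxE; set u := enum_val r.
  have /comp_spaceP/(_ c u) W0 := submx_refl W.
  rewrite (eq_bigr (fun b => (fun v => (comp_card F u)%:R^-1 *
     ((same_comp F u v)%:R * (W c (enum_rank v))^*)) (enum_val b))); last first.
    move=> b _; rewrite !mxE enum_valK -/u (inj_eq enum_val_inj) opprB addrC subrK.
    by rewrite mulrA [_^-1 * _]mulrC.
  rewrite (sum_enum_val (fun v => (comp_card F u)%:R^-1 *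
     ((same_comp F u v)%:R * (W c (enum_rank v))^*))) -mulr_sumr.
  rewrite (eq_bigr (fun v => (if same_comp F v u then W c (enum_rank v) else 0)^*)).
    by rewrite -rmorph_sum -big_mkcond W0 rmorph0 mulr0.
  by move=> v _; rewrite cC; case: ifP; rewrite ?mul1r // mul0r rmorph0.
have QE : Q *m P = Q by rewrite proj_ortho_id.
by rewrite -QE -[P in LHS]mul1mx -[1%:M in LHS](subrK Q) mulmxDl QP add0r.
Qed.

End CompProjection.

Section BlockCompat.

Variables (C : comPzRingType) (S T : finType).

Definition sum_ordl (x : 'I_#|S|) : 'I_#|{: S + T}| := enum_rank (inl (enum_val x)).
Definition sum_ordr (y : 'I_#|T|) : 'I_#|{: S + T}| := enum_rank (inr (enum_val y)).

Lemma sum_ordlE x : sum_ordl x = x :> nat.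
Proof. by rewrite enum_rank_inl enum_valK. Qed.

Lemma sum_ordrE y : sum_ordr y = (#|S| + y)%N :> nat.
Proof. by rewrite enum_rank_inr enum_valK. Qed.

Definition sum_block (M : 'M[C]_#|{: S + T}|) (MA : 'M[C]_#|S|) (MB : 'M[C]_#|T|) :=
  [/\ forall x y, M (sum_ordl x) (sum_ordl y) = MA x y,
      forall x y, M (sum_ordr x) (sum_ordr y) = MB x y,
      forall x y, M (sum_ordl x) (sum_ordr y) = 0
    & forall x y, M (sum_ordr x) (sum_ordl y) = 0].

Lemma sum_block_mul M MA MB M' MA' MB' :
  sum_block M MA MB -> sum_block M' MA' MB' ->
  sum_block (M *m M') (MA *m MA') (MB *m MB').
Proof.
case=> M1 M2 M3 M4 [M1' M2' M3' M4'].
have E a b : (M *m M') a b = \sum_x M a (sum_ordl x) * M' (sum_ordl x) b +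
    \sum_y M a (sum_ordr y) * M' (sum_ordr y) b.
  rewrite mxE; transitivity (\sum_(z : S + T) M a (enum_rank z) * M' (enum_rank z) b).
    rewrite -(sum_enum_val (fun z => M a (enum_rank z) * M' (enum_rank z) b)).
    by apply: eq_bigr => c _; rewrite enum_valK.
  rewrite big_sumType /= -(sum_enum_val (fun z => M a (enum_rank (inl z)) *
    M' (enum_rank (inl z)) b)); congr (_ + _).
  by rewrite -(sum_enum_val (fun z => M a (enum_rank (inr z)) *
    M' (enum_rank (inr z)) b)).
split=> x y; rewrite E.
- rewrite [RHS]mxE [X in _ + X]big1 ?addr0 => [|z _]; last by rewrite M3 mul0r.
  by apply: eq_bigr => z _; rewrite M1 M1'.
- rewrite [RHS]mxE [X in X + _]big1 ?add0r => [|z _]; last by rewrite M4 mul0r.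
  by apply: eq_bigr => z _; rewrite M2 M2'.
- by rewrite !big1 ?addr0 // => z _; rewrite ?M3 ?M3' ?mul0r ?mulr0.
by rewrite !big1 ?addr0 // => z _; rewrite ?M4 ?M4' ?mul0r ?mulr0.
Qed.

Lemma sum_block_fun (k : S + T -> S + T -> C) kA kB :
    (forall x y, k (inl x) (inl y) = kA x y) ->
    (forall x y, k (inr x) (inr y) = kB x y) ->
    (forall x y, k (inl x) (inr y) = 0) -> (forall x y, k (inr x) (inl y) = 0) ->
  sum_block (fun_mx k) (fun_mx kA) (fun_mx kB).
Proof. by move=> k1 k2 k3 k4; split=> x y; rewrite !mxE !enum_rankK. Qed.

End BlockCompat.

Lemma perm_sum_inj (S T : finType) : injective (@perm_sum S T).
Proof. by move=> s t E; apply: (injmP (perm_sum_injm S T)); rewrite ?inE. Qed.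

(** * States, components and Young subgroups of a disjoint union *)

Section DisjointUnion.

Variables A B : graph.

Local Notation AB := (disjoint_union A B).

Definition union_state (FA : {set edge A}) (FB : {set edge B}) : {set edge AB} :=
  [set e : edge AB | match e with inl x => x \in FA | inr y => y \in FB end].

Lemma union_stateK (F : {set edge AB}) :
  union_state [set x | (inl x : edge AB) \in F] [set y | (inr y : edge AB) \in F] = F.
Proof. by apply/setP=> -[x|y]; rewrite !inE. Qed.

Lemma union_state_eq FA FB FA' FB' :
  (union_state FA FB == union_state FA' FB') = (FA == FA') && (FB == FB').
Proof.
apply/eqP/andP=> [/setP E | [/eqP-> /eqP->]//]; split; apply/eqP/setP=> x.
  by have := E (inl x); rewrite !inE.
by have := E (inr x); rewrite !inE.
Qed.

Lemma sum_union_state (R : nmodType) FA FB (f : edge AB -> R) :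
  \sum_(e in union_state FA FB) f e =
  \sum_(x in FA) f (inl x) + \sum_(y in FB) f (inr y).
Proof.
rewrite big_sumType; congr (_ + _); by apply: eq_bigl => x; rewrite inE.
Qed.

Lemma card_union_state FA FB : #|union_state FA FB| = (#|FA| + #|FB|)%N.
Proof.
rewrite -!sum1_card big_sumType.
by congr (_ + _)%N; apply: eq_bigl => x; rewrite inE.
Qed.

Lemma union_stateD1l FA FB x :
  union_state FA FB :\ (inl x : edge AB) = union_state (FA :\ x) FB.
Proof. by apply/setP=> -[y|y]; rewrite !inE. Qed.

Lemma union_stateD1r FA FB y :
  union_state FA FB :\ (inr y : edge AB) = union_state FA (FB :\ y).
Proof. by apply/setP=> -[x|x]; rewrite !inE. Qed.

Section Components.

Variables (FA : {set edge A}) (FB : {set edge B}).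
Local Notation F := (union_state FA FB).

Lemma adjacent_union (u v : vertex AB) : adjacent F u v =
  match u, v with
  | inl u, inl v => adjacent FA u v
  | inr u, inr v => adjacent FB u v
  | _, _ => false
  end.
Proof.
apply/existsP/idP => [[[e|e]] | ]; rewrite ?inE.
- case/andP=> Fe; rewrite /= !xpair_eqE; case: u v => u [] v /=; rewrite ?andbF //.
  move=> uv; apply/existsP; exists e; rewrite Fe /=.
  by case: (ends e) uv => x y; rewrite !xpair_eqE.
- case/andP=> Fe; rewrite /= !xpair_eqE; case: u v => u [] v /=; rewrite ?andbF //.
  move=> uv; apply/existsP; exists e; rewrite Fe /=.
  by case: (ends e) uv => x y; rewrite !xpair_eqE.
case: u v => u [] v // /existsP[e /andP[Fe uv]].
  exists (inl e); rewrite inE Fe /=.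
  by case: (ends e) uv => x y; rewrite !xpair_eqE.
exists (inr e); rewrite inE Fe /=.
by case: (ends e) uv => x y; rewrite !xpair_eqE.
Qed.

Lemma same_comp_union (u v : vertex AB) : same_comp F u v =
  match u, v with
  | inl u, inl v => same_comp FA u v
  | inr u, inr v => same_comp FB u v
  | _, _ => false
  end.
Proof.
apply/idP/idP; last first.
  case: u v => u [] v // /connectP[p pP ->]; elim: p u pP => [|w p IHp] u /=;
    try by rewrite /same_comp connect0.
    case/andP=> uw /IHp; apply: connect_trans; apply: connect1.
    by rewrite adjacent_union.
  case/andP=> uw /IHp; apply: connect_trans; apply: connect1.
  by rewrite adjacent_union.
case/connectP=> p pP ->; elim: p u pP => [|w p IHp] u /=.
  by case: u => u _; rewrite /same_comp connect0.
case/andP; rewrite adjacent_union => uw /IHp.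
case: u uw => u; case: w {IHp} => w // /connect1; case: (last _ _) => z //.
  exact: connect_trans.
exact: connect_trans.
Qed.

Lemma comp_group_unionE (g : {perm vertex A} * {perm vertex B}) :
  (perm_sum g \in comp_group F) = (g.1 \in comp_group FA) && (g.2 \in comp_group FB).
Proof.
rewrite !inE; apply/forallP/andP => [Fg | [/forallP gA /forallP gB] [u|u]].
  by split; apply/forallP=> u; [have := Fg (inl u) | have := Fg (inr u)];
    rewrite same_comp_union permE.
  by rewrite same_comp_union permE /= gA.
by rewrite same_comp_union permE /= gB.
Qed.

(** No component meets both vertex sets, so g preserves each of them. Thus the Young subgroup of
    every state lies in S_A x S_B, which makes the complex an induced one. *)
Lemma comp_group_union_perm_sum (g : {perm vertex AB}) :
  g \in comp_group F -> exists h, g = perm_sum h.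
Proof.
rewrite inE => /forallP Fg.
have gA u : exists v, g (inl u) == inl v.
  by have := Fg (inl u); rewrite same_comp_union; case: (g _) => // v _; exists v.
have gB u : exists v, g (inr u) == inr v.
  by have := Fg (inr u); rewrite same_comp_union; case: (g _) => // v _; exists v.
pose a u := xchoose (gA u); pose b u := xchoose (gB u).
have aE u : g (inl u) = inl (a u) by apply/eqP/(xchooseP (gA u)).
have bE u : g (inr u) = inr (b u) by apply/eqP/(xchooseP (gB u)).
have inj_a : injective a.
  by move=> u v uv; have : inl u = inl v :> vertex AB;
    [apply: (@perm_inj _ g); rewrite !aE uv | case].
have inj_b : injective b.
  by move=> u v uv; have : inr u = inr v :> vertex AB;
    [apply: (@perm_inj _ g); rewrite !bE uv | case].
exists (perm inj_a, perm inj_b); apply/permP=> -[u|u].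
  by rewrite aE permE /= permE.
by rewrite bE permE /= permE.
Qed.

Lemma card_comp_group_union :
  #|comp_group F| = (#|comp_group FA| * #|comp_group FB|)%N.
Proof.
rewrite -cardsX -(card_imset _ (@perm_sum_inj _ _)).
apply: eq_card => g; apply/idP/imsetP => [Fg | [h Fh ->]].
  have [h gE] := comp_group_union_perm_sum Fg; exists h => //.
  by rewrite inE -comp_group_unionE -gE.
by move: Fh; rewrite comp_group_unionE inE.
Qed.

Variable C : numClosedFieldType.

Lemma comp_card_union (u : vertex AB) : comp_card F u =
  match u with inl u => comp_card FA u | inr u => comp_card FB u end.
Proof.
have inl_inj : injective (inl : vertex A -> vertex AB) by move=> ? ? [].
have inr_inj : injective (inr : vertex B -> vertex AB) by move=> ? ? [].
case: u => u; rewrite /comp_card.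
  rewrite -(card_imset _ inl_inj); apply: eq_card => w; rewrite inE same_comp_union.
  apply/idP/imsetP => [|[v]]; last by rewrite inE => uv ->.
  by case: w => // v uv; exists v; rewrite ?inE.
rewrite -(card_imset _ inr_inj); apply: eq_card => w; rewrite inE same_comp_union.
apply/idP/imsetP => [|[v]]; last by rewrite inE => uv ->.
by case: w => // v uv; exists v; rewrite ?inE.
Qed.

(** In the averaging formula, both the relation of lying in one component and the size of a
    component are those of the part that contains the vertex. *)
Lemma proj_comp_space_union :
  sum_block (proj_ortho (comp_space C F)) (proj_ortho (comp_space C FA))
    (proj_ortho (comp_space C FB)).
Proof.
rewrite !proj_comp_spaceE; apply: sum_block_fun => u v; rewrite same_comp_union.
- by rewrite comp_card_union.
- by rewrite comp_card_union.
- by rewrite mul0r subr0.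
by rewrite mul0r subr0.
Qed.

End Components.

Lemma vertex_mx_union (C : numClosedFieldType) (a : {perm vertex A})
    (b : {perm vertex B}) :
  sum_block (@vertex_mx C AB (perm_sum (a, b)) : 'M_#|vertex AB|)
    (vertex_mx C a) (vertex_mx C b).
Proof. by apply: sum_block_fun => u v; rewrite permE. Qed.

End DisjointUnion.

(** * Deletion signs for two orders of the edges *)

Section DeletionSign.

Variable E : finType.

Definition rank_sign (C : pzRingType) (lt : rel E) (F : {set E}) (e : E) : C :=
  (-1) ^+ #|[set x in F | lt e x]|.

(** For two total orders, the sign of the permutation of F leading from one to the other: each pair
    on which they disagree is counted once. *)
Definition discord_sign (C : pzRingType) (lt lt' : rel E) (F : {set E}) : C :=
  (-1) ^+ #|[set p in setX F F | lt p.1 p.2 && lt' p.2 p.1]|.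

Lemma discord_sign_sq (C : pzRingType) lt lt' (F : {set E}) :
  discord_sign C lt lt' F * discord_sign C lt lt' F = 1.
Proof. by rewrite -expr2 sqrr_sign. Qed.

(** Rescaling states by [discord_sign] turns the deletion signs of one order into those of the
    other. The numbers of edges after e in the two orders differ, modulo 2, by the number of edges
    placed differently with respect to e, and these form the discordant pairs that disappear with
    e. *)
Lemma discord_signD1 (C : comPzRingType) (lt lt' : rel E) (F : {set E}) e :
    irreflexive lt -> irreflexive lt' ->
    (forall x y, x != y -> lt y x = ~~ lt x y) ->
    (forall x y, x != y -> lt' y x = ~~ lt' x y) -> e \in F ->
  discord_sign C lt lt' F * rank_sign C lt F e =
  discord_sign C lt lt' (F :\ e) * rank_sign C lt' F e.
Proof.
move=> irr irr' anti anti' Fe; rewrite /discord_sign /rank_sign.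
(* [c] detects a discordant pair, [r] an edge that follows e in both orders. *)
pose c x y : nat := lt x y && lt' y x; pose r x : nat := lt e x && lt' e x.
have cardE X : #|[set p in setX X X | lt p.1 p.2 && lt' p.2 p.1]| =
    (\sum_(x in X) \sum_(y in X) c x y)%N.
  rewrite -sum1_card pair_big /= [RHS]big_mkcond [LHS]big_mkcond /=.
  apply: eq_bigr => -[x y] _; rewrite !inE /c /=.
  by case: (x \in X); case: (y \in X) => //=; case: (_ && _).
have rankE (l : rel E) : #|[set x in F | l e x]| = (\sum_(x in F) l e x)%N.
  rewrite -sum1_card [RHS]big_mkcond [LHS]big_mkcond /=; apply: eq_bigr => x _.
  by rewrite inE; case: (x \in F); case: (l e x).
have ltE : (\sum_(x in F) lt e x = \sum_(x in F) c e x + \sum_(x in F) r x)%N.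
  rewrite -big_split /=; apply: eq_bigr => x _; rewrite /c /r.
  have [-> | ne] := eqVneq e x; first by rewrite irr.
  by rewrite (anti' _ _ ne); case: (lt e x); case: (lt' e x).
have lt'E : (\sum_(x in F) lt' e x = \sum_(x in F) c x e + \sum_(x in F) r x)%N.
  rewrite -big_split /=; apply: eq_bigr => x _; rewrite /c /r.
  have [-> | ne] := eqVneq e x; first by rewrite irr' !andbF.
  by rewrite (anti _ _ ne); case: (lt e x); case: (lt' e x).
have FE : (\sum_(x in F) \sum_(y in F) c x y =
    \sum_(x in F) c e x + \sum_(x in F) c x e +
    \sum_(x in F :\ e) \sum_(y in F :\ e) c x y)%N.
  rewrite (big_setD1 e) //= -addnA; congr (_ + _)%N.
  rewrite (big_setD1 e Fe) /= {2}/c irr add0n -big_split /=.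
  by apply: eq_bigr => x _; rewrite (big_setD1 e).
rewrite !cardE !rankE FE ltE lt'E !exprD.
set P := (-1) ^+ _; set Q := (-1) ^+ _; set D := (-1) ^+ _; set R := (-1) ^+ _.
have PP : P * P = 1 by rewrite -expr2 sqrr_sign.
by rewrite [P * Q]mulrC -!mulrA [D * _]mulrCA [P * _]mulrA PP mul1r mulrCA.
Qed.

End DeletionSign.

Lemma mul_diag_framed_mx (K : comPzRingType) (X Y : finType) n n' m m'
    (phi : 'I_n -> X * 'I_m) (psi : 'I_n' -> Y * 'I_m') (d : X -> 'M[K]_m) k :
  bijective phi ->
  framed_mx phi phi (fun x y => if x == y then d x else 0) *m framed_mx phi psi k =
  framed_mx phi psi (fun x z => d x *m k x z).
Proof.
move=> bij_phi; rewrite framed_mx_mul //; apply: eq_framed_mx => x z.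
rewrite (bigD1 x) //= eqxx big1 ?addr0 // => y /negPf.
by rewrite eq_sym => ->; rewrite mul0mx.
Qed.

Lemma mul_framed_diag_mx (K : comPzRingType) (X Y : finType) n n' m m'
    (phi : 'I_n -> X * 'I_m) (psi : 'I_n' -> Y * 'I_m') (d : Y -> 'M[K]_m') k :
  bijective psi ->
  framed_mx phi psi k *m framed_mx psi psi (fun x y => if x == y then d x else 0) =
  framed_mx phi psi (fun x z => k x z *m d z).
Proof.
move=> bij_psi; rewrite framed_mx_mul //; apply: eq_framed_mx => x z.
rewrite (bigD1 z) //= eqxx big1 ?addr0 // => y /negPf ->.
by rewrite mulmx0.
Qed.

(** [R g] translates the second coordinate, so the conjugates of [S] are the diagonal projections
    onto the translates H g, and each group element lies in |H| of these. *)
Lemma sum_conj_framed_mx (K : comPzRingType) (X : finType) (gT : finGroupType) n m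
    (phi : 'I_n -> (X * gT) * 'I_m) (H : {pred gT}) : bijective phi ->
  let R g := framed_mx phi phi (fun z z' =>
    if (z.1 == z'.1) && (z.2 * g == z'.2)%g then 1%:M else 0) in
  let S := framed_mx phi phi (fun z z' => if z == z' then
    if z.2 \in H then 1%:M else 0 else 0) in
  \sum_g R g^-1%g *m S *m R g = #|H|%:R%:M :> 'M[K]_n.
Proof.
move=> bij_phi R S.
rewrite (eq_bigr (fun g => framed_mx phi phi (fun z z' => if z == z' then
   if (z.2 * g^-1)%g \in H then 1%:M else 0 else 0))) => [|g _].
  rewrite framed_mx_sum -[RHS]scalemx1 -(framed_mx1 _ (bij_inj bij_phi)) framed_mxZ.
  apply: eq_framed_mx => z z'.
  case: eqP => _; last by rewrite big1 // scaler0.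
  rewrite (reindex_inj (inj_comp (mulIg z.2) invg_inj)) /=.
  under eq_bigr do rewrite invMg invgK mulKVg.
  by rewrite -big_mkcond sumr_const scaler_nat.
rewrite -mulmxA /R /S mul_diag_framed_mx // framed_mx_mul //.
apply: eq_framed_mx => -[F h] [F' h'] /=.
rewrite (bigD1 (F, h * g^-1)%g) //= !eqxx mul1mx big1 ?addr0 => [|[F1 h1] ne].
  rewrite mulgKV xpair_eqE; case: ifP => _; last by rewrite mul0mx; case: ifP.
  by rewrite mul1mx.
case: ifP => [/andP[/eqP E1 /eqP E2]|_]; last by rewrite mul0mx.
by case/eqP: ne; rewrite E1 E2.
Qed.

Section StateProjection.

Variables (C : numClosedFieldType) (G : graph).

(** The effect on one factor of deleting an edge of the other graph: the state stays, but its
    exterior power is projected once more. Chains do not notice it ([chain_comp_proj]). *)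
Definition comp_proj j := amb_blk_mx (fun z z' : {set edge G} * {perm vertex G} =>
  if z == z' then ext_mx j (proj_ortho (comp_space C z.1)) else 0).

Lemma chain_comp_proj i j : chain_proj C G i j *m comp_proj j = chain_proj C G i j.
Proof.
rewrite chain_projE mul_framed_diag_mx; last exact: amb_frame_bij.
apply: eq_framed_mx => z z'; rewrite /chain_blk.
case: ifP => [/and3P[/eqP<- _ Fz] | _]; last first.
  by rewrite mul0mx.
rewrite -scalemxAl -ext_mx_mul -mulmxA proj_comp_spaceC; last first.
  by rewrite -groupV invMg invgK.
by rewrite mulmxA proj_ortho_proj.
Qed.

End StateProjection.

(** * Tensor products of complexes inside the complex of the union *)

Section UnionEmbedding.

Variables (C : numClosedFieldType) (A B : graph).
Variables (oA : enumeration A) (oB : enumeration B).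
Variable (oAB : enumeration (disjoint_union A B)).

Local Notation AB := (disjoint_union A B).
Local Notation n := #|vertex AB|.
Local Notation nA := #|vertex A|.
Local Notation nB := #|vertex B|.
Local Notation SA := {perm vertex A}.
Local Notation SB := {perm vertex B}.
Local Notation SAB := {perm vertex AB}.
Local Notation XA := ({set edge A} * SA)%type.
Local Notation XB := ({set edge B} * SB)%type.
Local Notation XAB := ({set edge AB} * SAB)%type.

Definition union_index (z : XA * XB) : XAB :=
  (union_state z.1.1 z.2.1, perm_sum (z.1.2, z.2.2)).

Lemma union_index_inj : injective union_index.
Proof.
move=> [[FA a] [FB b]] [[FA' a'] [FB' b']] /eqP; rewrite xpair_eqE /=.
by rewrite union_state_eq => /andP[/andP[/eqP-> /eqP->] /eqP/perm_sum_inj[-> ->]].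
Qed.

Lemma codom_union_index (F : {set edge AB}) (g : SAB) :
  ((F, g) \in codom union_index) = (g \in codom (@perm_sum (vertex A) (vertex B))).
Proof.
apply/codomP/codomP => [[z [_ ->]] | [[a b] ->]]; first by eexists.
exists (([set x | (inl x : edge AB) \in F], a), ([set y | (inr y : edge AB) \in F], b)).
by rewrite /union_index union_stateK.
Qed.

Definition edge_lt : rel (edge AB) := fun x y => (oAB x < oAB y)%N.

(* In this order the sign of an edge e of B in a state of the union counts all
   the edges of A, which gives the sign rule of the tensor product. *)
Definition edge_lt_BA : rel (edge AB) := fun x y =>
  match x, y with
  | inl x, inl y => (oA x < oA y)%N
  | inr x, inr y => (oB x < oB y)%N
  | inr _, inl _ => true
  | inl _, inr _ => false
  end.

(** The enumeration of the edges of the union is arbitrary; this sign compares it with the order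
    placing B before A. *)
Definition union_sign (z : XA * XB) : C :=
  discord_sign C edge_lt edge_lt_BA (union_state z.1.1 z.2.1).

Lemma union_sign_sq z : union_sign z * union_sign z = 1.
Proof. exact: discord_sign_sq. Qed.

Lemma union_signD1 (F : {set edge AB}) e : e \in F ->
  discord_sign C edge_lt edge_lt_BA F * edge_sign C oAB F e =
  discord_sign C edge_lt edge_lt_BA (F :\ e) * rank_sign C edge_lt_BA F e.
Proof.
apply: discord_signD1 => [x|[x|x]|x y ne|[x|x] [y|y] //= ne]; rewrite /= ?ltnn //.
- by rewrite /edge_lt ltnn.
- rewrite /edge_lt ltnNge leq_eqVlt negb_or.
  by rewrite (inj_eq val_inj) (inj_eq (@pos_inj _ oAB)) (negPf ne).
- rewrite ltnNge leq_eqVlt negb_or (inj_eq val_inj) (inj_eq (@pos_inj _ oA)).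
  by rewrite (_ : (x == y) = false) //; apply/eqP=> xy; rewrite xy eqxx in ne.
rewrite ltnNge leq_eqVlt negb_or (inj_eq val_inj) (inj_eq (@pos_inj _ oB)).
by rewrite (_ : (x == y) = false) //; apply/eqP=> xy; rewrite xy eqxx in ne.
Qed.

Lemma rank_sign_BA_l FA FB x :
  rank_sign C edge_lt_BA (union_state FA FB) (inl x) = edge_sign C oA FA x.
Proof.
have inl_inj : injective (inl : edge A -> edge AB) by move=> ? ? [].
congr (_ ^+ _); rewrite -(card_imset _ inl_inj); apply: eq_card => -[y|y].
  by rewrite !inE mem_imset // inE.
by rewrite !inE andbF; apply/esym/imsetP => -[].
Qed.

Lemma rank_sign_BA_r FA FB y : rank_sign C edge_lt_BA (union_state FA FB) (inr y) =
  (-1) ^+ #|FA| * edge_sign C oB FB y.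
Proof.
rewrite /rank_sign /edge_sign -exprD; congr (_ ^+ _).
rewrite -[#|FA|]sum1_card -!sum1_card big_sumType; congr (_ + _)%N; apply: eq_bigl => x.
  by rewrite !inE andbT.
by rewrite !inE.
Qed.

Section Blocks.

Variables (mA mB m : nat) (w : 'M[C]_(mA * mB, m)).

Lemma union_blk_amb a b (x x' : XA * XB) :
  union_sign x *: (w *m (if ((union_index x).1 == (union_index x').1) &&
      ((union_index x).2 * perm_sum (a, b) == (union_index x').2)%g
    then 1%:M else 0)) =
  union_sign x' *: (((if (x.1.1 == x'.1.1) && (x.1.2 * a == x'.1.2)%g then 1%:M else 0)
    *t (if (x.2.1 == x'.2.1) && (x.2.2 * b == x'.2.2)%g then 1%:M else 0)) *m w).
Proof.
move: x x'.
move=> [[FA g] [FB h]] [[FA' g'] [FB' h']] /=.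
rewrite -perm_sumM ?inE // (inj_eq (@perm_sum_inj _ _)) xpair_eqE union_state_eq.
have [<- | _] := eqVneq FA FA'; last by rewrite /= tens0mx mulmx0 mul0mx !scaler0.
have [<- | _] := eqVneq FB FB'; last by rewrite /= tensmx0 mulmx0 mul0mx !scaler0.
rewrite /=; case: eqP => _; last by rewrite /= tens0mx mulmx0 mul0mx !scaler0.
case: eqP => _; last by rewrite /= tensmx0 mulmx0 mul0mx !scaler0.
by rewrite tensmx1 mulmx1 mul1mx.
Qed.

(** Only the bidegree (|FA|, |FB|) contributes, and there the Young subgroup of the union and its
    order are products of those of the parts. *)
Lemma union_blk_chain fA fB fAB i (x x' : XA * XB) :
    (forall FA FB g h, w *m fAB (union_state FA FB) (perm_sum (g, h)) =
       (fA FA g *t fB FB h) *m w) ->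
  union_sign x *: (w *m chain_blk fAB i (union_index x) (union_index x')) =
  union_sign x' *: ((\sum_(z : 'I_i.+1 * 'I_i.+1 | (z.1 + z.2 == i)%N)
     chain_blk fA z.1 x.1 x'.1 *t chain_blk fB z.2 x.2 x'.2) *m w).
Proof.
move=> wf; move: x x'.
move=> [[FA g] [FB h]] [[FA' g'] [FB' h']].
rewrite /chain_blk /= union_state_eq.
have [<- | _] := eqVneq FA FA'; last first.
  by rewrite /= big1 => [|? _]; rewrite ?tens0mx // mulmx0 mul0mx !scaler0.
have [<- | _] := eqVneq FB FB'; last first.
  by rewrite /= big1 => [|? _]; rewrite ?tensmx0 // mulmx0 mul0mx !scaler0.
rewrite /= card_union_state.
have [ci | nci] := eqVneq (#|FA| + #|FB|)%N i; last first.
  rewrite big1 => [|[p r] /= /eqP pr]; first by rewrite mulmx0 mul0mx !scaler0.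
  case: eqP => [cA|_]; last by rewrite tens0mx.
  case: eqP => [cB|_]; last by rewrite tensmx0.
  by case/eqP: nci; rewrite cA cB.
have ltA : (#|FA| < i.+1)%N by rewrite ltnS -ci leq_addr.
have ltB : (#|FB| < i.+1)%N by rewrite ltnS -ci leq_addl.
rewrite (bigD1 (Ordinal ltA, Ordinal ltB)) /= ?ci // !eqxx big1 ?addr0; last first.
  move=> [p r] /andP[_ ne] /=.
  case: eqP => [cA|_]; last by rewrite tens0mx.
  case: eqP => [cB|_]; last by rewrite tensmx0.
  by case/eqP: ne; congr (_, _); apply: val_inj.
have -> : (perm_sum (g', h') * (perm_sum (g, h))^-1)%g =
    perm_sum ((g', h') * (g, h)^-1)%g.
  by rewrite perm_sumM ?inE // (morphV (perm_sum_morphism _ _)) ?inE.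
have -> : (perm_sum (g, h) * (perm_sum (g', h'))^-1)%g =
    perm_sum ((g, h) * (g', h')^-1)%g.
  by rewrite perm_sumM ?inE // (morphV (perm_sum_morphism _ _)) ?inE.
rewrite comp_group_unionE /=.
case: ((g' * g^-1)%g \in _); last by rewrite tens0mx mulmx0 mul0mx !scaler0.
case: ((h' * h^-1)%g \in _); last by rewrite tensmx0 mulmx0 mul0mx !scaler0.
have -> : #|comp_perms (union_state FA FB)| = (#|comp_perms FA| * #|comp_perms FB|)%N.
  exact: card_comp_group_union.
by apply: (scale_tens_intertwines (wf _ _ _ _)); rewrite natrM invfM.
Qed.

(** Deleting an edge of A leaves FB unchanged, but the exterior map of the new state acts on both
    factors, whence [fB] in the first term and symmetrically [fA] in the second. [union_signD1]
    reconciles the signs, and [rank_sign_BA_r] supplies (-1)^|FA| for the edges of B. *)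
Lemma union_blk_diff fA fB fAB (x x' : XA * XB) :
    (forall FA FB, w *m fAB (union_state FA FB) = (fA FA *t fB FB) *m w) ->
  union_sign x *: (w *m diff_blk oAB fAB (union_index x) (union_index x')) =
  union_sign x' *: ((diff_blk oA fA x.1 x'.1 *t (if x.2 == x'.2 then fB x.2.1 else 0)
    + (((-1) ^+ #|x.1.1|)%:M *m (if x.1 == x'.1 then fA x.1.1 else 0))
      *t diff_blk oB fB x.2 x'.2) *m w).
Proof.
move=> wf; move: x x'.
move=> [[FA g] [FB h]] [[FA' g'] [FB' h']]; rewrite /diff_blk /=.
rewrite (inj_eq (@perm_sum_inj _ _)) !xpair_eqE.
have [<- | _] := eqVneq g g'; last first.
  by rewrite /= !andbF mulmx0 tens0mx mulmx0 tens0mx addr0 mul0mx !scaler0.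
have [<- | _] := eqVneq h h'; last first.
  by rewrite /= !andbF !tensmx0 addr0 mulmx0 mul0mx !scaler0.
rewrite /= !andbT.
rewrite big_mkcondr sum_union_state /=.
under eq_bigr do rewrite union_stateD1l union_state_eq.
under [X in _ + X]eq_bigr do rewrite union_stateD1r union_state_eq.
rewrite mulmxDr mulmxDl !scalerDr; congr (_ + _).
  rewrite tensmx_suml mulmx_sumr mulmx_suml !scaler_sumr [RHS]big_mkcondr /=.
  apply: eq_bigr => x FAx; case: eqP => [-> | _]; last by rewrite mulmx0 scaler0.
  rewrite /= [FB == FB']eq_sym; case: eqP => [FBE | _]; last first.
    by rewrite tensmx0 mulmx0 mul0mx !scaler0.
  have Fx : (inl x : edge AB) \in union_state FA FB by rewrite inE.
  have := union_signD1 Fx; rewrite union_stateD1l rank_sign_BA_l => E.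
  subst FB'; rewrite -[fB _]scale1r.
  by apply: (scale_tens_intertwines (wf _ _)); rewrite mulr1; apply: E.
rewrite tensmx_sumr mulmx_sumr mulmx_suml !scaler_sumr [RHS]big_mkcondr /=.
apply: eq_bigr => y FBy; rewrite andbC.
case: eqP => [-> | _]; last by rewrite mulmx0 scaler0.
rewrite /= [FA == FA']eq_sym; case: eqP => [FAE | _]; last first.
  by rewrite !mulmx0 tens0mx mul0mx !scaler0.
have Fy : (inr y : edge AB) \in union_state FA FB by rewrite inE.
have := union_signD1 Fy; rewrite union_stateD1r rank_sign_BA_r => E.
subst FA'; rewrite mul_scalar_mx.
by apply: (scale_tens_intertwines (wf _ _)); apply: E.
Qed.

End Blocks.

Definition union_wedge q s j :
    'M[C]_(#|{: jsub q nA}| * #|{: jsub s nB}|, #|{: jsub j n}|) :=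
  wedge_mx C (@sum_ordl (vertex A) (vertex B)) (@sum_ordr (vertex A) (vertex B)) q s j.

Lemma ext_mx_union_wedge q s j (M : 'M[C]_n) MA MB : (q + s)%N = j ->
    sum_block M MA MB ->
  union_wedge q s j *m ext_mx j M = (ext_mx q MA *t ext_mx s MB) *m union_wedge q s j.
Proof.
move=> qsj [M1 M2 M3 M4].
exact: (ext_mx_wedge (@sum_ordlE _ _) (@sum_ordrE _ _) (card_sum _ _)).
Qed.

(** For q + s = j its image consists of the families supported on permutations in S_A x S_B and with
    exterior bidegree (q, s). *)
Definition union_mx q s j :=
  monomial_mx union_index (@amb_frame AB j)
    (tens_frame (@amb_frame A q) (@amb_frame B s)) union_sign (union_wedge q s j).

Local Notation frame2 q s := (tens_frame (@amb_frame A q) (@amb_frame B s)).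

Lemma frame2_bij q s : bijective (frame2 q s).
Proof. by apply: tens_frame_bij; apply: amb_frame_bij. Qed.

Lemma union_mx_tr q s j : (q + s)%N = j -> union_mx q s j *m (union_mx q s j)^T = 1%:M.
Proof.
move=> qsj; apply: monomial_mx_trmx1.
- exact: union_index_inj.
- exact: amb_frame_bij.
- exact: bij_inj (frame2_bij q s).
- exact: union_sign_sq.
exact: (wedge_mx_tr _ (@sum_ordlE _ _) (@sum_ordrE _ _) qsj).
Qed.

Lemma union_mx_tr0 q s q' s' j : q != q' ->
  union_mx q s j *m (union_mx q' s' j)^T = 0.
Proof.
move=> neq; apply: monomial_mx_trmx0; [exact: amb_frame_bij | exact: union_sign_sq |].
exact: (wedge_mx_tr0 _ (@sum_ordlE _ _) (@sum_ordrE _ _)).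
Qed.

(** Translation by g moves S_A x S_B to a disjoint coset. *)
Lemma union_mx_amb_tr q s q' s' j g :
    g \notin codom (@perm_sum (vertex A) (vertex B)) ->
  union_mx q s j *m amb_mx C (G := AB) j g *m (union_mx q' s' j)^T = 0.
Proof.
move=> ng; rewrite amb_mxE; apply: monomial_mx_trmx_eq0; first exact: amb_frame_bij.
  exact: union_sign_sq.
move=> x y; case: ifP => [/andP[_ /eqP gE] | _]; last by rewrite mulmx0 mul0mx.
case/codomP: ng; exists ((x.1.2, x.2.2)^-1 * (y.1.2, y.2.2))%g.
rewrite perm_sumM ?inE // (morphV (perm_sum_morphism _ _)) ?inE //.
by apply: (canRL (mulKg _)); apply: gE.
Qed.

Lemma union_mx_intertwines q s j k l :
    (forall x y, y \notin codom union_index -> k (union_index x) y = 0) ->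
    (forall x x', union_sign x *:
        (union_wedge q s j *m k (union_index x) (union_index x')) =
      union_sign x' *: (l x x' *m union_wedge q s j)) ->
  union_mx q s j *m amb_blk_mx k =
  framed_mx (frame2 q s) (frame2 q s) l *m union_mx q s j.
Proof.
move=> k0 kl; apply: monomial_mx_intertwines => //.
- exact: union_index_inj.
- exact: amb_frame_bij.
exact: frame2_bij.
Qed.

Lemma union_mx_amb q s j a b :
  union_mx q s j *m amb_mx C (G := AB) j (perm_sum (a, b)) =
  (amb_mx C q a *t amb_mx C s b) *m union_mx q s j.
Proof.
rewrite !amb_mxE tens_framed_mx; apply: union_mx_intertwines; last exact: union_blk_amb.
  move=> x [F g] nxy; case: ifP => // /andP[_ /eqP gE]; case/negP: nxy.
  rewrite codom_union_index; move: gE; rewrite /= -perm_sumM ?inE // => <-.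
  exact: codom_f.
Qed.

Lemma union_mx_chain q s j i : (q + s)%N = j ->
  union_mx q s j *m chain_proj C AB i j =
  tensor_piece (fun p => chain_proj C A p q) (fun r => chain_proj C B r s) i
    *m union_mx q s j.
Proof.
move=> qsj; have pieceE := tensor_piece_framed (k := chain_blk (@comp_ext C A q))
  (l := chain_blk (@comp_ext C B s)) i (fun p => chain_projE C A p q)
  (fun r => chain_projE C B r s).
apply: etrans (congr1 (mulmx^~ _) (esym pieceE)).
rewrite {pieceE} chain_projE; apply: union_mx_intertwines; last first.
  move=> x x'; apply: union_blk_chain => FA FB g h.
  exact: (ext_mx_union_wedge qsj (sum_block_mul (proj_comp_space_union _ _ _)
    (vertex_mx_union _ _ _))).
move=> x [F g] nxy; rewrite /chain_blk.
case: ifP => // /and3P[_ _ /comp_group_union_perm_sum[h gE]].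
case/negP: nxy; rewrite codom_union_index; apply/codomP.
exists (h * (x.1.2, x.2.2))%g; rewrite perm_sumM ?inE // -gE.
by rewrite /= mulgKV.
Qed.

Lemma union_mx_diff q s j : (q + s)%N = j ->
  union_mx q s j *m diff C oAB j =
  (diff C oA q *t comp_proj C B s +
   (grade_sign C A q *m comp_proj C A q) *t diff C oB s) *m union_mx q s j.
Proof.
move=> qsj; have signE : grade_sign C A q *m comp_proj C A q =
      framed_mx (@amb_frame A q) (@amb_frame A q) (fun x z => ((-1) ^+ #|x.1|)%:M *m
        (if x == z then ext_mx q (proj_ortho (comp_space C x.1)) else 0)).
  by rewrite grade_signE mul_diag_framed_mx; last exact: amb_frame_bij.
rewrite (tens_framed_mxD (diff_ambE C oA q) (erefl _) signE (diff_ambE C oB s)).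
rewrite {signE} diff_ambE; apply: union_mx_intertwines; last first.
  move=> x x'; apply: union_blk_diff => FA FB.
  exact: (ext_mx_union_wedge qsj (proj_comp_space_union _ _ _)).
move=> x [F g] nxy; rewrite /diff_blk; case: eqP => // gE; case/negP: nxy.
have {}gE : g = perm_sum (x.1.2, x.2.2) := esym gE.
by rewrite codom_union_index gE; apply: codom_f.
Qed.

(** The bidegrees fill the whole exterior power and every state of the union is a pair of states, so
    only the restriction on the permutation is left. *)
Lemma sum_union_mx j :
  \sum_(x : 'I_j.+1 * 'I_j.+1 | (x.1 + x.2 == j)%N)
    (union_mx x.1 x.2 j)^T *m union_mx x.1 x.2 j =
  amb_blk_mx (fun z z' : XAB => if z == z' then
    if z.2 \in codom (@perm_sum (vertex A) (vertex B)) then 1%:M else 0 else 0).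
Proof.
rewrite (eq_bigr (fun x : 'I_j.+1 * 'I_j.+1 => amb_blk_mx (fun z z' : XAB =>
  if (z == z') && (z \in codom union_index) then
    (union_wedge x.1 x.2 j)^T *m union_wedge x.1 x.2 j else 0))); last first.
  move=> x _; apply: trmx_monomial_mx; [exact: union_index_inj | |].
    exact: frame2_bij.
  exact: union_sign_sq.
rewrite framed_mx_sum; apply: eq_framed_mx => -[F g] z'.
case: eqP => _; last by rewrite big1.
rewrite codom_union_index /=; case: ifP => _; last by rewrite big1.
exact: (sum_wedge_mx _ (@sum_ordlE _ _) (@sum_ordrE _ _) (card_sum _ _)).
Qed.

Definition union_support j := amb_blk_mx (fun z z' : XAB => if z == z' then
    if z.2 \in codom (@perm_sum (vertex A) (vertex B)) then 1%:M else 0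
    else 0 : 'M[C]_#|{: jsub j n}|).

(** A diagonal projection commutes with whatever does not mix permutations inside and outside S_A x
    S_B. The differential fixes the permutation, and the chain projections move it by a Young
    subgroup, which lies inside. *)
Lemma union_supportC j (k : XAB -> XAB -> 'M[C]_#|{: jsub j n}|) :
    (forall z z', (z.2 \in codom (@perm_sum (vertex A) (vertex B))) !=
       (z'.2 \in codom (@perm_sum (vertex A) (vertex B))) -> k z z' = 0) ->
  union_support j *m amb_blk_mx k = amb_blk_mx k *m union_support j.
Proof.
move=> k0; rewrite mul_diag_framed_mx; last exact: amb_frame_bij.
rewrite mul_framed_diag_mx; last exact: amb_frame_bij.
apply: eq_framed_mx => z z'.
have := k0 z z'; case: (z.2 \in _); case: (z'.2 \in _) => /= kz;
  by rewrite ?mulmx1 ?mul1mx ?mulmx0 ?mul0mx // kz.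
Qed.

Lemma union_support_diff j :
  union_support j *m diff C oAB j = diff C oAB j *m union_support j.
Proof.
rewrite diff_ambE; apply: union_supportC => z z'; rewrite /diff_blk.
by move=> neq; case: (z.2 =P z'.2) => // E; rewrite E eqxx in neq.
Qed.

Lemma union_support_chain i j :
  union_support j *m chain_proj C AB i j = chain_proj C AB i j *m union_support j.
Proof.
rewrite chain_projE; apply: union_supportC => -[F g] [F' g'] /= neq.
rewrite /chain_blk /=.
case: ifP => // /and3P[_ _]; rewrite -[F](union_stateK).
case/comp_group_union_perm_sum=> h gE; case/eqP: neq.
apply/codomP/codomP=> -[k E].
  exists (h * k)%g; rewrite perm_sumM ?inE // -gE -E mulgKV //.
exists (h^-1 * k)%g; rewrite perm_sumM ?inE // (morphV (perm_sum_morphism _ _)) ?inE //.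
by rewrite -[perm_sum_morphism _ _ h]/(perm_sum h) -gE -E invMg invgK mulgKV.
Qed.

Lemma sum_conj_support j :
  \sum_g amb_mx C (G := AB) j g^-1%g *m union_support j *m amb_mx C (G := AB) j g =
  #|[set: SA * SB]|%:R%:M.
Proof.
rewrite cardsT -(card_codom (@perm_sum_inj (vertex A) (vertex B))).
apply: etrans (sum_conj_framed_mx _
  (mem (codom (@perm_sum (vertex A) (vertex B)))) (@amb_frame_bij AB j)).
by apply: eq_bigr => g _; rewrite !amb_mxE.
Qed.

End UnionEmbedding.

(** * Application to chromatic symmetric homology *)

Definition chromatic_complex (C : numClosedFieldType) (G : graph) (o : enumeration G)
    (j : nat) : graded_complex C {perm vertex G} :=
  GradedComplex (boundaries_module C o ^~ j) (cycles_module C o ^~ j)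
    (boundaries_eqmx C o ^~ j) (cycles_eqmx C o ^~ j)
    (fun i => @chain_projC C G i j) (fun i k => @chain_proj_mul C G i k j)
    (fun i => @chain_proj_ge C G i j) (chain0_diff C o j)
    (chain_proj_diff C o ^~ j) (diff_diff C o j)
    (fun i => @chain_proj_sign C G i j) (fun i => @sign_chain_proj C G i j)
    (diff_sign C o j).

(** True by conversion because the record stores the given matrices of boundaries and cycles, and
    describes them through idempotents only by equalities of row spaces. *)
Lemma homologyE (C : numClosedFieldType) (G : graph) (o : enumeration G) i j :
  homology C o i j = Representation (gc_homology (chromatic_complex C o j) i).
Proof. by []. Qed.

Lemma union_support_amb (C : numClosedFieldType) (A B : graph) j
    (h : {perm vertex A} * {perm vertex B}) :
  union_support C A B j *m amb_mx C (G := disjoint_union A B) j (perm_sum h) =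
  amb_mx C (G := disjoint_union A B) j (perm_sum h) *m union_support C A B j.
Proof.
rewrite amb_mxE; apply: union_supportC => -[F g] [F' g'] /= neq.
case: ifP => // /andP[_ /eqP gE]; case/eqP: neq; rewrite -gE.
apply/codomP/codomP=> -[k E].
  by exists (k * h)%g; rewrite perm_sumM ?inE // -E.
exists (k * h^-1)%g; rewrite perm_sumM ?inE // (morphV (perm_sum_morphism _ _)) ?inE //.
by apply: (canRL (mulgK _)); apply: E.
Qed.

Section ChromaticKunneth.

Variables (C : numClosedFieldType) (A B : graph).
Variables (oA : enumeration A) (oB : enumeration B).
Variable (oAB : enumeration (disjoint_union A B)).

Lemma chromatic_kunneth (i j : nat) :
  mx_rsim
    (homology C oAB i j)
    (\big[dadd_grepr/grepr0]_(x : ('I_i.+1 * 'I_i.+1) * ('I_j.+1 * 'I_j.+1)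
        | (x.1.1 + x.1.2 == i)%N && (x.2.1 + x.2.2 == j)%N)
      ind_tens (homology C oA x.1.1 x.2.1) (homology C oB x.1.2 x.2.2)).
Proof.
have H := @induced_kunneth C {perm vertex A} {perm vertex B}
  {perm vertex (disjoint_union A B)} (perm_sum_morphism (vertex A) (vertex B))
  (perm_sum_injm _ _) _ (chromatic_complex C oA) (chromatic_complex C oB)
  (chromatic_complex C oAB j) j
  (comp_proj C A) (comp_proj C B) (fun q s => union_mx C oA oB oAB q s j).
rewrite homologyE.
under eq_bigr => x _ do rewrite !homologyE.
refine (H _ _ _ _ _ _ _ _ _ _ _ _ _ i) => {i H}.
- by move=> m; rewrite pnatr_eq0.
- by move=> q s; apply: union_mx_tr.
- by move=> q s q' s'; apply: union_mx_tr0.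
- move=> q s q' s' g ng; apply: union_mx_amb_tr; apply: contra ng => /codomP[h ->].
  by apply: (mem_morphim (perm_sum_morphism _ _)); rewrite inE.
- by move=> q s a b _; apply: union_mx_amb.
- by move=> q s i; apply: union_mx_chain.
- by move=> q s; apply: union_mx_diff.
- by move=> q p; apply: chain_comp_proj.
- by move=> q p; apply: chain_comp_proj.
- by move=> h; rewrite sum_union_mx; apply: union_support_amb.
- by move=> i; rewrite sum_union_mx; apply: union_support_chain.
- by rewrite sum_union_mx; apply: union_support_diff.
rewrite sum_union_mx; apply: sum_conj_support.
Qed.

End ChromaticKunneth.

Theorem proposition3p3 (R : realType) (A B : graph)
    (oA : enumeration A) (oB : enumeration B)
    (oAB : enumeration (disjoint_union A B)) (i j : nat) :
  mx_rsim
    (homology R[i] oAB i j)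
    (\big[dadd_grepr/grepr0]_(x : ('I_i.+1 * 'I_i.+1) * ('I_j.+1 * 'I_j.+1)
        | (x.1.1 + x.1.2 == i)%N && (x.2.1 + x.2.2 == j)%N)
      ind_tens (homology R[i] oA x.1.1 x.2.1) (homology R[i] oB x.1.2 x.2.2)).
Proof. exact: (@chromatic_kunneth R[i] A B oA oB oAB i j). Qed.
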